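(* Let $n=pq$ be an RSA modulus. If the Grand Riemann Hypothesis is true, then the following algorithm (which uses the oracle $\mathcal O$ described in the context) runs in polynomial time, and the number $d$ given by it is a prime divisor of $n$: (1) Set $m=2$. (2) Send $(c,m)$ to $\mathcal O$. (3) If $\mathcal O$ returns $\perp$, replace $m$ by $m+1$ and go to (2). Otherwise let $S$ be the set returned by $\mathcal O$ and continue. (4) Take $r\in S$ with $r\notin S_m\cup\{1\}$, and compute $d=\gcd(r-1,n)$.
   Context: An RSA modulus is a product $n=pq$ of two primes, labelled so that $p<q$. Notation: for an integer $m\ge 2$ let $n'_m=m^n+1$ and let $S_m=\{r \bmod n : r\text{ prime},\ r\mid (m+1)\}$. Let $\omega(k)$ denote the number of distinct prime factors of $k$. Let $c$ be the binary encoding of $2^n+1$, that is, a $1$, then $n-1$ zeros, then a $1$; the base-$m$ representation of $m^n+1$ is always $c$, independently of $m$, so the pair $(c,m)$ specifies $n'_m$. Oracle $\mathcal O$: it is assumed that there is an oracle which, on input $(c,m)$, returns a set $S$ of residue classes modulo $n$ of prime factors of $n'_m$, of size $|S|=\omega(m)+2$, when such a set $S$ exists, and otherwise returns $\perp$. All that is needed is the residue class modulo $n$ of one factor of $n'_m$ different from $1$ and from the classes of the prime divisors of $m+1$; hence, if convenient, one may instead take $S$ to be a set of polynomial size with $S\subset\{r\bmod n : r \text{ prime},\ r\mid n'_m\}$ and $S\not\subseteq S_m\cup\{1\}$. Membership in $S_m\cup\{1\}$ is understood for residue classes modulo $n$. *)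

(* Defs.v *)
From HB Require Import structures.
From mathcomp Require Import all_boot all_order all_algebra.
From mathcomp Require Import complex.
From mathcomp Require Import all_classical all_reals all_analysis.
Set Implicit Arguments.
Unset Strict Implicit.
Unset Printing Implicit Defensive.
Import Order.TTheory GRing.Theory Num.Theory.
Import numFieldNormedType.Exports.
Local Open Scope classical_set_scope.
Local Open Scope ring_scope.
Local Open Scope complex_scope.

(** * The Riemann hypothesis for Dirichlet L-functions *)

Record dirichlet_character (R : realType) (N : nat) (chi : nat -> R[i]) : Prop :=
  DirichletCharacter {
    dirichlet1 : chi 1%N = 1;
    dirichletM : forall a b, chi (a * b)%N = chi a * chi b;
    dirichlet_period : forall a, chi (a + N)%N = chi a;
    dirichlet_neq0 : forall a, (chi a != 0) = coprime a N }.

(* k ^ (- s) = exp (- s ln k), for k > 0 *)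
Definition natpowN (R : realType) (k : nat) (s : R[i]) : R[i] :=
  let x := complex.Re s * ln (k%:R : R) in
  let y := complex.Im s * ln (k%:R : R) in
  (expR (- x) * cos y) -i* (expR (- x) * sin y).

(* L is the analytic continuation of sum_(k >= 1) chi(k) k^(-s) to the half-plane
   Re s > 0 punctured at s = 1 (the value L 1 is unconstrained).  The notation
   R[i]^o only selects the normed R[i]-module structure of R[i], so that
   derivable means complex differentiable. *)
Definition dirichlet_L_function (R : realType) (chi : nat -> R[i])
    (L : R[i]^o -> R[i]^o) : Prop :=
  (forall s : R[i], 1 < complex.Re s ->
     (fun K : nat => \sum_(1 <= k < K) chi k * natpowN k s : R[i]^o) @ \oo
       --> L s) /\
  (forall s : R[i], 0 < complex.Re s -> s != 1 -> derivable L s 1).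

(* All Dirichlet characters are covered: the principal ones (the zeta function
   for N = 1) and the imprimitive ones, whose extra Euler factors only vanish on
   the line Re s = 0. *)
Definition GRH (R : realType) : Prop :=
  forall (N : nat) (chi : nat -> R[i]) (L : R[i]^o -> R[i]^o),
    (0 < N)%N -> dirichlet_character N chi -> dirichlet_L_function chi L ->
    forall s : R[i], 0 < complex.Re s < 1 -> L s = 0 ->
      complex.Re s = 1 / 2.

(** * The oracle *)

Local Close Scope ring_scope.
Local Open Scope nat_scope.

Definition rsa_modulus (n : nat) : Prop :=
  exists p q, [/\ prime p, prime q, p < q & n = p * q].

Definition bitlen (k : nat) : nat := (trunc_log 2 k).+1.

(* the binary expansion of 2 ^ n + 1, most significant digit first (n > 0) *)
Definition code (n : nat) : seq bool := true :: rcons (nseq n.-1 false) true.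

(* residue classes modulo n are represented by their elements in [0, n) *)
Definition factor_classes (n m : nat) : seq nat :=
  [seq r %% n | r <- primes (m ^ n + 1)].

Definition S_classes (n m : nat) : seq nat :=
  [seq r %% n | r <- primes (m + 1)].

Definition admissible (n m : nat) (A : seq nat) : Prop :=
  [/\ uniq A,
      {subset A <= factor_classes n m}
    & ~ {subset A <= 1 %% n :: S_classes n m}].

(* None is the answer "bottom" *)
Definition oracle := seq bool -> nat -> option (seq nat).

(* The size of an answer is polynomial in the sizes of n and m, with a bound Q
   that does not depend on the modulus. *)
Definition oracle_spec (Q : {poly nat}) (n : nat) (O : oracle) : Prop :=
  forall m, 2 <= m ->
    if O (code n) m is Some A
    then admissible n m A /\ size A <= Q.[bitlen n + bitlen m]%R
    else forall A, ~ admissible n m A.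

(** * Machine model: while programs with an oracle, at bit cost *)

(* ans is the last answer of the oracle *)
Record state := State { reg : nat -> nat; ans : option (seq nat) }.

Inductive binop := opAdd | opSub | opMod | opEq | opLt.

(* Ans e is the element of index e of the last answer, and Bot tests whether
   that answer was bottom. Truth values are 0 and 1. *)
Inductive expr :=
  | Cst of nat
  | Var of nat
  | Bin of binop & expr & expr
  | Ans of expr
  | Bot.

(* Ask e1 e2 submits the query (code e1, e2). *)
Inductive cmd :=
  | Skip
  | Assign of nat & expr
  | Ask of expr & expr
  | Seq of cmd & cmd
  | If of expr & cmd & cmd
  | While of expr & cmd.

Definition binop_val (o : binop) (a b : nat) : nat :=
  match o with
  | opAdd => a + b
  | opSub => a - b
  | opMod => a %% b
  | opEq => a == b
  | opLt => a < b
  end.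

Definition answer (st : state) : seq nat := odflt [::] (ans st).

Fixpoint val_expr (st : state) (e : expr) : nat :=
  match e with
  | Cst k => k
  | Var x => reg st x
  | Bin o e1 e2 => binop_val o (val_expr st e1) (val_expr st e2)
  | Ans e1 => nth 0 (answer st) (val_expr st e1)
  | Bot => ans st == None
  end.

(* Bit operations of the schoolbook algorithms. A list is read sequentially, so
   that reading one of its elements costs its total length. *)
Definition list_cost (s : seq nat) : nat := (\sum_(x <- s) bitlen x).+1.

Fixpoint cost_expr (st : state) (e : expr) : nat :=
  match e with
  | Cst k => bitlen k
  | Var x => bitlen (reg st x)
  | Bin o e1 e2 =>
      cost_expr st e1 + cost_expr st e2
      + bitlen (val_expr st e1) * bitlen (val_expr st e2)
  | Ans e1 => cost_expr st e1 + list_cost (answer st)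
  | Bot => 1
  end.

Definition update (st : state) (x v : nat) : state :=
  State (fun y => if y == x then v else reg st y) (ans st).

Definition query (O : oracle) (n m : nat) (st : state) : state :=
  State (reg st) (O (code n) m).

(* run O c st st' t: started in state st, the program c stops in state st' after
   t bit operations. A query (code n, m) is charged the lengths of n and m, which
   specify it, and the length of its answer; the n + 1 digits of code n are not
   charged, since writing them out is exponential in the length of n. *)
Inductive run (O : oracle) : cmd -> state -> state -> nat -> Prop :=
  | run_skip st : run O Skip st st 1
  | run_set st x e :
      run O (Assign x e) st (update st x (val_expr st e)) (cost_expr st e).+1
  | run_ask st e1 e2 (st' := query O (val_expr st e1) (val_expr st e2) st) :
      run O (Ask e1 e2) st st'
        (cost_expr st e1 + cost_expr st e2 + list_cost (answer st'))
  | run_seq st st1 st2 c1 c2 t1 t2 :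
      run O c1 st st1 t1 -> run O c2 st1 st2 t2 ->
      run O (Seq c1 c2) st st2 (t1 + t2)
  | run_if st st' e c1 c2 t :
      run O (if val_expr st e != 0 then c1 else c2) st st' t ->
      run O (If e c1 c2) st st' (cost_expr st e + t)
  | run_while_stop st e c :
      val_expr st e = 0 -> run O (While e c) st st (cost_expr st e)
  | run_while_loop st st1 st2 e c t1 t2 :
      val_expr st e != 0 -> run O c st st1 t1 -> run O (While e c) st1 st2 t2 ->
      run O (While e c) st st2 (cost_expr st e + t1 + t2).

Lemma run_det O c st st1 t1 st2 t2 :
  run O c st st1 t1 -> run O c st st2 t2 -> st1 = st2 /\ t1 = t2.
Proof.
move=> H; elim: H st2 t2 => {c st st1 t1}.
- by move=> st st2 t2 H; inversion H.
- by move=> st x e st2 t2 H; inversion H.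
- by move=> st e1 e2 st' st2 t2 H; inversion H.
- move=> st st1 st2 c1 c2 t1 t2 _ IH1 _ IH2 st3 t3.
  inversion 1 as [| | |? sa ? ? ? ? ? Ha Hb| | |]; subst.
  by have [? ?] := IH1 _ _ Ha; subst; have [? ?] := IH2 _ _ Hb; subst.
- move=> st st' e c1 c2 t _ IH st3 t3.
  inversion 1 as [| | | |? ? ? ? ? ? Ha| |]; subst.
  by have [? ?] := IH _ _ Ha; subst.
- move=> st e c He st3 t3.
  inversion 1 as [| | | | | |? ? ? ? ? ? ? Hne Ha Hb]; subst=> //.
  by rewrite He in Hne.
- move=> st st1 st2 e c t1 t2 Hne _ IH1 _ IH2 st3 t3.
  inversion 1 as [| | | | |? ? ? He|? sa ? ? ? ? ? _ Ha Hb]; subst.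
    by rewrite He in Hne.
  by have [? ?] := IH1 _ _ Ha; subst; have [? ?] := IH2 _ _ Hb; subst.
Qed.

(** * The algorithm *)

Declare Scope prog_scope.
Delimit Scope prog_scope with prog.
Bind Scope prog_scope with expr.
Bind Scope prog_scope with cmd.

Coercion Cst : nat >-> expr.
Notation "x ::= e" := (Assign x e%prog)
  (at level 75, no associativity) : prog_scope.
Notation "c1 ;; c2" := (Seq c1%prog c2%prog)
  (at level 80, right associativity) : prog_scope.
Notation "$ x" := (Var x) (at level 1, x at level 0, format "$ x") : prog_scope.
Notation "e1 + e2" := (Bin opAdd e1 e2) : prog_scope.
Notation "e1 - e2" := (Bin opSub e1 e2) : prog_scope.
Notation "e1 %% e2" := (Bin opMod e1 e2) : prog_scope.
Notation "e1 == e2" := (Bin opEq e1 e2) : prog_scope.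
Notation "e1 < e2" := (Bin opLt e1 e2) : prog_scope.

Module Reg.
Definition n := 0.
Definition m := 1.
Definition i := 2.
Definition r := 3.
Definition bad := 4.
Definition s := 5.
Definition t := 6.
Definition a := 7.
Definition b := 8.
Definition d := 9.
End Reg.

(* m := the least integer >= 2 for which the oracle does not answer bottom *)
Definition find_m : cmd := (
  Reg.m ::= 2 ;;
  Ask $Reg.n $Reg.m ;;
  While Bot (
    Reg.m ::= $Reg.m + 1 ;;
    Ask $Reg.n $Reg.m))%prog.

(* bad := (r = 1 or r in S_m), as classes modulo n. The inner loop computes the
   least divisor t >= 2 of s, so that s is prime exactly when t = s. *)
Definition test_r : cmd := (
  Reg.bad ::= $Reg.r == 1 %% $Reg.n ;;
  Reg.s ::= 2 ;;
  While ($Reg.s < $Reg.m + 2) (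
    Reg.t ::= 2 ;;
    While ($Reg.s %% $Reg.t) (Reg.t ::= $Reg.t + 1) ;;
    If ($Reg.t == $Reg.s)
      (If (($Reg.m + 1) %% $Reg.s == 0)
        (If ($Reg.r == $Reg.s %% $Reg.n) (Reg.bad ::= 1) Skip)
        Skip)
      Skip ;;
    Reg.s ::= $Reg.s + 1))%prog.

(* r := the first element of S that is neither 1 nor in S_m *)
Definition find_r : cmd := (
  Reg.i ::= 0 ;;
  Reg.bad ::= 1 ;;
  While $Reg.bad (
    Reg.r ::= Ans $Reg.i ;;
    test_r ;;
    Reg.i ::= $Reg.i + 1))%prog.

(* d := gcd (r - 1, n) *)
Definition compute_d : cmd := (
  Reg.a ::= $Reg.r - 1 ;;
  Reg.b ::= $Reg.n ;;
  While $Reg.b (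
    Reg.t ::= $Reg.a %% $Reg.b ;;
    Reg.a ::= $Reg.b ;;
    Reg.b ::= $Reg.t) ;;
  Reg.d ::= $Reg.a)%prog.

Definition algorithm : cmd := (find_m ;; find_r ;; compute_d)%prog.

Definition input (n : nat) : state :=
  State (fun x => if x == Reg.n then n else 0) None.

Definition output (st : state) : nat := reg st Reg.d.

(* Main.v *)
Require Import Defs.
From mathcomp Require Import all_boot all_order all_algebra.
From mathcomp Require Import cyclic separable cyclotomic finfield.
From mathcomp Require Import complex.
From mathcomp Require Import all_classical all_reals all_analysis.
From mathcomp Require Import zify ring lra.
Set Implicit Arguments.
Unset Strict Implicit.
Unset Printing Implicit Defensive.
Import Order.TTheory GRing.Theory Num.Theory.
Import numFieldNormedType.Exports.

(** If a prime factor r of m ^ n + 1 does not divide m + 1, then r - 1 has a common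
    factor with n, since otherwise m = -1 modulo r; so gcd (r - 1, n) is p or q unless r = 1
    modulo n.  For odd p such an r is found among the prime factors of
    (m ^ p + 1) / (m + 1): they are 1 modulo p, but not all of them are 1 modulo q unless
    m ^ (p - 1) = 1 modulo q.  So one needs a small m with psi m ^ (p - 1) <> 1, for a
    faithful character psi modulo q.  For small p the polynomial X ^ (p - 1) - 1 has too few
    roots modulo q; for large p this is Ankeny's theorem that, under GRH, a nonprincipal
    character modulo N takes a value other than 1 below a fixed power of log N.

    To prove the latter, expand - L'/L in powers of z at s = 2 - z.  GRH and the
    non-vanishing of L on Re s >= 1 make L (2 - z) zero-free for |z| <= 5/4, so that, by the
    Borel-Caratheodory inequality for the Taylor polynomials of L, the coefficients from
    the K-th on sum up to at most 1 at z = 1, with K of order log log N.  Comparison with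
    zeta bounds the sum of the first K ones by 24 K.  Hence the sum of
    Lambda(n) chi(n) n ^ (- 1 - d) is at most 25 K for all small d > 0; but it is at least
    1 / (16 d) if chi is 1 below an X with X ^ (d / 2) >= 400, and d = 1 / (401 K) is
    absurd. *)

(** * Complex series *)

(** The analysis uses neither contour integrals nor complex logarithms. [L] is handled through
    absolutely convergent double series (Abel summation over n, Taylor expansion in z), and - L'/L
    enters only through Taylor coefficients, tied to those of [L] by Newton's recurrence. A Taylor
    polynomial of [L] obeys the same recurrence as far as its coefficients agree with those of [L],
    which makes the coefficients of - L'/L power sums of inverse roots of a polynomial. The centre 2
    gives |L(2)| >= 1/4 by elementary means; the radius 5/4 keeps 2 - 5/4 above 1/2, and 5/4 > 1
    yields geometric decay at z = 1. The size of K matters because m is found below 2^(O(K)): with K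
    of order log log N this is a power of log N, so that the search over m is polynomial. Only
    classes modulo n are visible to the algorithm, so it is not enough that r does not divide m + 1:
    its class must differ from that of every prime divisor of m + 1. Hence m is also chosen such
    that no prime divisor of m + 1 is 1 modulo p, while r is 1 modulo p. For p = 2, m = 2 and r = 5
    serve. *)

Section ComplexModulus.
Local Open Scope ring_scope.
Local Open Scope complex_scope.
Variable R : realType.
Implicit Types (z w : R[i]) (x y : R).

(** The norm [|z|] is an element of [R[i]]; the modulus is taken in [R] so that real inequalities
    are within reach of linear arithmetic. *)
Definition nrm z : R := Normc.normc z.

Lemma normE z : `|z| = (nrm z)%:C.
Proof. by case: z. Qed.

Lemma nrm_ge0 z : 0 <= nrm z.
Proof. by rewrite -ler0c -normE. Qed.

Lemma nrm0 : nrm 0 = 0. Proof. exact: Normc.normc0. Qed.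

Lemma nrm1 : nrm 1 = 1. Proof. exact: Normc.normc1. Qed.

Lemma nrmM z w : nrm (z * w) = nrm z * nrm w.
Proof. exact: Normc.normcM. Qed.

Lemma nrmV z : nrm z^-1 = (nrm z)^-1.
Proof. exact: Normc.normcV. Qed.

Lemma nrmD z w : nrm (z + w) <= nrm z + nrm w.
Proof. exact: le_normcD. Qed.

Lemma nrmN z : nrm (- z) = nrm z.
Proof. exact: normcN. Qed.

Lemma nrmB z w : nrm (z - w) <= nrm z + nrm w.
Proof. by rewrite -(nrmN w); exact: nrmD. Qed.

Lemma nrmC z w : nrm (z - w) = nrm (w - z).
Proof. by rewrite -nrmN opprB. Qed.

Lemma nrm_tri v z w : nrm (z - w) <= nrm (z - v) + nrm (v - w).
Proof. by rewrite (le_trans _ (nrmD _ _))// addrA subrK. Qed.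

Lemma nrm_lb z w : nrm z - nrm w <= nrm (z + w).
Proof. by rewrite lerBlDr -(nrmN w) (le_trans _ (nrmD _ _))// addrK. Qed.

Lemma nrm_eq0 z : (nrm z == 0) = (z == 0).
Proof. by rewrite -(inj_eq (@complexI R)) -normE rmorph0 normr_eq0. Qed.

Lemma nrm_gt0 z : (0 < nrm z) = (z != 0).
Proof. by rewrite lt_neqAle nrm_ge0 andbT eq_sym nrm_eq0. Qed.

Lemma nrmX z n : nrm (z ^+ n) = nrm z ^+ n.
Proof. by elim: n => [|n IH]; rewrite ?nrm1// !exprS nrmM IH. Qed.

Lemma nrm_real x : nrm x%:C = `|x|.
Proof. by apply: (@complexI R); rewrite -normE normc_def /= expr0n/= addr0 sqrtr_sqr. Qed.

Lemma nrm_nneg x : 0 <= x -> nrm x%:C = x.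
Proof. by move=> x0; rewrite nrm_real ger0_norm. Qed.

Lemma nrm_nat n : nrm n%:R = n%:R.
Proof. by rewrite -(rmorph_nat (real_complex R)) nrm_nneg. Qed.

Lemma nrm_conj z : nrm z^* = nrm z.
Proof. by apply: (@complexI R); rewrite -!normE normcJ. Qed.

Lemma nrm_sum (I : Type) (r : seq I) (P : pred I) (F : I -> R[i]) :
  nrm (\sum_(i <- r | P i) F i) <= \sum_(i <- r | P i) nrm (F i).
Proof.
elim/big_rec2: _ => [|i y z _ H]; first by rewrite nrm0.
by rewrite (le_trans (nrmD _ _))// lerD2l.
Qed.

Lemma nrm_prod (I : Type) (r : seq I) (P : pred I) (F : I -> R[i]) :
  nrm (\prod_(i <- r | P i) F i) = \prod_(i <- r | P i) nrm (F i).
Proof. by elim/big_rec2: _ => [|i y z _ <-]; rewrite ?nrm1 ?nrmM. Qed.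

Lemma nrm_sqr z : nrm z ^+ 2 = complex.Re z ^+ 2 + complex.Im z ^+ 2.
Proof. by case: z => a b; rewrite sqr_sqrtr// addr_ge0 ?sqr_ge0. Qed.

Lemma Re_le_nrm z : `|complex.Re z| <= nrm z.
Proof. by rewrite -lecR -normE normc_ge_Re. Qed.

Lemma Im_le_nrm z : `|complex.Im z| <= nrm z.
Proof.
rewrite -(@ler_pXn2r _ 2) ?nnegrE ?nrm_ge0// nrm_sqr real_normK ?num_real//.
by rewrite lerDr sqr_ge0.
Qed.

Lemma nrm_le_ReIm z : nrm z <= `|complex.Re z| + `|complex.Im z|.
Proof.
rewrite -(@ler_pXn2r _ 2) ?nnegrE ?nrm_ge0 ?addr_ge0// nrm_sqr sqrrD !real_normK ?num_real//.
by rewrite lerD2r lerDl mulrn_wge0// mulr_ge0.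
Qed.

Lemma ReD z w : complex.Re (z + w) = complex.Re z + complex.Re w.
Proof. by case: z; case: w. Qed.

Lemma ImD z w : complex.Im (z + w) = complex.Im z + complex.Im w.
Proof. by case: z; case: w. Qed.

Lemma ReN z : complex.Re (- z) = - complex.Re z.
Proof. by case: z. Qed.

Lemma ImN z : complex.Im (- z) = - complex.Im z.
Proof. by case: z. Qed.

Lemma ReM z w : complex.Re (z * w) =
  complex.Re z * complex.Re w - complex.Im z * complex.Im w.
Proof. by case: z; case: w. Qed.

Lemma ImM z w : complex.Im (z * w) =
  complex.Re z * complex.Im w + complex.Im z * complex.Re w.
Proof. by case: z => a b; case: w => c d. Qed.

Lemma ReMr x z : complex.Re (x%:C * z) = x * complex.Re z.
Proof. by rewrite ReM /= mul0r subr0. Qed.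

Lemma Re_sum (I : Type) (r : seq I) (P : pred I) (F : I -> R[i]) :
  complex.Re (\sum_(i <- r | P i) F i) = \sum_(i <- r | P i) complex.Re (F i).
Proof. by elim/big_rec2: _ => // i y z _ <-; rewrite ReD. Qed.

Lemma Im_sum (I : Type) (r : seq I) (P : pred I) (F : I -> R[i]) :
  complex.Im (\sum_(i <- r | P i) F i) = \sum_(i <- r | P i) complex.Im (F i).
Proof. by elim/big_rec2: _ => // i y z _ <-; rewrite ImD. Qed.

Lemma complexP z w :
  complex.Re z = complex.Re w -> complex.Im z = complex.Im w -> z = w.
Proof. by case: z => a b; case: w => c d /= -> ->. Qed.

Lemma le_addeps x y : (forall e, 0 < e -> x <= y + e) -> x <= y.
Proof. by move=> H; apply/ler_addgt0Pr => e e0; exact: H. Qed.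

End ComplexModulus.

(** * Limits, ordered series, double series and Dirichlet convolution *)

Section HasSum.
Local Open Scope ring_scope.
Local Open Scope complex_scope.
Variable R : realType.
Implicit Types (u v : nat -> R[i]) (l m : R[i]) (a b : nat -> R) (B e : R).

Definition clim u l := forall e, 0 < e ->
  exists N0, forall N, (N0 <= N)%N -> nrm (u N - l) <= e.

(** Convergence of the ordered partial sums, so that conditional convergence is covered: for 0 < Re
    s <= 1 the series of a nonprincipal character is of this kind. *)
Definition has_sum u l := clim (fun N => \sum_(i < N) u i) l.

Definition abs_bounded u B := forall N, \sum_(i < N) nrm (u i) <= B.

Lemma clim_uniq u l m : clim u l -> clim u m -> l = m.
Proof.
move=> ul um; apply/eqP; rewrite -subr_eq0 -nrm_eq0 eq_le nrm_ge0 andbT.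
apply: le_addeps => e e0; rewrite add0r.
have [N1 H1] := ul (e / 2) ltac:(by rewrite divr_gt0).
have [N2 H2] := um (e / 2) ltac:(by rewrite divr_gt0).
have := H1 (maxn N1 N2) (leq_maxl _ _); have := H2 (maxn N1 N2) (leq_maxr _ _).
have := nrm_tri (u (maxn N1 N2)) l m; rewrite (nrmC l (u _)) => h1 h2 h3; lra.
Qed.

Lemma clim_eq u v l : (forall n, u n = v n) -> clim u l -> clim v l.
Proof. by move=> /funext ->. Qed.

Lemma clim_cst l : clim (fun=> l) l.
Proof. by move=> e e0; exists 0%N => N _; rewrite subrr nrm0 ltW. Qed.

Lemma climD u v l m : clim u l -> clim v m -> clim (fun n => u n + v n) (l + m).
Proof.
move=> ul vm e e0.
have [N1 H1] := ul (e / 2) ltac:(by rewrite divr_gt0).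
have [N2 H2] := vm (e / 2) ltac:(by rewrite divr_gt0).
exists (maxn N1 N2) => N; rewrite geq_max => /andP[/H1 h1 /H2 h2].
rewrite opprD addrACA (le_trans (nrmD _ _))//; lra.
Qed.

Lemma climZ c u l : clim u l -> clim (fun n => c * u n) (c * l).
Proof.
move=> ul e e0; have c1 : 0 < nrm c + 1 by have := nrm_ge0 c; lra.
have [N1 H1] := ul (e / (nrm c + 1)) ltac:(by rewrite divr_gt0).
exists N1 => N /H1; rewrite -mulrBr nrmM ler_pdivlMr// mulrC.
by have := nrm_ge0 (u N - l); nra.
Qed.

Lemma climB u v l m : clim u l -> clim v m -> clim (fun n => u n - v n) (l - m).
Proof.
move=> ul /(climZ (-1)) vm; rewrite -mulN1r; apply: clim_eq (climD ul vm) => n.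
by rewrite mulN1r.
Qed.

Lemma climM u v l m : clim u l -> clim v m -> clim (fun n => u n * v n) (l * m).
Proof.
move=> ul vm.
have small : clim (fun n => (u n - l) * (v n - m)) 0.
  move=> e e0.
  have [N1 H1] := ul (Num.min e 1) ltac:(by rewrite lt_min e0 /=).
  have [N2 H2] := vm 1 ltac:(by []).
  exists (maxn N1 N2) => N; rewrite geq_max => /andP[/H1 + /H2].
  rewrite le_min => /andP[h1 _] h2; rewrite subr0 nrmM.
  have := nrm_ge0 (u N - l); have := nrm_ge0 (v N - m); nra.
have := climD small (climD (climZ l vm) (climZ m (climB ul (clim_cst l)))).
rewrite subrr mulr0 addr0 add0r; apply: clim_eq => n; ring.
Qed.

Lemma clim_nrm_le u l B : clim u l -> (forall n, nrm (u n) <= B) -> nrm l <= B.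
Proof.
move=> ul uB; apply: le_addeps => e /ul[N /(_ N (leqnn _))].
have := uB N; have := nrmB (u N) (u N - l); rewrite opprB addrC subrK; lra.
Qed.

Lemma clim_nrm u l e : clim u l -> 0 < e ->
  exists N0, forall N, (N0 <= N)%N -> `|nrm (u N) - nrm l| <= e.
Proof.
move=> ul /ul[N0 H]; exists N0 => N /H h; rewrite ler_norml.
have := nrm_lb (u N) (l - u N); have := nrm_lb l (u N - l).
rewrite !(addrC _ (_ - _)) !subrK (nrmC l); lra.
Qed.

Lemma clim_Re_ge u l B : clim u l -> (forall n, B <= complex.Re (u n)) ->
  B <= complex.Re l.
Proof.
move=> ul uB; apply: le_addeps => e /ul[N /(_ N (leqnn _))].
have := uB N; have := Re_le_nrm (u N - l); rewrite ler_norml ReD ReN; lra.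
Qed.

Lemma clim_sub u l (k : nat -> nat) : clim u l -> (forall n, (n <= k n)%N) ->
  clim (fun n => u (k n)) l.
Proof.
move=> ul kn e /ul[N0 H]; exists N0 => N N0N; apply: H.
exact: leq_trans (kn N).
Qed.

Lemma has_sum_uniq u l m : has_sum u l -> has_sum u m -> l = m.
Proof. exact: clim_uniq. Qed.

Lemma has_sum_eq u v l : (forall n, u n = v n) -> has_sum u l -> has_sum v l.
Proof. by move=> /funext ->. Qed.

Lemma has_sumZ c u l : has_sum u l -> has_sum (fun n => c * u n) (c * l).
Proof. by move=> ul; apply: clim_eq (climZ c ul) => n; rewrite mulr_sumr. Qed.

Lemma has_sumB u v l m : has_sum u l -> has_sum v m ->
  has_sum (fun n => u n - v n) (l - m).
Proof.
by move=> ul vm; apply: clim_eq (climB ul vm) => n; rewrite sumrB.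
Qed.

Lemma has_sum0 : has_sum (fun=> 0) 0.
Proof. by apply: clim_eq (clim_cst 0) => n; rewrite big1. Qed.

Lemma has_sum_nrm_le u l B : has_sum u l -> abs_bounded u B -> nrm l <= B.
Proof.
move=> ul uB; apply: (clim_nrm_le ul) => n.
exact: le_trans (nrm_sum _ _ _) (uB n).
Qed.

Lemma abs_bounded_ge0 u B : abs_bounded u B -> 0 <= B.
Proof. by move=> /(_ 0%N); rewrite big_ord0. Qed.

Lemma abs_bounded_term u B n : abs_bounded u B -> nrm (u n) <= B.
Proof.
move=> /(_ n.+1); rewrite big_ord_recr /=; apply: le_trans.
by rewrite lerDr sumr_ge0// => i _; exact: nrm_ge0.
Qed.

Lemma abs_bounded_le u v B : (forall n, nrm (u n) <= nrm (v n)) ->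
  abs_bounded v B -> abs_bounded u B.
Proof. by move=> uv vB N; apply: le_trans (vB N); apply: ler_sum. Qed.

Lemma abs_boundedZ c u B : abs_bounded u B ->
  abs_bounded (fun n => c * u n) (nrm c * B).
Proof.
move=> uB N; apply: le_trans (ler_wpM2l (nrm_ge0 c) (uB N)).
by rewrite mulr_sumr ler_sum// => i _; rewrite nrmM.
Qed.

Lemma has_sum_drop u l n : has_sum u l ->
  has_sum (fun k => u (n + k)%N) (l - \sum_(i < n) u i).
Proof.
move=> ul; have := climB (clim_sub ul (leq_addl n)) (clim_cst (\sum_(i < n) u i)).
by apply: clim_eq => N; rewrite big_split_ord /= addrAC subrr add0r.
Qed.

Lemma has_sum_dist_le u l n B : has_sum u l ->
  abs_bounded (fun k => u (n + k)%N) B -> nrm (l - \sum_(i < n) u i) <= B.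
Proof. by move=> /(has_sum_drop n); exact: has_sum_nrm_le. Qed.

Lemma has_sum_trunc u n : (forall k, (n <= k)%N -> u k = 0) ->
  has_sum u (\sum_(i < n) u i).
Proof.
move=> u0 e e0; exists n => N /subnKC <-; rewrite big_split_ord /= addrAC subrr add0r.
by rewrite big1 ?nrm0 ?ltW// => i _; rewrite u0// leq_addr.
Qed.

(** An index where [f] nearly attains its supremum. It is applied to partial sums of moduli over
    [nat] and over [nat * nat], where it yields small tails. *)
Lemma nneg_sum_eps (T : Type) (t : T) (f : T -> R) B : (forall x, f x <= B) ->
  forall e, 0 < e -> exists x, forall y, f y <= f x + e.
Proof.
move=> fB e e0; pose S := range f.
have hS : has_sup S by split; [exists (f t), t | exists B => _ [x _ <-]].
have [_ [x _ <-] xe] := sup_adherent e0 hS; exists x => y.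
have := ub_le_sup hS.2 (x := f y) ltac:(by exists y); lra.
Qed.

Lemma abs_bounded_tail u B e : abs_bounded u B -> 0 < e ->
  exists n, forall k, (n <= k)%N -> abs_bounded (fun i => u (k + i)%N) e.
Proof.
move=> uB e0; have [n H] := nneg_sum_eps 0%N uB e0.
exists n => k nk N; have := H (k + N)%N; rewrite big_split_ord /=.
have : \sum_(i < n) nrm (u i) <= \sum_(i < k) nrm (u i).
  rewrite -(subnKC nk) big_split_ord /= lerDl.
  by apply: sumr_ge0 => i _; exact: nrm_ge0.
lra.
Qed.

Lemma real_abs_cvg a B : (forall N, \sum_(i < N) `|a i| <= B) ->
  exists x : R, forall e, 0 < e -> exists N0, forall N, (N0 <= N)%N ->
    `|\sum_(i < N) a i - x| <= e.
Proof.
move=> aB; have nc : cvgn [normed series a].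
  apply: nondecreasing_is_cvgn.
    by apply: nondecreasing_series => n _ _; exact: normr_ge0.
  by exists B => _ [n _ <-]; rewrite /normed_series_of seriesEord; exact: aB.
have /cvg_ex[x /cvgrPdist_le cl] := normed_cvg nc.
exists x => e e0; have [N0 _ H] := cl e e0; exists N0 => N /H.
by rewrite seriesEord /= distrC.
Qed.

Lemma abs_bounded_sum u B : abs_bounded u B -> exists l, has_sum u l.
Proof.
move=> uB.
have [x Hx] := @real_abs_cvg (fun n => complex.Re (u n)) B ltac:(by
  move=> N; apply: le_trans (uB N); apply: ler_sum => i _; exact: Re_le_nrm).
have [y Hy] := @real_abs_cvg (fun n => complex.Im (u n)) B ltac:(by
  move=> N; apply: le_trans (uB N); apply: ler_sum => i _; exact: Im_le_nrm).
exists (x +i* y) => e e0.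
have [N1 H1] := Hx (e / 2) ltac:(by rewrite divr_gt0).
have [N2 H2] := Hy (e / 2) ltac:(by rewrite divr_gt0).
exists (maxn N1 N2) => N; rewrite geq_max => /andP[/H1 h1 /H2 h2].
apply: le_trans (nrm_le_ReIm _) _.
by rewrite ReD ReN ImD ImN Re_sum Im_sum /=; lra.
Qed.

Lemma has_sum_ge u l B : has_sum u l ->
  (exists n, forall k, (n <= k)%N -> B <= complex.Re (\sum_(i < k) u i)) ->
  B <= complex.Re l.
Proof.
move=> ul [n H]; apply: (clim_Re_ge (clim_sub ul (leq_addl n))) => k.
by apply: H; exact: leq_addr.
Qed.

Lemma double_tail (w : nat -> nat -> R) B :
  (forall d j, 0 <= w d j) ->
  (forall D E, \sum_(d < D) \sum_(j < E) w d j <= B) ->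
  forall e, 0 < e -> exists N0, forall N D E, (N0 <= D <= N)%N -> (N0 <= E <= N)%N ->
    \sum_(d < N) \sum_(j < N) w d j <= \sum_(d < D) \sum_(j < E) w d j + e.
Proof.
move=> w0 wB e e0.
have [[D0 E0] H] := @nneg_sum_eps (nat * nat) (0%N, 0%N)
  (fun p => \sum_(d < p.1) \sum_(j < p.2) w d j) B (fun p => wB p.1 p.2) e e0.
exists (maxn D0 E0) => N D E /andP[+ _] /andP[+ _].
rewrite !geq_max => /andP[D0D _] /andP[_ E0E].
apply: le_trans (H (N, N)) _; rewrite lerD2r /=.
rewrite -(subnKC D0D) big_split_ord /= -[leLHS]addr0 lerD//.
  apply: ler_sum => i _; rewrite -(subnKC E0E) big_split_ord /= lerDl.
  exact: sumr_ge0.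
by do 2![apply: sumr_ge0 => ? _].
Qed.

Implicit Type w : nat -> nat -> R[i].

Definition dbl_bounded w B :=
  forall D E, \sum_(d < D) \sum_(j < E) nrm (w d j) <= B.

(** The two sides of the rectangle tend to infinity independently; this is what permits evaluation
    by rows, by columns and along hyperbolas. *)
Definition dbl_sum w l := forall e, 0 < e -> exists N0, forall D E,
  (N0 <= D)%N -> (N0 <= E)%N -> nrm (\sum_(d < D) \sum_(j < E) w d j - l) <= e.

Lemma rect_widen (V : nmodType) (f : nat -> nat -> V) N D E :
  (D <= N)%N -> (E <= N)%N -> \sum_(d < D) \sum_(j < E) f d j =
  \sum_(d < N) \sum_(j < N) if (d < D)%N && (j < E)%N then f d j else 0.
Proof.
move=> DN EN; rewrite (big_ord_widen N (fun d => \sum_(j < E) f d j) DN).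
rewrite big_mkcond; apply: eq_bigr => d _; case: ltnP => _ /=; last by rewrite big1.
by rewrite (big_ord_widen N (fun j => f d j) EN) big_mkcond.
Qed.

(** A term outside the small rectangle occurs at most once on the left and always, in modulus, on
    the right. With [P] constantly true this compares nested rectangles; with [d * j < N] it reaches
    the region under a hyperbola. *)
Lemma region_dist w N (P : rel nat) D E : (D <= N)%N -> (E <= N)%N ->
  (forall d j, (d < D)%N -> (j < E)%N -> P d j) ->
  nrm (\sum_(d < N) \sum_(j < N | P d j) w d j - \sum_(d < D) \sum_(j < E) w d j)
  <= \sum_(d < N) \sum_(j < N) nrm (w d j)
     - \sum_(d < D) \sum_(j < E) nrm (w d j).
Proof.
move=> DN EN HP; rewrite (rect_widen w DN EN).
rewrite (rect_widen (fun d j => nrm (w d j)) DN EN) -!sumrB.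
apply: le_trans (nrm_sum _ _ _) _; apply: ler_sum => d _.
rewrite [\sum_(j < N | P d j) _]big_mkcond -!sumrB.
apply: le_trans (nrm_sum _ _ _) _; apply: ler_sum => j _.
case: ifPn => Pdj; case: ifPn => h; rewrite ?subrr ?subr0 ?nrm0 ?nrm_ge0//.
by case/andP: h => h1 h2; rewrite HP in Pdj.
Qed.

(** The sums over squares converge since their increments are dominated by those of the bounded
    increasing sums of moduli; a rectangle is then compared with a large square. *)
Lemma dbl_bounded_sum w B : dbl_bounded w B -> exists l, dbl_sum w l.
Proof.
move=> wB; pose T n := \sum_(d < n) \sum_(j < n) w d j.
pose A n : R := \sum_(d < n) \sum_(j < n) nrm (w d j).
have dT n k : (n <= k)%N -> nrm (T k - T n) <= A k - A n.
  by move=> nk; exact: (@region_dist w k (fun _ _ => true) n n).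
have sT n : \sum_(i < n) (T i.+1 - T i) = T n.
  rewrite -(big_mkord xpredT (fun i => T i.+1 - T i)) telescope_sumr//.
  by rewrite /T big_ord0 subr0.
have [l Tl] : exists l, has_sum (fun n => T n.+1 - T n) l.
  apply: (@abs_bounded_sum _ B) => N.
  apply: (@le_trans _ _ (\sum_(i < N) (A i.+1 - A i))).
    by apply: ler_sum => i _; exact: dT.
  rewrite -(big_mkord xpredT (fun i => A i.+1 - A i)) telescope_sumr//.
  by rewrite lerBlDr (le_trans (wB N N))// lerDl /A big_ord0.
exists l => e e0.
have [N1 H1] := Tl (e / 2) ltac:(by rewrite divr_gt0).
have [N2 H2] := double_tail (fun d j => nrm_ge0 (w d j)) wB
  (e := e / 2) ltac:(by rewrite divr_gt0).
exists N2 => D E N2D N2E.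
pose N := maxn N1 (maxn D E).
have DN : (D <= N)%N by rewrite /N !leq_max leqnn orbT.
have EN : (E <= N)%N by rewrite /N !leq_max leqnn !orbT.
have := H1 N (leq_maxl _ _); rewrite sT => h1.
have := H2 N D E; rewrite N2D N2E DN EN => /(_ isT isT) h2.
have := @region_dist w N (fun _ _ => true) D E DN EN (fun _ _ _ _ => isT) => h3.
apply: le_trans (nrm_tri (T N) _ _) _.
by rewrite nrmC; have := le_trans h3 (lerB h2 (lexx _)); rewrite /T /= in h1 *; lra.
Qed.

Lemma dbl_bounded_row w B d : dbl_bounded w B -> abs_bounded (w d) B.
Proof.
move=> wB N; apply: le_trans (wB d.+1 N); rewrite big_ord_recr /= lerDr.
by do 2![apply: sumr_ge0 => ? _]; exact: nrm_ge0.
Qed.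

Lemma dbl_bounded_tr w B : dbl_bounded w B -> dbl_bounded (fun d j => w j d) B.
Proof. by move=> wB D E; rewrite exchange_big /=; exact: wB. Qed.

Lemma dbl_sum_tr w l : dbl_sum w l -> dbl_sum (fun d j => w j d) l.
Proof.
move=> wl e /wl[N0 H]; exists N0 => D E hD hE.
by rewrite exchange_big /=; exact: H.
Qed.

Lemma clim_sum (I : Type) (s : seq I) (f : I -> nat -> R[i]) (r : I -> R[i]) :
  (forall i, clim (f i) (r i)) ->
  clim (fun n => \sum_(i <- s) f i n) (\sum_(i <- s) r i).
Proof.
move=> H; elim: s => [|i s IH].
  by rewrite big_nil; apply: clim_eq (clim_cst 0) => n; rewrite big_nil.
by rewrite big_cons; apply: clim_eq (climD (H i) IH) => n; rewrite big_cons.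
Qed.

Lemma dbl_sum_rows w l (r : nat -> R[i]) : dbl_sum w l ->
  (forall d, has_sum (w d) (r d)) -> has_sum r l.
Proof.
move=> wl wr e /wl[N0 H]; exists N0 => D N0D.
have c : clim (fun E => \sum_(d < D) \sum_(j < N0 + E) w d j - l) (\sum_(d < D) r d - l).
  apply: climB (clim_cst _); apply: clim_sum => i.
  exact: (clim_sub (wr i) (leq_addl N0)).
apply: (clim_nrm_le c) => E; apply: H => //; exact: leq_addr.
Qed.

Lemma dbl_sum_cols w l (r : nat -> R[i]) : dbl_sum w l ->
  (forall j, has_sum (fun d => w d j) (r j)) -> has_sum r l.
Proof. by move=> /dbl_sum_tr; exact: dbl_sum_rows. Qed.

Lemma abs_bounded_rows w B (r : nat -> R[i]) : dbl_bounded w B ->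
  (forall d, has_sum (w d) (r d)) -> abs_bounded r B.
Proof.
move=> wB wr D.
have c : clim (fun E => \sum_(d < D) (nrm (\sum_(j < E) w d j))%:C)
              (\sum_(d < D) (nrm (r d))%:C).
  apply: clim_sum => d e e0; have [N0 H] := clim_nrm (wr d) e0.
  by exists N0 => N /H; rewrite -rmorphB nrm_real.
rewrite -[leLHS]nrm_nneg; last by apply: sumr_ge0 => i _; exact: nrm_ge0.
rewrite rmorph_sum; apply: (clim_nrm_le c) => E.
rewrite -rmorph_sum nrm_nneg; last by apply: sumr_ge0 => i _; exact: nrm_ge0.
by apply: le_trans (wB D E); apply: ler_sum => d _; exact: nrm_sum.
Qed.

(** For [n > 0] this runs over the factorizations of [n]. Infinitely many pairs have product 0,
    which is why [w] is required to vanish on both axes when these values are summed. *)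
Definition dconv w n := \sum_(d < n.+1) \sum_(j < n.+1 | (d * j == n)%N) w d j.

Lemma dconv_partial w N : (forall j, w 0%N j = 0) -> (forall d, w d 0%N = 0) ->
  \sum_(n < N) dconv w n = \sum_(d < N) \sum_(j < N | (d * j < N)%N) w d j.
Proof.
move=> w0 w0'.
have E n : (n < N)%N -> dconv w n = \sum_(d < N) \sum_(j < N | (d * j == n)%N) w d j.
  move=> nN; rewrite /dconv.
  have -> : \sum_(d < N) \sum_(j < N | (d * j == n)%N) w d j =
      \sum_(d < n.+1) \sum_(j < N | (d * j == n)%N) w d j.
    rewrite [RHS](big_ord_widen N (fun d => \sum_(j < N | (d * j == n)%N) w d j))//.
    rewrite [RHS]big_mkcond; apply: eq_bigr => d _; case: ltnP => // nd.
    apply: big1 => j /eqP dj; case: (posnP j) => [->//|j0].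
    by have := leq_pmulr d j0; rewrite dj leqNgt nd.
  apply: eq_bigr => d _.
  rewrite (big_ord_widen_cond N (fun j => (d * j == n)%N) (fun j => w d j))//.
  rewrite big_mkcondr; apply: eq_bigr => j /eqP dj; case: ltnP => // nj.
  case: (posnP d) => [->//|d0].
  by have := leq_pmull j d0; rewrite dj leqNgt nj.
under eq_bigr => n _ do rewrite E//.
rewrite exchange_big /=; apply: eq_bigr => d _.
under eq_bigr => n _ do rewrite big_mkcond.
rewrite exchange_big /= [RHS]big_mkcond; apply: eq_bigr => j _.
case: ltnP => h.
  rewrite (bigD1 (Ordinal h)) //= eqxx big1 ?addr0// => i /negP ni.
  by case: eqP => // dj; case: ni; apply/eqP/val_inj.
by apply: big1 => i _; case: eqP => // dj; rewrite leqNgt dj ltn_ord in h.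
Qed.

Lemma dbl_sum_dconv w B l : dbl_bounded w B -> dbl_sum w l ->
  (forall j, w 0%N j = 0) -> (forall d, w d 0%N = 0) -> has_sum (dconv w) l.
Proof.
move=> wB wl w0 w0' e e0.
have [N1 H1] := wl (e / 2) ltac:(by rewrite divr_gt0).
have [N2 H2] := double_tail (fun d j => nrm_ge0 (w d j)) wB
  (e := e / 2) ltac:(by rewrite divr_gt0).
pose N0 := (maxn N1 N2).+1.
(* Once [N >= N0 ^ 2], the region [d * j < N] contains the square of side [N0]. *)
exists (N0 * N0)%N => N N00; rewrite dconv_partial//.
have N0N : (N0 <= N)%N by apply: leq_trans N00; rewrite leq_pmull.
have N10 : (N1 <= N0)%N by rewrite leqW// leq_maxl.
have N20 : (N2 <= N0)%N by rewrite leqW// leq_maxr.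
have h3 := @region_dist w N (fun d j => (d * j < N)%N) N0 N0 N0N N0N ltac:(by
  move=> d j hd hj; apply: leq_trans N00; exact: ltn_mul).
have := H2 N N0 N0; rewrite N20 N0N => /(_ isT isT) h2.
have h1 := H1 N0 N0 N10 N10.
apply: le_trans (nrm_tri (\sum_(d < N0) \sum_(j < N0) w d j) _ _) _.
by have := le_trans h3 (lerB h2 (lexx _)); lra.
Qed.

Lemma dbl_bounded_mul u v B1 B2 : abs_bounded u B1 -> abs_bounded v B2 ->
  dbl_bounded (fun d j => u d * v j) (B1 * B2).
Proof.
move=> uB vB D E; have B20 := abs_bounded_ge0 vB.
apply: le_trans (ler_wpM2r B20 (uB D)); rewrite mulr_suml.
apply: ler_sum => d _; apply: le_trans (ler_wpM2l (nrm_ge0 (u d)) (vB E)).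
by rewrite mulr_sumr; apply: ler_sum => j _; rewrite nrmM.
Qed.

Lemma has_sum_dconv_mul u v B1 B2 l m : abs_bounded u B1 -> abs_bounded v B2 ->
  u 0%N = 0 -> v 0%N = 0 -> has_sum u l -> has_sum v m ->
  has_sum (dconv (fun d j => u d * v j)) (l * m).
Proof.
move=> uB vB u0 v0 ul vm; have wB := dbl_bounded_mul uB vB.
have [s ws] := dbl_bounded_sum wB.
have := dbl_sum_rows ws (fun d => has_sumZ (u d) vm).
move=> h; have := has_sumZ m ul => h'.
have -> : l * m = s.
  apply: (@has_sum_uniq (fun d => u d * m)); last exact: h.
  by rewrite mulrC; apply: has_sum_eq h' => n; rewrite mulrC.
by apply: (dbl_sum_dconv wB ws) => ?; rewrite ?u0 ?v0 ?mul0r ?mulr0.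
Qed.

End HasSum.

(** * Complex powers of integers *)

Section ComplexExp.
Local Open Scope ring_scope.
Local Open Scope complex_scope.
Variable R : realType.
Implicit Types (z w : R[i]) (x y t r : R).

Definition cexp z : R[i] :=
  (expR (complex.Re z) * cos (complex.Im z)) +i*
  (expR (complex.Re z) * sin (complex.Im z)).

Lemma cexp0 : cexp 0 = 1.
Proof. by apply: complexP; rewrite /= expR0 ?cos0 ?sin0 ?mul1r. Qed.

Lemma cexpD z w : cexp (z + w) = cexp z * cexp w.
Proof.
by apply: complexP; rewrite /cexp ?ReM ?ImM /= ?ReD ?ImD expRD ?cosD ?sinD; ring.
Qed.

Lemma nrm_cexp z : nrm (cexp z) = expR (complex.Re z).
Proof.
rewrite /nrm /= !exprMn -mulrDr cos2Dsin2 mulr1 sqrtr_sqr.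
by rewrite ger0_norm// expR_ge0.
Qed.

Lemma cexp_real x : cexp x%:C = (expR x)%:C.
Proof. by apply: complexP; rewrite /= ?cos0 ?sin0 ?mulr1 ?mulr0. Qed.

Definition cder (F : R -> R[i]) (dF : R[i]) x :=
  is_derive x 1 (fun t => complex.Re (F t)) (complex.Re dF) /\
  is_derive x 1 (fun t => complex.Im (F t)) (complex.Im dF).

Lemma rderM (f g : R -> R) x (df dg : R) : is_derive x 1 f df ->
  is_derive x 1 g dg -> is_derive x 1 (fun t => f t * g t) (df * g x + f x * dg).
Proof.
move=> hf hg; apply: (is_derive_eq (is_deriveM hf hg)).
by rewrite /GRing.scale /=; ring.
Qed.

Lemma cderM F G x dF dG : cder F dF x -> cder G dG x ->
  cder (fun t => F t * G t) (dF * G x + F x * dG) x.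
Proof.
move=> [F1 F2] [G1 G2]; split.
  rewrite (_ : (fun t => _) = (fun t => complex.Re (F t) * complex.Re (G t)) -
     (fun t => complex.Im (F t) * complex.Im (G t))); last first.
    by apply/funext => t; rewrite ReM.
  by apply: is_derive_eq (is_deriveB (rderM F1 G1) (rderM F2 G2)) _;
     rewrite ReD !ReM; ring.
rewrite (_ : (fun t => _) = (fun t => complex.Re (F t) * complex.Im (G t)) +
   (fun t => complex.Im (F t) * complex.Re (G t))); last first.
  by apply/funext => t; rewrite ImM.
by apply: is_derive_eq (is_deriveD (rderM F1 G2) (rderM F2 G1)) _;
   rewrite ImD !ImM; ring.
Qed.

Lemma cderD F G x dF dG : cder F dF x -> cder G dG x ->
  cder (fun t => F t + G t) (dF + dG) x.
Proof.
move=> [F1 F2] [G1 G2]; split.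
  rewrite (_ : (fun t => _) = (fun t => complex.Re (F t)) +
     (fun t => complex.Re (G t))); last by apply/funext => t; rewrite ReD.
  by apply: is_derive_eq (is_deriveD F1 G1) _; rewrite ReD.
rewrite (_ : (fun t => _) = (fun t => complex.Im (F t)) +
   (fun t => complex.Im (G t))); last by apply/funext => t; rewrite ImD.
by apply: is_derive_eq (is_deriveD F2 G2) _; rewrite ImD.
Qed.

Lemma cder_cst (c : R[i]) x : cder (fun=> c) 0 x.
Proof. by split; exact: is_derive_cst. Qed.

Lemma cder_real (f : R -> R) (df : R) x : is_derive x 1 f df -> cder (fun t => (f t)%:C) df%:C x.
Proof. by move=> h; split => //=; exact: is_derive_cst. Qed.

Lemma cderZ (c : R[i]) F x dF : cder F dF x -> cder (fun t => c * F t) (c * dF) x.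
Proof. by move=> h; have := cderM (cder_cst c x) h; rewrite mul0r add0r. Qed.

Lemma cderB F G x dF dG : cder F dF x -> cder G dG x ->
  cder (fun t => F t - G t) (dF - dG) x.
Proof.
move=> hF /(cderZ (-1)) /(cderD hF); rewrite mulN1r.
by under eq_fun => t do rewrite mulN1r.
Qed.

Lemma cder_sum n (F : nat -> R -> R[i]) dF x : (forall k, cder (F k) (dF k) x) ->
  cder (fun t => \sum_(k < n) F k t) (\sum_(k < n) dF k) x.
Proof.
move=> H; elim: n => [|n IH].
  by under eq_fun => t do rewrite big_ord0; rewrite big_ord0; exact: cder_cst.
under eq_fun => t do rewrite big_ord_recr.
by rewrite big_ord_recr; exact: cderD.
Qed.

Lemma is_derive_lin (a : R) x : is_derive x 1 (fun t : R => a * t) a.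
Proof.
by apply: is_derive_eq (rderM (is_derive_cst a x 1) (is_derive_id x 1)) _;
  rewrite mul0r add0r mulr1.
Qed.

Lemma cder_cexp w x : cder (fun t => cexp (w * t%:C)) (w * cexp (w * x%:C)) x.
Proof.
case: w => a b.
have E t : complex.Re ((a +i* b) * t%:C) = a * t by rewrite /= mulr0 subr0.
have E' t : complex.Im ((a +i* b) * t%:C) = b * t by rewrite /= mulr0 add0r.
have de : is_derive x 1 (fun t => expR (a * t)) (expR (a * x) * a).
  exact: (is_derive1_comp (is_derive_expR _) (is_derive_lin a x)).
have dc : is_derive x 1 (fun t => cos (b * t)) (- sin (b * x) * b).
  exact: (is_derive1_comp (is_derive_cos _) (is_derive_lin b x)).
have ds : is_derive x 1 (fun t => sin (b * t)) (cos (b * x) * b).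
  exact: (is_derive1_comp (is_derive_sin _) (is_derive_lin b x)).
rewrite /cexp; split.
  under eq_fun => t do rewrite /= mulr0 subr0 mulr0 add0r.
  by apply: is_derive_eq (rderM de dc) _; rewrite E E' ReM /=; ring.
under eq_fun => t do rewrite /= mulr0 subr0 mulr0 add0r.
by apply: is_derive_eq (rderM de ds) _; rewrite E E' ImM /=; ring.
Qed.

Lemma real_MVT_le (f df : R -> R) x y : x <= y ->
  (forall t, x <= t <= y -> is_derive t 1 f (df t)) ->
  (forall t, x <= t <= y -> 0 <= df t) -> f x <= f y.
Proof.
move=> xy dfE df0.
have [t||c cxy E] := @MVT_segment R f df x y xy.
- by rewrite in_itv /= => /andP[h1 h2]; apply: dfE; rewrite !ltW.
- apply: derivable_within_continuous => t; rewrite in_itv /= => /dfE h.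
  exact: ex_derive.
- by rewrite -subr_ge0 E mulr_ge0 ?subr_ge0// df0//; move: cxy; rewrite in_itv.
Qed.

(** Multiplying [F] by the unit [c] that turns [F y - F x] into its modulus reduces the claim to the
    monotonicity of the real function [g - Re (c F)]. *)
Lemma complex_MVT (F : R -> R[i]) dF (g dg : R -> R) x y : x <= y ->
  (forall t, x <= t <= y -> cder F (dF t) t) ->
  (forall t, x <= t <= y -> is_derive t 1 g (dg t)) ->
  (forall t, x <= t <= y -> nrm (dF t) <= dg t) ->
  nrm (F y - F x) <= g y - g x.
Proof.
move=> xy hF hg Fg; pose D := F y - F x; pose c := D^* / (nrm D)%:C.
have c1 : nrm c <= 1.
  rewrite /c nrmM nrmV nrm_conj nrm_nneg ?nrm_ge0//.
  by have [->|D0] := eqVneq (nrm D) 0; rewrite ?mul0r// divff.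
have cD : complex.Re (c * D) = nrm D.
  have [D0|D0] := eqVneq D 0; first by rewrite D0 mulr0 nrm0.
  have -> : c * D = (nrm D)%:C; last by [].
  have nD : (nrm D)%:C != 0 by rewrite -normE normr_eq0.
  rewrite /c mulrAC (mulrC _ D) -sqr_normc normE expr2 mulfK//.
pose h t := g t - complex.Re (c * F t).
suff : h x <= h y by rewrite /h => ?; rewrite -/D -cD mulrBr ReD ReN; lra.
apply: (@real_MVT_le h (fun t => dg t - complex.Re (c * dF t))) => // t xty.
  by apply: is_deriveB; [exact: hg|exact: (cderZ c (hF t xty)).1].
rewrite subr_ge0 (le_trans _ (Fg t xty))//.
apply: le_trans (ler_norm _) _; apply: le_trans (Re_le_nrm _) _.
by rewrite nrmM ler_piMl// nrm_ge0.
Qed.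

(** Divided powers: with the factorial built in, differentiation lowers [k] without a coefficient
    and the binomial formula is a plain convolution ([dpowD]). *)
Definition dpow k x : R := x ^+ k / k`!%:R.

Lemma dpow0 x : dpow 0 x = 1. Proof. by rewrite /dpow expr0 divr1. Qed.

Lemma dpow_ge0 k x : 0 <= x -> 0 <= dpow k x.
Proof. by move=> x0; rewrite divr_ge0 ?exprn_ge0. Qed.

Lemma dpowS k x : (k.+1)%:R * dpow k.+1 x = x * dpow k x.
Proof.
have h1 : (k.+1%:R : R) != 0 by rewrite pnatr_eq0.
have h2 : (k`!%:R : R) != 0 by rewrite pnatr_eq0 -lt0n fact_gt0.
rewrite /dpow factS natrM exprS; move: h1 h2; move: (k.+1%:R) (k`!%:R) => c d h1 h2.
by field; rewrite h1 h2.
Qed.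

Lemma dpow_le k x y : 0 <= x <= y -> dpow k x <= dpow k y.
Proof.
move=> /andP[x0 xy]; rewrite ler_wpM2r ?invr_ge0// lerXn2r ?nnegrE//.
exact: le_trans xy.
Qed.

Lemma dpowM k x y : dpow k (x * y) = x ^+ k * dpow k y.
Proof. by rewrite /dpow exprMn mulrA. Qed.

Lemma dpowD k x y : dpow k (x + y) = \sum_(i < k.+1) dpow i x * dpow (k - i) y.
Proof.
rewrite /dpow addrC exprDn mulr_suml; apply: eq_bigr => i _.
have ik : (i <= k)%N by rewrite -ltnS.
have h2 n : (n`!%:R : R) != 0 by rewrite pnatr_eq0 -lt0n fact_gt0.
rewrite -mulr_natr -(bin_fact ik) !natrM; field.
by rewrite !h2 pnatr_eq0 -lt0n bin_gt0 ik.
Qed.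

Definition ddpow k x : R := if k is j.+1 then dpow j x else 0.

Lemma ddpow_ge0 k x : 0 <= x -> 0 <= ddpow k x.
Proof. by case: k => // k; exact: dpow_ge0. Qed.

Lemma ddpow_le k x y : 0 <= x <= y -> ddpow k x <= ddpow k y.
Proof. by case: k => // k; exact: dpow_le. Qed.

Lemma is_derive_dpow k x : is_derive x 1 (dpow k) (ddpow k x).
Proof.
case: k => [|k]; rewrite /ddpow.
  rewrite (_ : dpow 0 = cst 1); first exact: is_derive_cst.
  by apply/funext => t; rewrite dpow0.
have d := is_deriveX k.+1 (is_derive_id x (1 : R)).
rewrite (_ : dpow k.+1 = fun t => (id ^+ k.+1) t * (k.+1)`!%:R^-1); last first.
  by apply/funext => t; rewrite /dpow exprfctE.
apply: is_derive_eq (rderM d (is_derive_cst _ x 1)) _.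
have h1 : (k.+1%:R : R) != 0 by rewrite pnatr_eq0.
have h2 : (k`!%:R : R) != 0 by rewrite pnatr_eq0 -lt0n fact_gt0.
rewrite /GRing.scale /= mulr0 addr0 mulr1 factS natrM /dpow.
have E (c e y : R) : c != 0 -> e != 0 -> c * y * (c * e)^-1 = y / e.
  by move=> h h'; field; rewrite h h'.
exact: E.
Qed.

(** The remainder after [n + 1] terms vanishes at 0, and its derivative is the remainder after [n]
    terms. *)
Lemma sum_dpow_le K x : 0 <= x -> \sum_(k < K) dpow k x <= expR x.
Proof.
move=> x0; case: K => [|K]; first by rewrite big_ord0 expR_ge0.
have [->|xn0] := eqVneq x 0.
  rewrite expR0 big_ord_recl dpow0 big1 ?addr0// => i _.
  by rewrite /dpow expr0n mul0r.
pose f K t := expR t - \sum_(k < K) dpow k t.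
suff H n t : 0 <= t -> 0 <= f n t by rewrite -subr_ge0; exact: H.
elim: n t => [|n IH] t t0; first by rewrite /f big_ord0 subr0 expR_ge0.
have f0 : f n.+1 0 = 0.
  rewrite /f expR0 big_ord_recl dpow0 big1 ?addr0 ?subrr// => i _.
  by rewrite /dpow expr0n mul0r.
rewrite -f0; apply: (@real_MVT_le _ (f n)) => // y /andP[y0 _]; last exact: IH.
have D : is_derive y 1 (fun t => \sum_(k < n.+1) dpow k t) (\sum_(k < n) dpow k y).
  have [+ _] := @cder_sum n.+1 (fun k t => (dpow k t)%:C) _ y
    (fun k => cder_real (is_derive_dpow k y)).
  rewrite Re_sum /= big_ord_recl /= add0r.
  by under eq_fun => u do rewrite Re_sum /=.
exact: is_deriveB.
Qed.

Lemma cexp_taylor w K :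
  nrm (cexp w - \sum_(k < K) w ^+ k / k`!%:R) <= dpow K (nrm w) * expR (nrm w).
Proof.
pose F K t := cexp (w * t%:C) - \sum_(k < K) w ^+ k * (dpow k t)%:C.
(* Along the segment [t * w] the derivative of a remainder is [w] times the previous remainder, so
   the bound is integrated one degree at a time. *)
suff H t : 0 <= t <= 1 ->
    nrm (F K t) <= nrm w ^+ K * expR (nrm w) * dpow K t.
  have := H 1; rewrite ler01 lexx => /(_ isT).
  rewrite /F mulr1; congr (nrm (_ - _) <= _).
    apply: eq_bigr => k _; congr (_ * _).
    by rewrite /dpow expr1n mul1r fmorphV rmorph_nat.
  by rewrite /dpow expr1n; ring.
elim: K t => [|K IH] t /andP[t0 t1].
  rewrite /F big_ord0 subr0 nrm_cexp dpow0 mulr1 expr0 mul1r ler_expR.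
  apply: le_trans (ler_norm _) _; apply: le_trans (Re_le_nrm _) _.
  by rewrite nrmM nrm_nneg// ler_piMr// nrm_ge0.
have F0 : F K.+1 0 = 0.
  rewrite /F mulr0 cexp0 big_ord_recl dpow0 big1 ?addr0 ?mul1r ?subrr// => i _.
  by rewrite /dpow expr0n mul0r mulr0.
have E0 : nrm w ^+ K.+1 * expR (nrm w) * dpow K.+1 0 = 0.
  by rewrite /dpow expr0n mul0r mulr0.
have := @complex_MVT (F K.+1) (fun t => w * F K t)
   (fun t => nrm w ^+ K.+1 * expR (nrm w) * dpow K.+1 t)
   (fun t => nrm w ^+ K.+1 * expR (nrm w) * dpow K t) 0 t t0.
rewrite F0 E0 !subr0; apply => u /andP[u0 ut].
- rewrite /F mulrBr mulr_sumr; apply: cderB; first exact: cder_cexp.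
  have := @cder_sum K.+1 (fun k t => w ^+ k * (dpow k t)%:C) _ u
    (fun k => cderZ (w ^+ k) (cder_real (is_derive_dpow k u))).
  rewrite big_ord_recl /= mulr0 add0r.
  by under eq_bigr => i _ do rewrite exprS -mulrA.
- apply: is_derive_eq (rderM (is_derive_cst _ u 1) (is_derive_dpow K.+1 u)) _.
  by rewrite mul0r add0r.
- rewrite nrmM exprS -!mulrA ler_wpM2l ?nrm_ge0// mulrA.
  by apply: IH; rewrite u0 (le_trans ut).
Qed.

End ComplexExp.

(** * Powers n^(-s), their sums, and their Taylor coefficients in s *)

Section NatPowers.
Local Open Scope ring_scope.
Local Open Scope complex_scope.
Variable R : realType.
Implicit Types (z w s : R[i]) (x y t r a b : R) (n k m : nat).

Definition lnn n : R := ln n%:R.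
(** This is n^(-a), with the value 0 at [n = 0]: sums may start at index 0, and multiplicativity in
    [n] holds without a side condition. *)
Definition pw n a : R := if n is 0 then 0 else expR (- (a * lnn n)).
Definition cpw n s : R[i] := if n is 0 then 0 else cexp (- (s * (lnn n)%:C)).

Lemma pw0 a : pw 0 a = 0. Proof. by []. Qed.

Lemma cpw0 s : cpw 0 s = 0. Proof. by []. Qed.

#[global] Arguments pw : simpl never.
#[global] Arguments cpw : simpl never.

Lemma lnn_ge0 n : 0 <= lnn n.
Proof. by rewrite /lnn; case: n => [|n]; [rewrite ln0|rewrite ln_ge0// ler1n]. Qed.

Lemma lnn1 : lnn 1 = 0. Proof. exact: ln1. Qed.

Lemma lnnM m n : (0 < m)%N -> (0 < n)%N -> lnn (m * n) = lnn m + lnn n.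
Proof. by move=> m0 n0; rewrite /lnn natrM lnM// posrE ltr0n. Qed.

Lemma lnn_le m n : (0 < m <= n)%N -> lnn m <= lnn n.
Proof.
by move=> /andP[m0 mn]; rewrite /lnn ler_ln ?posrE ?ltr0n ?ler_nat// (leq_trans m0).
Qed.

Lemma lnnS_le n : (0 < n)%N -> lnn n.+1 <= lnn n + n%:R^-1.
Proof.
move=> n0; have n0' : (0 : R) < n%:R by rewrite ltr0n.
have -> : lnn n.+1 = lnn n + ln (1 + n%:R^-1).
  rewrite /lnn -lnM ?posrE// ?addr_gt0 ?invr_gt0//; congr ln.
  by rewrite mulrDr mulr1 divff ?gt_eqF// -natr1.
by rewrite lerD2l le_ln1Dx// (lt_trans (y := 0)) ?invr_gt0// oppr_lt0.
Qed.

Lemma lnnS_ge n : (0 < n)%N -> lnn n + n.+1%:R^-1 <= lnn n.+1.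
Proof.
move=> n0; have n0' : (0 : R) < n%:R by rewrite ltr0n.
have n1 : (0 : R) < n.+1%:R by rewrite ltr0n.
have -> : lnn n = lnn n.+1 + ln (1 - n.+1%:R^-1).
  have h : 0 < 1 - n.+1%:R^-1 :> R by rewrite subr_gt0 invf_lt1// ltr1n.
  rewrite /lnn -lnM ?posrE//; congr ln.
  by rewrite mulrBr mulr1 divff ?gt_eqF// -natr1 addrK.
have := @le_ln1Dx R (- n.+1%:R^-1); rewrite ltrN2 invf_lt1// ltr1n ltnS n0 => /(_ isT) h.
by rewrite -addrA gerDl -lerBrDr sub0r.
Qed.

Lemma pw_ge0 n a : 0 <= pw n a.
Proof. by case: n => // n; exact: expR_ge0. Qed.

Lemma pwD n a b : pw n (a + b) = pw n a * pw n b.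
Proof. by case: n => [|n]; rewrite ?mul0r// /pw mulrDl opprD expRD. Qed.

Lemma pwM m n a : pw (m * n) a = pw m a * pw n a.
Proof.
case: m => [|m]; first by rewrite mul0r.
case: n => [|n]; first by rewrite muln0 mulr0.
by rewrite -expRD -opprD -mulrDr -lnnM.
Qed.

Lemma pw_1 a : pw 1 a = 1.
Proof. by rewrite /pw lnn1 mulr0 oppr0 expR0. Qed.

Lemma pw_0 n : (0 < n)%N -> pw n 0 = 1.
Proof. by case: n => // n _; rewrite /pw mul0r oppr0 expR0. Qed.

Lemma pwV n : pw n 1 = n%:R^-1.
Proof.
by case: n => [|n]; rewrite ?invr0// /pw mul1r expRN lnK// posrE ltr0n.
Qed.

Lemma pw_le n a b : a <= b -> pw n b <= pw n a.
Proof.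
by case: n => // n ab; rewrite ler_expR lerN2 ler_wpM2r ?lnn_ge0.
Qed.

Lemma pw_mono m n a : 0 <= a -> (0 < m <= n)%N -> pw n a <= pw m a.
Proof.
case: m n => // m [|n] a0 // mn.
by rewrite ler_expR lerN2 ler_wpM2l// lnn_le.
Qed.

Lemma pw_mul_expR n a r : pw n (a - r) = pw n a * expR (r * lnn n).
Proof. by case: n => [|n]; rewrite ?mul0r// pwD /pw mulNr opprK. Qed.

Lemma cpwE n s : (0 < n)%N -> cpw n s = natpowN n s.
Proof.
case: n => // n _; rewrite /cpw /natpowN /cexp /lnn.
by rewrite ReN ImN ReM ImM /= !mulr0 subr0 add0r cosN sinN mulrN.
Qed.

Lemma nrm_cpw n s : nrm (cpw n s) = pw n (complex.Re s).
Proof.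
by case: n => [|n]; rewrite ?nrm0// nrm_cexp ReN ReM /= mulr0 subr0.
Qed.

Lemma cpwD n s z : cpw n (s + z) = cpw n s * cpw n z.
Proof. by case: n => [|n]; rewrite ?mul0r// /cpw mulrDl opprD cexpD. Qed.

Lemma cpwM m n s : cpw (m * n) s = cpw m s * cpw n s.
Proof.
case: m => [|m]; first by rewrite mul0r.
case: n => [|n]; first by rewrite muln0 mulr0.
by rewrite /cpw -cexpD -opprD -mulrDr -rmorphD -lnnM.
Qed.

Lemma cpw1 s : cpw 1 s = 1.
Proof. by rewrite /cpw lnn1 mulr0 oppr0 cexp0. Qed.

Lemma cpw_real n a : cpw n a%:C = (pw n a)%:C.
Proof. by case: n => [|n]; rewrite ?rmorph0// /cpw -rmorphM -rmorphN cexp_real. Qed.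

(** Discrete integral test: ln (n + 1) - ln n >= 1 / (n + 1) and e^x >= 1 + x bound a term by a
    telescoping difference. The companion [pw_step_le] uses ln (n + 1) - ln n <= 1 / n. *)
Lemma pw_step_ge n a : 0 < a -> (0 < n)%N ->
  pw n.+1 (1 + a) <= (pw n a - pw n.+1 a) / a.
Proof.
move=> a0 n0; rewrite ler_pdivlMr// addrC pwD pwV.
have -> : pw n a = pw n.+1 a * expR (a * (lnn n.+1 - lnn n)).
  by case: n n0 => // n _; rewrite /pw -expRD; congr expR; ring.
have := expR_ge1Dx (a * (lnn n.+1 - lnn n)); have := lnnS_ge n0.
have := pw_ge0 n.+1 a; set p := pw _ _; set e := expR _; set u := n.+1%:R^-1.
move=> p0 hu he; move: (lnn n.+1) (lnn n) hu he => L l hu he.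
have : a * u <= a * (L - l) by rewrite ler_wpM2l ?(ltW a0)// lerBrDl.
by move: p0 he; clearbody p e u; nra.
Qed.

Lemma pw_step_le n a : 0 < a -> (0 < n)%N ->
  (pw n a - pw n.+1 a) / a <= pw n (1 + a).
Proof.
move=> a0 n0; rewrite ler_pdivrMr// addrC pwD pwV.
have -> : pw n.+1 a = pw n a * expR (- (a * (lnn n.+1 - lnn n))).
  by case: n n0 => // n _; rewrite /pw -expRD; congr expR; ring.
have := expR_ge1Dx (- (a * (lnn n.+1 - lnn n))); have := lnnS_le n0.
have := pw_ge0 n a; set p := pw _ _; set e := expR _; set u := n%:R^-1.
move=> p0 hu he; move: (lnn n.+1) (lnn n) hu he => L l hu he.
have : a * (L - l) <= a * u by rewrite ler_wpM2l ?(ltW a0)// lerBlDl.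
by move: p0 he; clearbody p e u; nra.
Qed.

Lemma sum_pw_le a N : 0 < a -> \sum_(i < N) pw i (1 + a) <= 1 + a^-1.
Proof.
move=> a0; case: N => [|[|N]]; first by rewrite big_ord0 addr_ge0// invr_ge0 ltW.
  by rewrite big_ord_recl big_ord0 addr0 pw0 addr_ge0// invr_ge0 ltW.
rewrite big_ord_recl pw0 add0r big_ord_recl /= pw_1 lerD2l.
apply: (@le_trans _ _ (\sum_(i < N) (pw i.+1 a - pw i.+2 a) / a)).
  by apply: ler_sum => i _; exact: pw_step_ge.
rewrite -mulr_suml ler_piMl ?invr_ge0 ?(ltW a0)//.
suff -> : \sum_(i < N) (pw i.+1 a - pw i.+2 a) = 1 - pw N.+1 a.
  by rewrite gerBl pw_ge0.
elim: N => [|N IH]; first by rewrite big_ord0 pw_1 subrr.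
by rewrite big_ord_recr IH /=; ring.
Qed.

Lemma sum_pw_ge a N : 0 < a -> (1 - pw N.+1 a) / a <= \sum_(i < N.+1) pw i (1 + a).
Proof.
move=> a0; rewrite big_ord_recl pw0 add0r.
apply: (@le_trans _ _ (\sum_(i < N) (pw i.+1 a - pw i.+2 a) / a)); last first.
  by apply: ler_sum => i _; exact: pw_step_le.
rewrite -mulr_suml.
suff -> : \sum_(i < N) (pw i.+1 a - pw i.+2 a) = 1 - pw N.+1 a by [].
elim: N => [|N IH]; first by rewrite big_ord0 pw_1 subrr.
by rewrite big_ord_recr IH /=; ring.
Qed.

Lemma pw_small a e : 0 < a -> 0 < e -> exists n0, forall n, (n0 <= n)%N -> pw n a <= e.
Proof.
move=> a0 e0; pose m := (Num.Def.archi_bound (expR ((ln e^-1) / a))).+1.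
have me : expR (ln e^-1 / a) <= m%:R.
  by rewrite (le_trans (ltW (archi_boundP (expR_ge0 _))))// ler_nat leqnSn.
exists m => n mn; apply: le_trans (pw_mono (ltW a0) (m := m) _) _ => //.
rewrite /pw expRN -[leRHS]invrK lef_pV2 ?posrE ?expR_gt0 ?invr_gt0//.
rewrite -[leLHS]lnK ?posrE ?invr_gt0// ler_expR.
rewrite mulrC -ler_pdivrMr// -[leLHS]expRK /lnn ler_ln ?posrE ?expR_gt0//.
Qed.

(** The k-th Taylor coefficient in z of n^(-(s - z)). Expanding in [s - z] instead of [s + z] makes
    the factors (ln n)^k / k! appear without signs. *)
Definition ecoef s k n : R[i] := cpw n s * (dpow k (lnn n))%:C.

Lemma nrm_ecoef s k n : nrm (ecoef s k n) = pw n (complex.Re s) * dpow k (lnn n).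
Proof. by rewrite nrmM nrm_cpw nrm_nneg// dpow_ge0// lnn_ge0. Qed.

Lemma dpow_small x e : 0 <= x -> 0 < e -> exists n0, forall n, (n0 <= n)%N -> dpow n x <= e.
Proof.
move=> x0 e0; have [n0 H] := abs_bounded_tail (R := R)
  (u := fun n => (dpow n x)%:C) (B := expR x) (e := e)
  ltac:(by move=> N; under eq_bigr => i _ do rewrite nrm_nneg ?dpow_ge0//; exact: sum_dpow_le) e0.
exists n0 => n /H /abs_bounded_term => /(_ 0%N).
by rewrite addn0 nrm_nneg// dpow_ge0.
Qed.

Lemma ecoef_has_sum s z n : has_sum (fun k => ecoef s k n * z ^+ k) (cpw n (s - z)).
Proof.
case: n => [|n].
  rewrite cpw0; apply: (@has_sum_eq _ (fun=> 0)); last exact: has_sum0.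
  by move=> k; rewrite /ecoef cpw0 !mul0r.
set w := z * (lnn n.+1)%:C.
have -> : cpw n.+1 (s - z) = cpw n.+1 s * cexp w by rewrite cpwD /cpw mulNr opprK.
have E k : cpw n.+1 s * (w ^+ k / k`!%:R) = ecoef s k n.+1 * z ^+ k.
  by rewrite /ecoef /dpow rmorphM rmorphXn fmorphV rmorph_nat exprMn; ring.
apply: (has_sum_eq E); apply: has_sumZ => e e0.
have [n0 H] := dpow_small (nrm_ge0 w) (e := e / expR (nrm w)) ltac:(by rewrite divr_gt0 ?expR_gt0).
exists n0 => N /H; rewrite ler_pdivlMr ?expR_gt0// => h.
by rewrite nrmC (le_trans (cexp_taylor _ _)).
Qed.

(** Mean value inequality for e^(-s t) t^k / k! on the interval from ln n to ln (n + 1), whose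
    length is at most 1 / n. The gain 1 / n is what makes the Abel-summed series converge absolutely
    for Re s > 0. *)
Lemma ecoef_diff s k n : (0 < n)%N -> 0 <= complex.Re s ->
  nrm (ecoef s k n - ecoef s k n.+1) <= n%:R^-1 * pw n (complex.Re s) *
   (nrm s * dpow k (lnn n.+1) + ddpow k (lnn n.+1)).
Proof.
move=> n0 s0; set G := nrm s * _ + _.
have G0 : 0 <= G.
  apply: addr_ge0; last by rewrite ddpow_ge0// lnn_ge0.
  by apply: mulr_ge0; [exact: nrm_ge0|rewrite dpow_ge0// lnn_ge0].
pose F y := cexp (- s * y%:C) * (dpow k y)%:C.
have FE m : (0 < m)%N -> F (lnn m) = ecoef s k m.
  by case: m => // m _; rewrite /F mulNr.
pose A := pw n (complex.Re s) * G.
have A0 : 0 <= A by rewrite mulr_ge0 ?pw_ge0.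
have nn : lnn n <= lnn n.+1 by rewrite lnn_le// n0 /=.
have := @complex_MVT R F _ (fun t => A * t) (fun=> A) _ _ nn
  (fun t _ => cderM (cder_cexp (- s) t) (cder_real (is_derive_dpow k t)))
  (fun t _ => is_derive_lin A t).
rewrite !FE// => H; rewrite nrmC; apply: le_trans (H _) _; last first.
  rewrite -mulrBr [leRHS](_ : _ = A * n%:R^-1); last by rewrite /A; ring.
  by rewrite ler_wpM2l// lerBlDl lnnS_le.
move=> t /andP[nt tn].
have t0 : 0 <= t by rewrite (le_trans _ nt)// lnn_ge0.
have -> : - s * cexp (- s * t%:C) * (dpow k t)%:C +
   cexp (- s * t%:C) * (ddpow k t)%:C =
   cexp (- s * t%:C) * (- s * (dpow k t)%:C + (ddpow k t)%:C).
  by ring.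
rewrite nrmM nrm_cexp /A ler_pM ?expR_ge0 ?nrm_ge0//.
  rewrite ReM ReN /= mulr0 subr0 mulNr; case: (n) n0 nt => // n' _ nt.
  by rewrite ler_expR lerN2 ler_wpM2l.
apply: le_trans (nrmD _ _) _; rewrite nrmM nrmN nrm_nneg ?dpow_ge0// lerD//.
  by rewrite ler_wpM2l ?nrm_ge0// dpow_le ?t0.
by rewrite nrm_nneg ?ddpow_ge0// ddpow_le ?t0.
Qed.

(** Summed against r^k, the divided powers add up to at most (n + 1)^r; the factor [expR r] is lost
    in passing from n + 1 to n. *)
Lemma ecoef_diff_sum s r n K : (0 < n)%N -> 0 <= complex.Re s -> 0 <= r ->
  \sum_(k < K) nrm (ecoef s k n - ecoef s k n.+1) * r ^+ k <=
  (nrm s + r) * expR r * pw n (1 + complex.Re s - r).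
Proof.
move=> n0 s0 r0; set Y := lnn n.+1; have Y0 : 0 <= Y by exact: lnn_ge0.
pose A := n%:R^-1 * pw n (complex.Re s).
have A0 : 0 <= A by rewrite mulr_ge0 ?pw_ge0 ?invr_ge0.
apply: (@le_trans _ _ (A * ((nrm s + r) * expR (r * Y)))); last first.
  have -> : pw n (1 + complex.Re s - r) = A * expR (r * lnn n).
    by rewrite pw_mul_expR pwD pwV.
  rewrite (_ : _ * (A * _) = A * ((nrm s + r) * (expR r * expR (r * lnn n)))); last by ring.
  rewrite ler_wpM2l// ler_wpM2l ?addr_ge0 ?nrm_ge0// -expRD ler_expR.
  have := lnnS_le n0; have : n%:R^-1 <= 1 :> R by rewrite invf_le1 ?ltr0n// ler1n.
  by rewrite -/Y; nra.
apply: (@le_trans _ _ (A * (nrm s * (\sum_(k < K) dpow k (r * Y)) +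
   \sum_(k < K) ddpow k Y * r ^+ k))).
  rewrite mulr_sumr -big_split /= mulr_sumr; apply: ler_sum => k _.
  rewrite dpowM; have := ler_wpM2r (exprn_ge0 k r0) (ecoef_diff k n0 s0).
  by move/le_trans; apply; rewrite -/A -/Y le_eqVlt; apply/orP; left; apply/eqP; ring.
rewrite ler_wpM2l// mulrDl lerD//.
  by rewrite ler_wpM2l ?nrm_ge0// sum_dpow_le// mulr_ge0.
case: K => [|K]; first by rewrite big_ord0 mulr_ge0 ?expR_ge0.
rewrite big_ord_recl /= mul0r add0r.
apply: (@le_trans _ _ (r * \sum_(k < K) dpow k (r * Y))).
  by rewrite mulr_sumr; apply: ler_sum => k _; rewrite dpowM /= exprS; lra.
by rewrite ler_wpM2l// sum_dpow_le// mulr_ge0.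
Qed.

Lemma cpw_second_order n s : (0 < n)%N -> 0 <= complex.Re s ->
  nrm (cpw n (s - 1) - cpw n.+1 (s - 1) - (s - 1) * cpw n s) <=
  nrm (s - 1) * nrm s * pw n (1 + complex.Re s).
Proof.
move=> n0 s0; set A := nrm (s - 1) * nrm s * _.
have A0 : 0 <= A by rewrite !mulr_ge0 ?nrm_ge0 ?pw_ge0.
have nn : lnn n <= lnn n.+1 by rewrite lnn_le// n0 /=.
(* With x = e^t this is x^(1-s) - (1-s) n^(-s) x. Its derivative in t is (1-s) x (x^(-s) - n^(-s)),
   and the last factor is small near x = n by a second use of the mean value inequality. *)
pose F t := cexp ((1 - s) * t%:C) - ((1 - s) * cpw n s) * (expR t)%:C.
have e_ln m : (0 < m)%N -> expR (lnn m) = m%:R by move=> m0; rewrite lnK// posrE ltr0n.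
have FE m : (0 < m)%N -> F (lnn m) = cpw m (s - 1) - (1 - s) * cpw n s * m%:R.
  case: m => // m _; rewrite /F e_ln// rmorph_nat; congr (_ - _).
  by rewrite /cpw -mulNr opprB.
have d1 t : is_derive t 1 (fun t : R => A * expR t) (A * expR t).
  apply: is_derive_eq (rderM (is_derive_cst A t 1) (is_derive_expR t)) _.
  by rewrite mul0r add0r.
have := @complex_MVT R F _ (fun t => A * expR t) (fun t => A * expR t) _ _ nn
  (fun t _ => cderB (cder_cexp (1 - s) t)
                    (cderZ ((1 - s) * cpw n s) (cder_real (is_derive_expR t))))
  (fun t _ => d1 t).
have E1 : A * expR (lnn n.+1) - A * expR (lnn n) = A.
  by rewrite !e_ln// -mulrBr -natr1 addrAC subrr add0r mulr1.
rewrite E1 (FE n n0) (FE n.+1 isT) => H.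
rewrite nrmC -(_ : nrm (cpw n.+1 (s - 1) - (1 - s) * cpw n s * n.+1%:R -
  (cpw n (s - 1) - (1 - s) * cpw n s * n%:R)) = nrm ((s - 1) * cpw n s - (cpw n (s - 1) - cpw n.+1 (s - 1)))); last first.
  by congr nrm; rewrite -natr1; ring.
apply: H => t /andP[nt tn].
have t0 : 0 <= t by rewrite (le_trans _ nt)// lnn_ge0.
have -> : cexp ((1 - s) * t%:C) = (expR t)%:C * cexp (- s * t%:C).
  by rewrite -cexp_real -cexpD; congr cexp; ring.
have -> : (1 - s) * ((expR t)%:C * cexp (- s * t%:C)) - (1 - s) * cpw n s * (expR t)%:C =
  (expR t)%:C * ((1 - s) * (cexp (- s * t%:C) - cpw n s)) by ring.
rewrite !nrmM nrm_nneg ?expR_ge0// mulrC ler_wpM2r ?expR_ge0// /A -mulrA.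
rewrite [nrm (1 - s)]nrmC ler_wpM2l ?nrm_ge0//.
pose B := nrm s * pw n (complex.Re s).
have B0 : 0 <= B by rewrite mulr_ge0 ?nrm_ge0 ?pw_ge0.
have := @complex_MVT R (fun t => cexp (- s * t%:C)) _ (fun t => B * t) (fun=> B) _ _ nt
  (fun t _ => cder_cexp (- s) t) (fun t _ => is_derive_lin B t).
have -> : cexp (- s * (lnn n)%:C) = cpw n s by case: (n) n0 => // ? _; rewrite mulNr.
move=> H'; apply: le_trans (H' _) _; last first.
  rewrite -mulrBr pwD pwV (_ : nrm s * _ = B * n%:R^-1); last by rewrite /B; ring.
  rewrite ler_wpM2l// lerBlDl (le_trans tn)// lnnS_le//.
move=> u /andP[nu ut]; rewrite nrmM nrmN nrm_cexp /B ler_wpM2l ?nrm_ge0//.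
rewrite ReM ReN /= mulr0 subr0 mulNr; case: (n) n0 nu => // n' _ nu.
by rewrite ler_expR lerN2 ler_wpM2l.
Qed.

End NatPowers.

#[global] Arguments pw : simpl never.
#[global] Arguments cpw : simpl never.

(** * Dirichlet L-functions for Re s > 0 *)

Section PowerSeries.
Local Open Scope ring_scope.
Local Open Scope complex_scope.
Variable R : realType.
Implicit Types (z w s : R[i]) (x y t r : R) (n k m : nat) (u : nat -> R[i]).

Definition csum u : R[i] := xget 0 [set l | has_sum u l]%classic.

Lemma csumE u l : has_sum u l -> csum u = l.
Proof. by move=> ul; apply: xget_unique => // m um; exact: has_sum_uniq um ul. Qed.

Lemma csumP u B : abs_bounded u B -> has_sum u (csum u).
Proof. by move=> /abs_bounded_sum[l ul]; rewrite (csumE ul). Qed.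

(** Each term equals [(nrm z / r) ^+ k] times a term at radius [r], and the ratio is at most 1. *)
Lemma power_series_rem u r B z l K : 0 < r ->
  abs_bounded (fun k => u k * r%:C ^+ k) B -> nrm z <= r ->
  has_sum (fun k => u k * z ^+ k) l ->
  nrm (l - \sum_(k < K) u k * z ^+ k) <= B * (nrm z / r) ^+ K.
Proof.
move=> r0 uB zr ul; apply: (has_sum_dist_le ul) => N.
have q0 : 0 <= nrm z / r by rewrite divr_ge0 ?nrm_ge0// ltW.
have q1 : nrm z / r <= 1 by rewrite ler_pdivrMr// mul1r.
have E k : nrm (u k * z ^+ k) = (nrm z / r) ^+ k * nrm (u k * r%:C ^+ k).
  rewrite !nrmM !nrmX nrm_nneg ?(ltW r0)// exprMn exprVn mulrCA.
  by rewrite divfK// expf_neq0// gt_eqF.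
apply: (@le_trans _ _ (\sum_(i < N) (nrm z / r) ^+ K * nrm (u (K + i)%N * r%:C ^+ (K + i)))).
  apply: ler_sum => i _; rewrite E ler_wpM2r ?nrm_ge0// exprD.
  by rewrite ler_piMr ?exprn_ge0// exprn_ile1.
rewrite -mulr_sumr mulrC ler_wpM2r ?exprn_ge0//.
apply: le_trans (uB (K + N)%N); rewrite big_split_ord /= lerDr.
by apply: sumr_ge0 => i _; exact: nrm_ge0.
Qed.

End PowerSeries.

Section LSeries.
Local Open Scope ring_scope.
Local Open Scope complex_scope.
Variables (R : realType) (chi : nat -> R[i]) (B : R).
Implicit Types (z w s : R[i]) (x y t r : R) (n k m : nat).

Definition psum n := \sum_(k < n.+1) chi k.

Hypothesis chi0 : chi 0%N = 0.
Hypothesis psumB : forall n, nrm (psum n) <= B.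

(** Abel summation of the Dirichlet series. When the partial sums of [chi] are bounded it converges
    absolutely on all of Re s > 0, which provides the continuation to which [GRH] is applied. *)
Definition Lfun s := csum (fun n => psum n * (cpw n s - cpw n.+1 s)).

Definition acoef s k := csum (fun n => psum n * (ecoef s k n - ecoef s k n.+1)).

Lemma psum0 : psum 0 = 0. Proof. by rewrite /psum big_ord1. Qed.

Lemma psumB_ge0 : 0 <= B. Proof. exact: le_trans (nrm_ge0 _) (psumB 0). Qed.

Definition Lbound s r := B * ((nrm s + r) * expR r * (1 + (complex.Re s - r)^-1)).

(** One absolutely convergent double series in [n] and [k] carries all the analysis: its rows sum to
    [Lfun (s - z)], and its columns are the terms of the power series in [z]. *)
Lemma Ldbl s r z : 0 <= r -> r < complex.Re s -> nrm z <= r ->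
  dbl_bounded (fun n k => psum n * (ecoef s k n - ecoef s k n.+1) * z ^+ k)
    (Lbound s r).
Proof.
move=> r0 rs zr N K.
apply: (@le_trans _ _ (\sum_(n < N) B * ((nrm s + r) * expR r * pw n (1 + (complex.Re s - r))))).
  apply: ler_sum => -[n nN] _ /=; case: n {nN} => [|n].
    rewrite /= pw0 !mulr0 big1// => k _; rewrite psum0 !mul0r nrm0//.
  rewrite /=; apply: (@le_trans _ _ (B * \sum_(k < K)
     nrm (ecoef s k n.+1 - ecoef s k n.+2) * r ^+ k)).
    rewrite mulr_sumr; apply: ler_sum => k _; rewrite !nrmM nrmX -mulrA.
    rewrite ler_pM ?nrm_ge0 ?psumB ?mulr_ge0 ?exprn_ge0 ?nrm_ge0//.
    by rewrite ler_wpM2l ?nrm_ge0// lerXn2r// nnegrE// nrm_ge0.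
  rewrite ler_wpM2l ?psumB_ge0// addrA ecoef_diff_sum//.
  exact: le_trans r0 (ltW rs).
rewrite -mulr_sumr -mulr_sumr /Lbound ler_wpM2l ?psumB_ge0//.
by rewrite ler_wpM2l ?mulr_ge0 ?addr_ge0 ?nrm_ge0 ?expR_ge0// sum_pw_le// subr_gt0.
Qed.

Lemma acoef_has_sum s k : 0 < complex.Re s ->
  has_sum (fun n => psum n * (ecoef s k n - ecoef s k n.+1)) (acoef s k).
Proof.
move=> s0; pose r := complex.Re s / 2.
have r0 : 0 < r by rewrite divr_gt0.
have rs : r < complex.Re s by rewrite /r; lra.
have H := dbl_bounded_tr (Ldbl (z := r%:C) (ltW r0) rs ltac:(by rewrite nrm_nneg// ltW)).
have := abs_boundedZ (r%:C ^+ k)^-1 (dbl_bounded_row k H).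
move=> H'; apply: (@csumP _ _ _ _); apply: abs_bounded_le H' => n.
rewrite [X in nrm X <= _](_ : _ = (r%:C ^+ k)^-1 *
  (psum n * (ecoef s k n - ecoef s k n.+1) * r%:C ^+ k))//.
rewrite [RHS]mulrC mulfK// expf_neq0//.
by rewrite -nrm_eq0 nrm_nneg ?gt_eqF// ltW.
Qed.

Lemma Lfun_has_sum s : 0 < complex.Re s ->
  has_sum (fun n => psum n * (cpw n s - cpw n.+1 s)) (Lfun s).
Proof.
move=> /(acoef_has_sum 0) H; have E n : ecoef s 0 n = cpw n s.
  by rewrite /ecoef dpow0 mulr1.
have := H; under eq_fun => n do rewrite !E.
by move=> H1; rewrite /Lfun (csumE H1).
Qed.

Lemma Lfun_power_series s r z : 0 <= r -> r < complex.Re s -> nrm z <= r ->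
  has_sum (fun k => acoef s k * z ^+ k) (Lfun (s - z)) /\
  abs_bounded (fun k => acoef s k * z ^+ k) (Lbound s r).
Proof.
move=> r0 rs zr; have H := Ldbl r0 rs zr.
have [l wl] := dbl_bounded_sum H.
have s0 : 0 < complex.Re s by exact: le_lt_trans r0 rs.
have sz : 0 < complex.Re (s - z).
  have := Re_le_nrm z; rewrite ler_norml => /andP[_ h].
  by rewrite ReD ReN subr_gt0 (le_lt_trans h)// (le_lt_trans zr).
have cols k : has_sum (fun n => psum n * (ecoef s k n - ecoef s k n.+1) * z ^+ k)
   (acoef s k * z ^+ k).
  rewrite mulrC; have := has_sumZ (z ^+ k) (acoef_has_sum k s0).
  by apply: has_sum_eq => n; rewrite mulrC.
have rows n : has_sum (fun k => psum n * (ecoef s k n - ecoef s k n.+1) * z ^+ k)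
   (psum n * (cpw n (s - z) - cpw n.+1 (s - z))).
  have := has_sumZ (psum n) (has_sumB (ecoef_has_sum s z n) (ecoef_has_sum s z n.+1)).
  by apply: has_sum_eq => k; rewrite -mulrBl mulrA.
have /csumE El := dbl_sum_rows wl rows; rewrite /Lfun El.
split; first exact: dbl_sum_cols wl cols.
exact: abs_bounded_rows (dbl_bounded_tr H) cols.
Qed.

Lemma acoef_bounded s r : 0 <= r -> r < complex.Re s ->
  abs_bounded (fun k => acoef s k * r%:C ^+ k) (Lbound s r).
Proof.
by move=> r0 rs; apply: (Lfun_power_series (z := r%:C) r0 rs _).2; rewrite nrm_nneg.
Qed.

Lemma Lfun0 s : 0 < complex.Re s -> Lfun s = acoef s 0.
Proof.
move=> s0; have := (Lfun_power_series (z := 0) (lexx 0) s0 _).1.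
rewrite nrm0 subr0 => /(_ (lexx _)) H; apply: (has_sum_uniq H).
have := @has_sum_trunc R (fun k => acoef s k * 0 ^+ k) 1.
rewrite big_ord1 expr0 mulr1; apply => k.
by case: k => // k _; rewrite expr0n mulr0.
Qed.

Lemma chi_psum n : chi n.+1 = psum n.+1 - psum n.
Proof. by rewrite /psum [in RHS]big_ord_recr /= addrAC subrr add0r. Qed.

Lemma abel_sum (c : nat -> R[i]) N :
  \sum_(k < N.+1) chi k * c k =
  \sum_(n < N.+1) psum n * (c n - c n.+1) + psum N * c N.+1.
Proof.
elim: N => [|N IH].
  by rewrite !big_ord1 psum0 chi0 !mul0r addr0.
by rewrite big_ord_recr IH [in RHS]big_ord_recr /= chi_psum; ring.
Qed.

Lemma Lfun_dirichlet_series s : 0 < complex.Re s ->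
  has_sum (fun k => chi k * cpw k s) (Lfun s).
Proof.
move=> s0; have E : clim (fun N => psum N * cpw N.+1 s) 0.
  move=> e e0; have B1 : 0 < B + 1 by have := psumB_ge0; lra.
  have [n0 H] := pw_small s0 (e := e / (B + 1)) ltac:(by rewrite divr_gt0).
  exists n0 => N n0N; rewrite subr0 nrmM nrm_cpw.
  have := H N.+1 (leqW n0N); rewrite ler_pdivlMr// mulrC; apply: le_trans.
  by rewrite ler_wpM2r ?pw_ge0// (le_trans (psumB N))// lerDl.
have := climD (clim_sub (Lfun_has_sum s0) leqnSn) E; rewrite addr0.
move=> H e /H[N0 HN]; exists N0.+1 => -[|N]// N0N.
by rewrite (abel_sum (fun k => cpw k s)); exact: HN.
Qed.

Lemma Lfun_lipschitz s : 0 < complex.Re s ->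
  exists2 C, 0 <= C & forall z, nrm z <= complex.Re s / 2 ->
    nrm (Lfun (s + z) - Lfun s) <= C * nrm z.
Proof.
move=> s0; pose r := complex.Re s / 2.
have r0 : 0 < r by rewrite divr_gt0.
have rs : r < complex.Re s by rewrite /r; lra.
have aB := acoef_bounded (ltW r0) rs; have B0 := abs_bounded_ge0 aB.
exists (Lbound s r / r) => [|z zr]; first by rewrite divr_ge0// ltW.
have zr' : nrm (- z) <= r by rewrite nrmN.
have [H _] := Lfun_power_series (ltW r0) rs zr'.
have := power_series_rem 1 r0 aB zr' H.
by rewrite big_ord1 !expr0 mulr1 opprK (Lfun0 s0) nrmN expr1 mulrA mulrAC.
Qed.

Lemma Lfun_derivable s : 0 < complex.Re s ->
  derivable (Lfun : R[i]^o -> R[i]^o) s 1.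
Proof.
move=> s0; pose r := complex.Re s / 2.
have r0 : 0 < r by rewrite divr_gt0.
have rs : r < complex.Re s by rewrite /r; lra.
have aB := acoef_bounded (ltW r0) rs; have B0 := abs_bounded_ge0 aB.
apply/cvg_ex; exists (- acoef s 1 : R[i]^o).
apply/cvgrPdist_le => /= e e0.
have eE : e = (complex.Re e)%:C.
  by apply: complexP => //=; rewrite (ger0_Im (ltW e0)).
have e0' : 0 < complex.Re e by move: e0; rewrite ltcE => /andP[].
pose d := Num.min r (complex.Re e * r ^+ 2 / (Lbound s r + 1)).
have d0 : 0 < d.
  by rewrite lt_min r0 /= divr_gt0 ?mulr_gt0 ?exprn_gt0//; lra.
have d0' : 0 < d%:C :> R[i] by rewrite -(rmorph0 (real_complex R)) ltcR.
near=> h.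
have hn0 : h != 0 by near: h; exact: (@nbhs_dnbhs_neq R[i]^o 0).
have hd : nrm h <= d.
  rewrite -lecR -normE; near: h; exact: (@dnbhs0_le R[i] R[i]^o).
have hr : nrm (- h) <= r by rewrite nrmN (le_trans hd)// /d ge_min lexx.
have [H _] := Lfun_power_series (ltW r0) rs hr.
(* The expansion is in [- h], hence the derivative [- acoef s 1]; the remainder after two terms is
   of order h^2. *)
have := power_series_rem 2 r0 aB hr H.
rewrite !big_ord_recl big_ord0 /= /bump /= expr0 expr1 mulr1 addr0 opprK -(Lfun0 s0) nrmN.
move=> Hh; rewrite /shift /= eE normE lecR.
have -> : h *: (1 : R[i]^o) = h by rewrite /GRing.scale /= mulr1.
have hp : 0 < nrm h by rewrite nrm_gt0.
have -> : - acoef s 1 - h^-1 *: (Lfun (h + s) - Lfun s) =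
  - (h^-1 * (Lfun (s + h) - (Lfun s + acoef s 1 * - h))).
  rewrite -[h^-1 *: _]/(h^-1 * (Lfun (h + s) - Lfun s)) [h + s]addrC.
  by field.
rewrite nrmN nrmM nrmV mulrC ler_pdivrMr// (le_trans Hh)//.
rewrite exprMn exprVn mulrA ler_pdivrMr ?exprn_gt0//.
have : nrm h <= complex.Re e * r ^+ 2 / (Lbound s r + 1).
  by rewrite (le_trans hd)// /d ge_min lexx orbT.
rewrite ler_pdivlMr ?ltr_wpDl// expr2 => H3.
have := ler_wpM2r (ltW hp) H3.
nra.
Unshelve. all: by end_near.
Qed.

Lemma Lfun_dirichlet_L : dirichlet_L_function chi (Lfun : R[i]^o -> R[i]^o).
Proof.
split=> [s s1|s s0 _]; last exact: Lfun_derivable.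
have s0 : 0 < complex.Re s by exact: lt_trans s1.
apply/cvgrPdist_le => /= e e0.
have eE : e = (complex.Re e)%:C.
  by apply: complexP => //=; rewrite (ger0_Im (ltW e0)).
have e0' : 0 < complex.Re e by move: e0; rewrite ltcE => /andP[].
have [N0 H] := Lfun_dirichlet_series s0 e0'.
exists (maxn N0 1) => // N; rewrite /= geq_max => /andP[/H + N1].
rewrite eE normE lecR nrmC -(big_mkord xpredT (fun k => chi k * cpw k s)).
rewrite big_ltn// cpw0 mulr0 add0r; congr (nrm (_ - _) <= _).
by apply: eq_big_nat => k /andP[k1 _]; rewrite cpwE.
Qed.

End LSeries.

(** * Dirichlet characters and their partial sums *)

Section Characters.
Local Open Scope ring_scope.
Local Open Scope complex_scope.
Variables (R : realType) (N : nat) (chi : nat -> R[i]).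
Hypotheses (N1 : (1 < N)%N) (chiP : dirichlet_character N chi).
Implicit Types (a k n : nat).

Lemma char_period n a : chi (a + n * N)%N = chi a.
Proof.
elim: n => [|n IH]; first by rewrite mul0n addn0.
by rewrite mulSn addnCA addnC (dirichlet_period chiP).
Qed.

Lemma char_mod a : chi (a %% N)%N = chi a.
Proof. by rewrite {2}(divn_eq a N) addnC char_period. Qed.

Lemma char_eqmod a b : a = b %[mod N] -> chi a = chi b.
Proof. by move=> ab; rewrite -char_mod ab char_mod. Qed.

Lemma charX a k : chi (a ^ k)%N = chi a ^+ k.
Proof.
elim: k => [|k IH]; first by rewrite expn0 (dirichlet1 chiP).
by rewrite expnS (dirichletM chiP) IH exprS.
Qed.

Lemma char0 : chi 0%N = 0.
Proof.
apply/eqP/negPn; rewrite (dirichlet_neq0 chiP) /coprime gcd0n.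
by rewrite neq_ltn N1 orbT.
Qed.

Lemma char_notcoprime a : ~~ coprime a N -> chi a = 0.
Proof. by rewrite -(dirichlet_neq0 chiP) negbK => /eqP. Qed.

Lemma nrm_char a : coprime a N -> nrm (chi a) = 1.
Proof.
move=> aN; have := Euler_exp_totient aN => /char_eqmod.
rewrite charX (dirichlet1 chiP) => /(congr1 (@nrm R)); rewrite nrmX nrm1 => /eqP.
have t0 : (0 < totient N)%N by rewrite totient_gt0 ltnW.
by rewrite pexpr_eq1 ?nrm_ge0// => /eqP.
Qed.

Lemma nrm_char_le a : nrm (chi a) <= 1.
Proof.
by case: (boolP (coprime a N)) => [/nrm_char->//|/char_notcoprime->]; rewrite nrm0.
Qed.

(** Multiplication by [a] permutes the residues modulo [N], so the sum is unchanged by the factor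
    [chi a], which is not 1. *)
Lemma char_sum0 : (exists2 a, coprime a N & chi a != 1) -> \sum_(k < N) chi k = 0.
Proof.
case=> a aN chia1; set S := \sum_(k < N) chi k.
have N0 : (0 < N)%N by rewrite ltnW.
pose h (k : 'I_N) : 'I_N := Ordinal (ltn_pmod (a * k)%N N0).
have hi : injective h.
  move=> x y /(congr1 val) /= /eqP => E; apply: val_inj.
  wlog xy : x y E / (x <= y)%N.
    by move=> W; case/orP: (leq_total x y) => h1; [exact: W|apply/esym/W; rewrite // eq_sym].
  move: E; rewrite eq_sym eqn_mod_dvd ?leq_mul// -mulnBr Gauss_dvdr; last by rewrite coprime_sym.
  case: (posnP (y - x)) => [|h0 /dvdn_leq -/(_ h0)].
    by move=> /eqP; rewrite subn_eq0 => yx _; apply/eqP; rewrite eqn_leq xy.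
  by rewrite leqNgt (leq_ltn_trans (leq_subr x y)).
have : chi a * S = S.
  rewrite {2}/S (reindex_inj hi) mulr_sumr; apply: eq_bigr => k _.
  by rewrite /= char_mod (dirichletM chiP).
move/eqP; rewrite -subr_eq0 -[X in _ - X]mul1r -mulrBl mulf_eq0 subr_eq0.
by rewrite (negbTE chia1) => /eqP.
Qed.

(** Full periods cancel. The crude bound [N] suffices since it enters the final estimate only
    through its logarithm. *)
Lemma char_psum_le n : (exists2 a, coprime a N & chi a != 1) ->
  nrm (psum chi n) <= N%:R.
Proof.
move=> chi1; rewrite /psum; move: (n.+1) => m {n}.
have [k] := ubnP m; elim: k m => // k IH m mk.
case: (leqP m N) => [mN|Nm].
  apply: le_trans (nrm_sum _ _ _) _.
  apply: (@le_trans _ _ (\sum_(i < m) 1)); first by apply: ler_sum => i _; exact: nrm_char_le.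
  by rewrite sumr_const card_ord ler_nat.
rewrite -(subnKC (ltnW Nm)) big_split_ord /= (char_sum0 chi1) add0r.
under eq_bigr => i _ do rewrite addnC (dirichlet_period chiP).
apply: IH; apply: (@leq_trans m) => //; rewrite ltn_subrL.
by rewrite (leq_trans _ (ltnW Nm)) ltnW.
Qed.

End Characters.

(** * Non-vanishing for Re s >= 1 *)

Section EulerProduct.
Local Open Scope ring_scope.
Local Open Scope complex_scope.
Variable R : realType.
Implicit Types (u v z w : R[i]) (r t e : R) (g : nat -> R[i]).

Lemma geo_sum_le r n : 0 <= r < 1 -> \sum_(i < n) r ^+ i <= (1 - r)^-1.
Proof.
move=> /andP[r0 r1]; have h : 0 < 1 - r by rewrite subr_gt0.
rewrite -[leRHS]mul1r ler_pdivlMr// -opprB mulrN mulrC -subrX1 opprB.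
by rewrite gerBl exprn_ge0.
Qed.

Lemma pow_small r e : 0 <= r < 1 -> 0 < e -> exists n, forall m, (n <= m)%N -> r ^+ m <= e.
Proof.
move=> r01 e0; have /andP[r0 r1] := r01.
have [n H] := abs_bounded_tail (R := R) (u := fun n => (r ^+ n)%:C)
  (B := (1 - r)^-1) (e := e) ltac:(by move=> N;
   under eq_bigr => i _ do rewrite nrm_nneg ?exprn_ge0//; exact: geo_sum_le) e0.
exists n => m /H /abs_bounded_term => /(_ 0%N).
by rewrite addn0 nrm_nneg// exprn_ge0.
Qed.

(** Truncated series of the real part of - log (1 - u). *)
Definition logsum J u := \sum_(j < J) complex.Re (u ^+ j.+1) / j.+1%:R.

Lemma nrm_1B_sqr u : nrm (1 - u) ^+ 2 = 1 - complex.Re u *+ 2 + nrm u ^+ 2.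
Proof. by rewrite !nrm_sqr !ReD !ImD !ReN !ImN /=; ring. Qed.

(** The left side taken at t u vanishes for t = 0 and has derivative - Re (u (t u)^J / (1 - t u)),
    the geometric tail, which is bounded by the right side for t in [0, 1]. *)
Lemma ln_nrm_1B J u : nrm u < 1 ->
  `|ln (nrm (1 - u)) + logsum J u| <= nrm u ^+ J.+1 / (1 - nrm u).
Proof.
move=> u1; set C := _ / _.
have ut t : 0 <= t <= 1 -> nrm (t%:C * u) <= nrm u.
  by move=> /andP[t0 t1]; rewrite nrmM nrm_nneg// ler_piMl// nrm_ge0.
have pos t : 0 <= t <= 1 -> 0 < nrm (1 - t%:C * u).
  move=> /ut h; have := nrm_lb 1 (- (t%:C * u)); rewrite nrm1 nrmN; lra.
pose a := complex.Re u; pose b := nrm u ^+ 2.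
(* The squared modulus of 1 - t u is a polynomial in [t], so half its logarithm is differentiable
   without handling a square root. *)
pose q (t : R) : R := 1 - t * a *+ 2 + t ^+ 2 * b.
have qE t : 0 <= t -> q t = nrm (1 - t%:C * u) ^+ 2.
  by move=> t0; rewrite nrm_1B_sqr ReMr nrmM nrm_nneg// exprMn.
pose psi t : R := ln (q t) / 2 + \sum_(j < J) complex.Re (u ^+ j.+1) * (t ^+ j.+1 / j.+1%:R).
pose dpsi t : R := - complex.Re (u * (t%:C * u) ^+ J / (1 - t%:C * u)).
have dq t : is_derive t 1 q (- (a *+ 2) + t * b *+ 2).
  rewrite /q; have d1 := is_derive_lin (a *+ 2) t.
  have d2 := rderM (is_derive_id t (1 : R)) (is_derive_lin b t).
  rewrite (_ : (fun t => _) = cst (1 : R) - (fun t : R => a *+ 2 * t) + (fun t : R => t * (b * t))).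
    by apply: is_derive_eq (is_deriveD (is_deriveB (is_derive_cst (1 : R) t (1 : R)) d1) d2) _; ring.
  by apply/funext => x; rewrite !fctE; ring.
have dpow1 j t : is_derive t 1 (fun t : R => t ^+ j.+1 / j.+1%:R) (t ^+ j).
  have n0 : (j.+1%:R : R) != 0 by rewrite pnatr_eq0.
  have d := is_derive_dpow j.+1 t.
  rewrite (_ : (fun t => _) = (fun t => (j`!)%:R * dpow j.+1 t)); last first.
    apply/funext => x; rewrite /dpow factS natrM invfM mulrCA; congr (_ * _).
    by rewrite mulrCA mulrV ?mulr1// unitfE pnatr_eq0 -lt0n fact_gt0.
  apply: is_derive_eq (rderM (is_derive_cst ((j`!)%:R : R) t (1 : R)) d) _.
  rewrite mul0r add0r /ddpow /dpow mulrC divfK//.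
have dpsiE t : 0 <= t <= 1 -> is_derive t 1 psi (dpsi t).
  move=> t01; have t0 : 0 <= t by case/andP: t01.
  have q0 : 0 < q t by rewrite qE// exprn_gt0// pos.
  have d1 := is_derive1_comp (is_derive1_ln q0) (dq t).
  have d2 : is_derive t 1 (fun t => \sum_(j < J) complex.Re (u ^+ j.+1) * (t ^+ j.+1 / j.+1%:R))
     (\sum_(j < J) complex.Re (u ^+ j.+1) * t ^+ j).
    have [+ _] := @cder_sum R J (fun j t => u ^+ j.+1 * (t ^+ j.+1 / j.+1%:R)%:C) _ t
      (fun j => cderZ (u ^+ j.+1) (cder_real (dpow1 j t))).
    rewrite Re_sum; under eq_bigr => j _ do rewrite mulrC ReMr mulrC.
    congr (is_derive _ _ _ _); apply/funext => x; rewrite Re_sum.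
    by apply: eq_bigr => j _; rewrite mulrC ReMr mulrC.
  apply: is_derive_eq (is_deriveD (rderM d1 (is_derive_cst (2^-1 : R) t (1 : R))) d2) _.
  rewrite mulr0 addr0.
  have w0 : 1 - t%:C * u != 0 by rewrite -nrm_gt0 pos.
  have -> : \sum_(j < J) complex.Re (u ^+ j.+1) * t ^+ j =
     complex.Re (\sum_(j < J) u * (t%:C * u) ^+ j).
    rewrite Re_sum; apply: eq_bigr => j _.
    by rewrite exprMn mulrCA -rmorphXn ReMr exprS mulrC.
  rewrite -mulr_sumr.
  have -> : \sum_(j < J) (t%:C * u) ^+ j = (1 - (t%:C * u) ^+ J) / (1 - t%:C * u).
    apply: (mulfI w0); rewrite mulrCA divff// mulr1.
    by rewrite -[in RHS]opprB subrX1 -[in LHS]opprB mulNr.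
  have E : complex.Re (u / (1 - t%:C * u)) = (a - t * b) / q t.
    have -> : (u / (1 - t%:C * u)) = ((q t)^-1)%:C * (u * (1 - t%:C * u)^*).
      have qw : (q t)%:C = (1 - t%:C * u) * (1 - t%:C * u)^*.
        by rewrite qE// -sqr_normc normE rmorphXn.
      have wc0 : (1 - t%:C * u)^* != 0 by rewrite conjc_eq0.
      have -> : ((q t)^-1)%:C = ((1 - t%:C * u) * (1 - t%:C * u)^*)^-1.
        by rewrite -qw fmorphV.
      have gen (w wc : R[i]) : wc != 0 -> u / w = (w * wc)^-1 * (u * wc).
        by move=> wc1; rewrite invfM mulrACA mulVf// mulr1 mulrC.
      exact: gen.
    rewrite ReMr mulrC; congr (_ / _); rewrite /b nrm_sqr /a.
    by case: (u) => x y /=; ring.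
  rewrite [u * (_ / _)](_ : _ = u / (1 - t%:C * u) - u * (t%:C * u) ^+ J / (1 - t%:C * u)).
    by rewrite ReD ReN E /dpsi /=; field; rewrite gt_eqF.
  by rewrite mulrA mulrBr mulr1 mulrBl.
have psi1 : psi 1 = ln (nrm (1 - u)) + logsum J u.
  rewrite /psi qE// mul1r lnXn; last by have := pos 1; rewrite mul1r; apply; rewrite ler01 lexx.
  congr (_ + _); first by field.
  by apply: eq_bigr => j _; rewrite expr1n mul1r.
have psi0 : psi 0 = 0.
  rewrite /psi /q !mul0r mul0rn subr0 expr0n mul0r addr0 ln1 mul0r add0r big1// => j _.
  by rewrite expr0n !mul0r mulr0.
have := @complex_MVT R (fun t => (psi t)%:C) (fun t => (dpsi t)%:C)
  (fun t => C * t) (fun=> C) 0 1 ler01.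
rewrite psi0 psi1 rmorph0 subr0 mulr0 subr0 mulr1 nrm_real; apply => t t01.
- exact/cder_real/dpsiE.
- exact: is_derive_lin.
rewrite nrm_real normrN (le_trans (Re_le_nrm _))// !nrmM nrmV nrmX.
have w0 := pos t t01.
rewrite ler_pdivrMr// /C mulrAC ler_pdivlMr ?subr_gt0//.
rewrite exprS -[leRHS]mulrA -[leLHS]mulrA ler_wpM2l ?nrm_ge0//.
have h1 : 1 - nrm u <= nrm (1 - t%:C * u).
  have := nrm_lb 1 (- (t%:C * u)); have := ut t t01; rewrite nrm1 nrmN; lra.
rewrite ler_pM ?exprn_ge0 ?nrm_ge0 ?subr_ge0 ?(ltW u1)//.
by rewrite lerXn2r ?nnegrE ?nrm_ge0// ut.
Qed.

(** The logarithm of the product is minus a series whose terms are r^j / j times 3 + 4 cos a + cos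
    2a >= 0. *)
Lemma mertens_factor r u : 0 <= r < 1 -> nrm u = 1 ->
  nrm (1 - r%:C) ^+ 3 * nrm (1 - r%:C * u) ^+ 4 * nrm (1 - r%:C * u ^+ 2) <= 1.
Proof.
move=> /andP[r0 r1] u1.
have e1 : nrm r%:C = r by rewrite nrm_nneg.
have e2 : nrm (r%:C * u) = r by rewrite nrmM u1 mulr1.
have e3 : nrm (r%:C * u ^+ 2) = r by rewrite nrmM nrmX u1 expr1n mulr1.
have n1 : nrm r%:C < 1 by rewrite e1.
have n2 : nrm (r%:C * u) < 1 by rewrite e2.
have n3 : nrm (r%:C * u ^+ 2) < 1 by rewrite e3.
have pos z : nrm z < 1 -> 0 < nrm (1 - z).
  by move=> h; have := nrm_lb 1 (- z); rewrite nrm1 nrmN; lra.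
have p1 := pos _ n1; have p2 := pos _ n2; have p3 := pos _ n3.
have P0 : 0 < nrm (1 - r%:C) ^+ 3 * nrm (1 - r%:C * u) ^+ 4 * nrm (1 - r%:C * u ^+ 2).
  by rewrite !mulr_gt0 ?exprn_gt0.
rewrite -(lnK P0) -expR0 ler_expR; apply: le_addeps => e e0; rewrite add0r.
rewrite lnM ?posrE ?mulr_gt0 ?exprn_gt0// lnM ?posrE ?exprn_gt0//.
rewrite (lnXn 3 p1) (lnXn 4 p2).
have [n H] := @pow_small r (e * (1 - r) / 8) ltac:(by rewrite r0) ltac:(by
  rewrite divr_gt0 ?mulr_gt0 ?subr_gt0).
have := ln_nrm_1B n n1; have := ln_nrm_1B n n2; have := ln_nrm_1B n n3.
rewrite e1 e2 e3 !ler_norml.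
have : r ^+ n.+1 / (1 - r) <= e / 8.
  by rewrite ler_pdivrMr ?subr_gt0// mulrAC H.
have : 0 <= 3 * logsum n r%:C + 4 * logsum n (r%:C * u) + logsum n (r%:C * u ^+ 2).
  rewrite /logsum !mulr_sumr -!big_split; apply: sumr_ge0 => j _ /=.
  rewrite [X in 0 <= X](_ : _ = (3 * complex.Re (r%:C ^+ j.+1) +
    4 * complex.Re ((r%:C * u) ^+ j.+1) +
    complex.Re ((r%:C * u ^+ 2) ^+ j.+1)) / j.+1%:R); last by ring.
  apply: divr_ge0 => //.
  have -> : (r%:C * u) ^+ j.+1 = (r ^+ j.+1)%:C * u ^+ j.+1 by rewrite exprMn rmorphXn.
  have -> : (r%:C * u ^+ 2) ^+ j.+1 = (r ^+ j.+1)%:C * (u ^+ j.+1) ^+ 2.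
    by rewrite exprMn rmorphXn -[_ ^+ _ ^+ j.+1]exprM -[_ ^+ _ ^+ 2]exprM mulnC.
  rewrite -rmorphXn !ReMr.
  have := nrm_sqr (u ^+ j.+1); rewrite nrmX u1 !expr1n.
  move: (u ^+ j.+1) => [x y] /= h.
  have := exprn_ge0 j.+1 r0; move: (r ^+ j.+1) => q q0.
  (* For x^2 + y^2 = 1 one has 3 + 4 x + (x^2 - y^2) = 2 (1 + x)^2. *)
  rewrite [leRHS](_ : _ = q * (2 * (1 + x) ^+ 2)).
    by rewrite mulr_ge0// mulr_ge0// sqr_ge0.
  have -> : y * y = 1 - x ^+ 2 by rewrite h; ring.
  by ring.
move: (ln _) (ln _) (ln _) => A1 A2 A3.
move: (logsum _ _) (logsum _ _) (logsum _ _) (_ / (1 - r)) => B1 B2 B3 T h1 h2.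
move=> /andP[_ h3] /andP[_ h4] /andP[_ h5].
clear -h1 h2 h3 h4 h5; lra.
Qed.

(** Replaces [mertens_factor] at the primes dividing the modulus, where the character vanishes and
    the middle factor is 1. *)
Lemma mertens_factor0 r v : 0 <= r < 1 -> nrm v <= 1 ->
  nrm (1 - r%:C) ^+ 3 * nrm (1 - r%:C * v) <= 1.
Proof.
move=> /andP[r0 r1] v1.
have -> : nrm (1 - r%:C) = 1 - r.
  by rewrite -(rmorph1 (real_complex R)) -rmorphB nrm_nneg// subr_ge0 ltW.
have h : nrm (1 - r%:C * v) <= 1 + r.
  apply: le_trans (nrmB _ _) _; rewrite nrm1 nrmM nrm_nneg// lerD2l.
  by rewrite ler_piMr.
have h3 : 0 <= (1 - r) ^+ 3 by rewrite exprn_ge0// subr_ge0 ltW.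
by apply: le_trans (ler_wpM2l h3 h) _; nra.
Qed.

Fixpoint rough N n := if N is M.+1 then rough M n && (prime M ==> ~~ (M %| n)%N) else true.

Lemma roughP N n : reflect (forall p, (p < N)%N -> prime p -> ~~ (p %| n)%N) (rough N n).
Proof.
elim: N => [|N IH] /=; first by left.
apply: (iffP andP) => [[/IH h /implyP h'] p|h].
  by rewrite ltnS leq_eqVlt => /orP[/eqP->|/h].
split; first by apply/IH => p pN; apply: h; rewrite ltnW.
by apply/implyP; exact: h.
Qed.

Definition sieve g N n : R[i] := if rough N n then g n else 0.

(** Partial sums of the dilated series are partial sums of the original one, of a length [c] that is
    about 1 / N of theirs. *)
Lemma has_sum_dilate g l N : (0 < N)%N -> has_sum g l ->
  has_sum (fun n => if (N %| n)%N then g (n %/ N)%N else 0) l.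
Proof.
move=> N0 gl; have E M : exists2 c, (M <= c * N < M + N)%N &
    \sum_(n < M) (if (N %| n)%N then g (n %/ N)%N else 0) = \sum_(j < c) g j.
  elim: M => [|M [c /andP[c1 c2] IH]]; first by exists 0%N; rewrite ?mul0n ?N0 ?big_ord0.
  rewrite big_ord_recr IH /=; case: ifP => [/dvdnP[d Md]|NM].
    have cd : c = d.
      move: c1 c2; rewrite Md -mulSnr leq_pmul2r// ltn_pmul2r// ltnS => h1 h2.
      by apply/eqP; rewrite eqn_leq h2 h1.
    exists c.+1; last by rewrite big_ord_recr /= Md mulnK// cd.
    by rewrite mulSn cd -Md addSn addnC ltnS leqnn andbT -[M.+1]addn1 leq_add2l.
  exists c; last by rewrite addr0.
  rewrite ltn_neqAle c1 andbT addSn (leq_trans c2 (leqnSn _)) andbT.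
  by apply/eqP => h; rewrite h dvdn_mull in NM.
move=> e /gl[N1 H]; exists (N1 * N)%N => M NM; have [c /andP[c1 _] ->] := E M.
by apply: H; rewrite -(leq_pmul2r N0) (leq_trans NM).
Qed.

Section CompletelyMultiplicative.
Variables (g : nat -> R[i]) (l : R[i]) (B : R).
Hypotheses (g0 : g 0%N = 0) (g1 : g 1%N = 1).
Hypothesis gM : forall m n, g (m * n)%N = g m * g n.
Hypotheses (gB : abs_bounded g B) (gl : has_sum g l).

(** Subtracting [g p] times the series dilated by [p] deletes the multiples of [p]. *)
Lemma sieve_has_sum N :
  has_sum (sieve g N) (l * \prod_(p < N | prime p) (1 - g p)).
Proof.
elim: N => [|N IH]; first by rewrite big_ord0 mulr1; apply: has_sum_eq gl.
rewrite big_mkcond big_ord_recr /= -big_mkcond /=; case: ifP => [pN|npN]; last first.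
  by rewrite mulr1; apply: has_sum_eq IH => n; rewrite /sieve /= npN andbT.
have N0 := prime_gt0 pN.
have := has_sumB IH (has_sumZ (g N) (has_sum_dilate N0 IH)).
set P := \prod_(p < N | prime p) _.
have -> : l * P - g N * (l * P) = l * (P * (1 - g N)) by ring.
apply: has_sum_eq => n.
rewrite /sieve /= pN /=; case: (boolP (N %| n)%N) => [/dvdnP[m ->]|Nn] /=.
  rewrite andbF mulnK//.
  have -> : rough N (m * N) = rough N m.
    apply/roughP/roughP => h p pN' pp; first by apply: contra (h p pN' pp) => /dvdn_mulr.
    rewrite Euclid_dvdM// negb_or h//= dvdn_prime2//.
    by apply/eqP => E; rewrite E ltnn in pN'.
  by case: ifP => _; rewrite ?mulr0 ?subr0// gM mulrC subrr.
by rewrite andbT mulr0 subr0.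
Qed.

(** Sieving by all primes below [N] leaves the term 1 and terms of index at least [N]. Kept free of
    division, the statement also shows that [l] is nonzero. *)
Lemma euler_product : clim (fun N => l * \prod_(p < N | prime p) (1 - g p)) 1.
Proof.
move=> e e0; have [n0 H] := abs_bounded_tail gB e0.
exists (maxn n0 2) => N; rewrite geq_max => /andP[/H tN N2].
have E : \sum_(n < N) sieve g N n = 1.
  case: N N2 tN => [|[|N]]// _ _; rewrite big_ord_recl big_ord_recl big1 => [|i _].
    rewrite addr0 /sieve g0 if_same add0r ifT ?g1//.
    by apply/roughP => p _ pp; rewrite dvdn1; case: eqP pp => // ->.
  rewrite /sieve ifF//; apply/negP => /roughP h.
  have := h (pdiv (bump 0 (bump 0 i))).
  rewrite pdiv_dvd pdiv_prime// => /(_ _ isT) h'; apply: notF; apply: h'.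
  rewrite (leq_ltn_trans (pdiv_leq _))//.
  by rewrite /bump /= !add1n !ltnS.
have := @has_sum_dist_le _ _ _ N e (sieve_has_sum N).
rewrite E; apply => M; apply: le_trans (tN M).
by apply: ler_sum => i _; rewrite /sieve; case: ifP => // _; rewrite nrm0 nrm_ge0.
Qed.

Lemma euler_neq0 : l != 0.
Proof.
apply/eqP => l0; have [N H] := euler_product (e := 2^-1) ltac:(by rewrite invr_gt0).
have := H N (leqnn _); rewrite l0 mul0r sub0r nrmN nrm1; lra.
Qed.

End CompletelyMultiplicative.

(** The values times the finite products tend to 1, whereas the products are at most 1 factor by
    factor. *)
Lemma mertens_ineq (g0 g1 g2 : nat -> R[i]) l0 l1 l2 B0 B1 B2 :
  g0 0%N = 0 -> g0 1%N = 1 -> (forall m n, g0 (m * n)%N = g0 m * g0 n) ->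
  g1 0%N = 0 -> g1 1%N = 1 -> (forall m n, g1 (m * n)%N = g1 m * g1 n) ->
  g2 0%N = 0 -> g2 1%N = 1 -> (forall m n, g2 (m * n)%N = g2 m * g2 n) ->
  abs_bounded g0 B0 -> abs_bounded g1 B1 -> abs_bounded g2 B2 ->
  has_sum g0 l0 -> has_sum g1 l1 -> has_sum g2 l2 ->
  (forall p, prime p ->
    nrm (1 - g0 p) ^+ 3 * nrm (1 - g1 p) ^+ 4 * nrm (1 - g2 p) <= 1) ->
  1 <= nrm l0 ^+ 3 * nrm l1 ^+ 4 * nrm l2.
Proof.
move=> a0 a1 aM b0 b1 bM c0 c1 cM aB bB cB al bl cl H.
have A := euler_product a0 a1 aM aB al.
have A' := euler_product b0 b1 bM bB bl.
have A'' := euler_product c0 c1 cM cB cl.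
have := climM (climM (climM A (climM A A)) (climM (climM A' A') (climM A' A'))) A''.
rewrite !mulr1 => C; apply: le_addeps => e e0.
have [N HN] := clim_nrm C e0; have := HN N (leqnn _).
rewrite nrm1 !nrmM !nrm_prod ler_norml => /andP[+ _].
have : 0 <= \prod_(p < N | prime p) (nrm (1 - g0 p) ^+ 3 * nrm (1 - g1 p) ^+ 4 * nrm (1 - g2 p)) <= 1.
  elim/big_rec: _ => [|p y pp /andP[y0 y1]]; first by rewrite ler01 lexx.
  have h : 0 <= nrm (1 - g0 p) ^+ 3 * nrm (1 - g1 p) ^+ 4 * nrm (1 - g2 p).
    by rewrite !mulr_ge0 ?exprn_ge0 ?nrm_ge0.
  by rewrite mulr_ge0//= -[leRHS]mulr1 ler_pM// H.
rewrite big_split big_split /= !prodrXl.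
move: (\prod_(p < N | prime p) nrm (1 - g0 p)) => p.
move: (\prod_(p < N | prime p) nrm (1 - g1 p)) => q.
move: (\prod_(p < N | prime p) nrm (1 - g2 p)) => s.
have : 0 <= nrm l0 ^+ 3 * nrm l1 ^+ 4 * nrm l2.
  by rewrite !mulr_ge0 ?exprn_ge0 ?nrm_ge0.
move: (nrm l0) (nrm l1) (nrm l2) => a b c abc /andP[Y0 Y1].
rewrite lerBrDr [X in _ <= X](_ : _ = (a ^+ 3 * b ^+ 4 * c) * (p ^+ 3 * q ^+ 4 * s)); last by ring.
move: (a ^+ 3 * b ^+ 4 * c) (p ^+ 3 * q ^+ 4 * s) abc Y0 Y1 => x y x0 y0 y1; nra.
Qed.

End EulerProduct.

Section NonVanishing.
Local Open Scope ring_scope.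
Local Open Scope complex_scope.
Variable R : realType.
Implicit Types (s w z : R[i]) (x y : R) (n m : nat).

Lemma abs_bounded_pw (u : nat -> R[i]) x : 0 < x ->
  (forall n, nrm (u n) <= pw n (1 + x)) -> abs_bounded u (1 + x^-1).
Proof.
move=> x0 H N; apply: le_trans (sum_pw_le N x0); exact: ler_sum.
Qed.

Lemma abs_bounded_cpw s x : 0 < x -> complex.Re s = 1 + x ->
  abs_bounded (fun n => cpw n s) (1 + x^-1).
Proof. by move=> x0 sx; apply: abs_bounded_pw => // n; rewrite nrm_cpw sx. Qed.

Lemma cpw_double n s : cpw n (s + s) = cpw n s ^+ 2.
Proof. by rewrite cpwD expr2. Qed.

Lemma pw_lt1 n x : (1 < n)%N -> 0 < x -> 0 <= pw n x < 1.
Proof.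
move=> n1 x0; rewrite pw_ge0 /=; case: n n1 => // n n1.
by rewrite /pw expR_lt1 oppr_lt0 mulr_gt0// ln_gt0// ltr1n.
Qed.

(* Comparison of [n^(-s)] with the telescoping [(n^(1-s) - (n+1)^(1-s)) / (s-1)]. *)
Lemma zeta_near_1 s l x : 0 < x -> complex.Re s = 1 + x ->
  has_sum (fun n => cpw n s) l -> nrm (s - 1) * nrm l <= 2 + 2 * nrm (s - 1) * nrm s.
Proof.
move=> x0 sx sl; have s0 : 0 <= complex.Re s by rewrite sx; lra.
rewrite -nrmM; apply: (clim_nrm_le (clim_sub (climZ (s - 1) sl) leqnSn)) => N.
rewrite mulr_sumr big_ord_recl cpw0 mulr0 add0r.
have -> : \sum_(i < N) (s - 1) * cpw (bump 0 i) s =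
  (1 - cpw N.+1 (s - 1)) - \sum_(i < N) (cpw i.+1 (s - 1) - cpw i.+2 (s - 1) - (s - 1) * cpw i.+1 s).
  rewrite [X in _ = _ - X]sumrB.
  have -> : \sum_(i < N) (cpw i.+1 (s - 1) - cpw i.+2 (s - 1)) = 1 - cpw N.+1 (s - 1).
    elim: N => [|N IH]; first by rewrite big_ord0 cpw1 subrr.
    by rewrite big_ord_recr IH /=; ring.
  by rewrite subKr.
apply: le_trans (nrmB _ _) _; apply: lerD.
  apply: le_trans (nrmB _ _) _; rewrite nrm1 nrm_cpw.
  have -> : complex.Re (s - 1) = x by rewrite ReD ReN sx /=; ring.
  rewrite (_ : 2 = 1 + 1)// lerD2l; case: N => [|N]; first by rewrite pw_1.
  by have /andP[_ /ltW] := @pw_lt1 N.+2 x isT x0.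
apply: le_trans (nrm_sum _ _ _) _.
apply: (@le_trans _ _ (\sum_(i < N) nrm (s - 1) * nrm s * pw i.+1 (1 + 1))).
  apply: ler_sum => i _; apply: le_trans (cpw_second_order (ltn0Sn i) s0) _.
  rewrite ler_wpM2l ?mulr_ge0 ?nrm_ge0// pw_le// sx; lra.
rewrite -mulr_sumr mulrC -mulrA ler_wpM2r ?mulr_ge0 ?nrm_ge0//.
have := @sum_pw_le R 1 N.+1 ltr01; rewrite big_ord_recl pw0 add0r invr1.
by move/le_trans; apply.
Qed.

Variables (N : nat) (chi : nat -> R[i]).
Hypotheses (N1 : (1 < N)%N) (chiP : dirichlet_character N chi).
Hypothesis chi1 : exists2 a, coprime a N & chi a != 1.

Local Notation L := (Lfun chi).

Let chi0 := char0 N1 chiP.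

Lemma char_twist_mul s m n :
  chi (m * n)%N * cpw (m * n) s = chi m * cpw m s * (chi n * cpw n s).
Proof. by rewrite (dirichletM chiP) cpwM mulrACA. Qed.

Lemma char_twist_bounded s x : 0 < x -> complex.Re s = 1 + x ->
  abs_bounded (fun n => chi n * cpw n s) (1 + x^-1).
Proof.
move=> x0 sx; apply: abs_bounded_pw => // n; rewrite nrmM nrm_cpw sx.
by rewrite ler_piMl ?pw_ge0// (nrm_char_le N1 chiP).
Qed.

Lemma L_series s : 0 < complex.Re s -> has_sum (fun n => chi n * cpw n s) (L s).
Proof.
exact: (Lfun_dirichlet_series chi0 (fun n => char_psum_le N1 chiP n chi1)).
Qed.

Lemma L_neq0_gt1 s : 1 < complex.Re s -> L s != 0.
Proof.
move=> s1; have x0 : 0 < complex.Re s - 1 by rewrite subr_gt0.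
have sx : complex.Re s = 1 + (complex.Re s - 1) by ring.
apply: (@euler_neq0 _ (fun n => chi n * cpw n s) _ (1 + (complex.Re s - 1)^-1)).
- by rewrite chi0 mul0r.
- by rewrite cpw1 (dirichlet1 chiP) mulr1.
- exact: char_twist_mul.
- exact: char_twist_bounded.
- by apply: L_series; exact: lt_trans s1.
Qed.

Lemma char_sqr : dirichlet_character N (fun n => chi n ^+ 2).
Proof.
split=> [|a b|a|a]; rewrite ?(dirichlet1 chiP) ?(dirichletM chiP) ?(dirichlet_period chiP)//.
- by rewrite expr1n.
- by rewrite exprMn.
- by rewrite expf_eq0 /= (dirichlet_neq0 chiP).
Qed.

(* The exponents 3 and 4 force [L s = 0] to contradict [3 + 4 cos t + cos 2t >= 0]. *)
Lemma L_mertens s (g2 : R -> nat -> R[i]) (l2 : R -> R[i]) C2 :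
  complex.Re s = 1 ->
  (forall x, 0 < x <= 2^-1 -> [/\ g2 x 0%N = 0, g2 x 1%N = 1,
     forall m n, g2 x (m * n)%N = g2 x m * g2 x n,
     abs_bounded (g2 x) (1 + x^-1) & has_sum (g2 x) (l2 x)]) ->
  (forall x, 0 < x <= 2^-1 -> nrm (l2 x) <= C2) ->
  (forall x p, 0 < x <= 2^-1 -> prime p -> let u := chi p * cpw p (s - 1) in
     exists2 v, g2 x p = (pw p (1 + x))%:C * v &
       (nrm u = 1 /\ v = u ^+ 2) \/ (u = 0 /\ nrm v <= 1)) ->
  L s != 0.
Proof.
move=> s1 H2 l2C Hp; apply/eqP => Ls.
have s0 : 0 < complex.Re s by rewrite s1.
have [C1 C10 HC] := Lfun_lipschitz chi0 (fun n => char_psum_le N1 chiP n chi1) s0.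
have C20 : 0 <= C2.
  by apply: le_trans (nrm_ge0 _) (l2C 2^-1 _); rewrite invr_gt0 ltr0n lexx.
have key x : 0 < x <= 2^-1 -> 1 <= 8 * C1 ^+ 4 * C2 * x.
  move=> xb; have /andP[x0 x1] := xb.
  have [a0 a1 aM aB al] := H2 x xb.
  have reb : complex.Re (1 + x%:C) = 1 + x :> R by rewrite ReD.
  have reb1 : complex.Re (s + x%:C) = 1 + x by rewrite ReD s1.
  have [l0 zl] := abs_bounded_sum (abs_bounded_cpw x0 reb).
  have := @mertens_ineq R (fun n => cpw n (1 + x%:C)) (fun n => chi n * cpw n (s + x%:C))
    (g2 x) l0 (L (s + x%:C)) (l2 x) _ _ _ (cpw0 _) (cpw1 _) (fun m n => cpwM m n _)
    _ _ (char_twist_mul _) a0 a1 aM (abs_bounded_cpw x0 reb) (char_twist_bounded x0 reb1)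
    aB zl _ al _.
  rewrite chi0 mul0r cpw1 mulr1 (dirichlet1 chiP).
  have posx : 0 < complex.Re (s + x%:C) by rewrite reb1; lra.
  move=> /(_ erefl erefl (L_series posx)) H.
  have {H} : 1 <= nrm l0 ^+ 3 * nrm (L (s + x%:C)) ^+ 4 * nrm (l2 x).
    apply: H => p pp; have [v -> uv] := Hp x p xb pp.
    have r01 := pw_lt1 (prime_gt1 pp) (x := 1 + x) ltac:(by lra).
    have -> : cpw p (1 + x%:C) = (pw p (1 + x))%:C.
      by rewrite -cpw_real rmorphD.
    have -> : chi p * cpw p (s + x%:C) =
       (pw p (1 + x))%:C * (chi p * cpw p (s - 1)).
      rewrite -cpw_real mulrCA -cpwD; congr (_ * cpw _ _).
      by rewrite rmorphD /=; ring.
    case: uv => [[u1 ->]|[-> v1]]; first exact: mertens_factor.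
    by rewrite mulr0 subr0 nrm1 expr1n mulr1; exact: mertens_factor0.
  have h0 : nrm l0 <= 2 / x.
    apply: le_trans (has_sum_nrm_le zl (abs_bounded_cpw x0 reb)) _.
    by rewrite ler_pdivlMr// mulrDl mulVf ?gt_eqF//; lra.
  (* The assumed zero makes this factor of order x; its fourth power beats the cube of zeta (1 + x),
     which is of order 1 / x. *)
  have h1 : nrm (L (s + x%:C)) <= C1 * x.
    have := HC x%:C; rewrite nrm_nneg ?(ltW x0)// Ls subr0; apply.
    by rewrite s1; lra.
  move/le_trans; apply; rewrite [leRHS](_ : _ = (2 / x) ^+ 3 * (C1 * x) ^+ 4 * C2).
    rewrite ler_pM ?mulr_ge0 ?exprn_ge0 ?nrm_ge0 ?l2C//.
    rewrite ler_pM ?exprn_ge0 ?nrm_ge0// lerXn2r// ?nnegrE ?nrm_ge0//.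
      by rewrite divr_ge0// ltW.
    by rewrite mulr_ge0// ltW.
  by field; rewrite gt_eqF.
pose K := 8 * C1 ^+ 4 * C2; have K0 : 0 <= K by rewrite !mulr_ge0 ?exprn_ge0.
have K1 : 0 < 2 * (K + 1) by lra.
have := key (2 * (K + 1))^-1; rewrite -/K ler_pdivlMr// invr_gt0 K1 /=.
have -> : (2 * (K + 1))^-1 <= 2^-1 by rewrite lef_pV2 ?posrE//; lra.
by move=> /(_ isT); lra.
Qed.

(** For s = 1 + it the third function is taken near s + (s - 1) = 1 + 2it. It is the L-function of
    [chi ^ 2] if that character is nonprincipal. Otherwise it is zeta, which is bounded there as 1 +
    2it stays away from the pole when t <> 0. What remains is s = 1 with a real character. *)
Lemma L_neq0_line s : complex.Re s = 1 ->
  (s != 1) || [exists a : 'I_N, coprime a N && (chi a ^+ 2 != 1)] -> L s != 0.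
Proof.
move=> s1; case: (boolP [exists a : 'I_N, _]) => [/existsP[a /andP[aN a2]] _|].
  have chi21 : exists2 a, coprime a N & chi a ^+ 2 != 1 by exists a.
  have c20 : (fun n => chi n ^+ 2) 0%N = 0 by rewrite chi0 expr0n.
  have pB n := char_psum_le N1 char_sqr n chi21.
  have re2 x : complex.Re (s + (s - 1) + x%:C) = 1 + x.
    by rewrite !ReD ReN s1 /=; ring.
  have p0 : 0 < complex.Re (s + (s - 1)) by have := re2 0; rewrite addr0 => ->; lra.
  have [C C0 HC] := Lfun_lipschitz c20 pB p0.
  apply: (@L_mertens s (fun x n => chi n ^+ 2 * cpw n (s + (s - 1) + x%:C))
    (fun x => Lfun (fun n => chi n ^+ 2) (s + (s - 1) + x%:C))
    (nrm (Lfun (fun n => chi n ^+ 2) (s + (s - 1))) + C)) => //.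
  - move=> x /andP[x0 x1]; split.
    + by rewrite cpw0 mulr0.
    + by rewrite cpw1 (dirichlet1 chiP) expr1n mulr1.
    + by move=> m n; rewrite (dirichletM chiP) cpwM exprMn mulrACA.
    + apply: abs_bounded_pw => // n; rewrite nrmM nrm_cpw re2.
      by rewrite ler_piMl ?pw_ge0// (nrm_char_le N1 char_sqr).
    + by apply: (Lfun_dirichlet_series c20 pB); rewrite re2; lra.
  - move=> x /andP[x0 x1]; have := HC x%:C; rewrite nrm_nneg ?(ltW x0)//.
    have -> : complex.Re (s + (s - 1)) = 1 by have := re2 0; rewrite !addr0.
    move=> /(_ ltac:(lra)) h.
    rewrite -[X in nrm X](subrK (Lfun (fun n => chi n ^+ 2) (s + (s - 1)))) addrC.
    apply: le_trans (nrmD _ _) _; rewrite lerD2l (le_trans h)// ler_piMr//; lra.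
  - move=> x p /andP[x0 x1] pp u; exists (u ^+ 2).
      rewrite -cpw_real exprMn -cpw_double mulrCA -cpwD; congr (_ * cpw _ _).
      by rewrite rmorphD /=; ring.
    case: (boolP (coprime p N)) => pN; [left|right].
      split=> //; rewrite /u nrmM (nrm_char N1 chiP pN) nrm_cpw ReD ReN s1 subrr mul1r.
      by rewrite pw_0// prime_gt0.
    by rewrite /u (char_notcoprime chiP pN) mul0r expr0n nrm0.
rewrite negb_exists orbF => /forallP H sn1.
have chi2 a : coprime a N -> chi a ^+ 2 = 1.
  move=> aN; have N0 : (0 < N)%N by rewrite ltnW.
  have := H (Ordinal (ltn_pmod a N0)); rewrite /= coprime_modl aN (char_mod chiP) /=.
  by rewrite negbK => /eqP.
have re2 x : complex.Re (s + (s - 1) + x%:C) = 1 + x.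
  by rewrite !ReD ReN s1 /=; ring.
have E x : 0 < x -> exists l, has_sum (fun n => cpw n (s + (s - 1) + x%:C)) l.
  by move=> x0; apply: abs_bounded_sum (abs_bounded_cpw x0 (re2 x)).
pose l2 x := csum (fun n => cpw n (s + (s - 1) + x%:C)).
have l2P x : 0 < x -> has_sum (fun n => cpw n (s + (s - 1) + x%:C)) (l2 x).
  by move=> x0; have [l hl] := E x x0; rewrite /l2 (csumE hl).
pose D := nrm ((s - 1) + (s - 1)).
have D0 : 0 < D by rewrite nrm_gt0 -mulr2n mulrn_eq0 /= subr_eq0.
have ImD' x : D <= nrm (s + (s - 1) + x%:C - 1).
  have -> : s + (s - 1) + x%:C - 1 = (s - 1) + (s - 1) + x%:C by ring.
  rewrite /D -(@ler_pXn2r _ 2) ?nnegrE ?nrm_ge0// !nrm_sqr !ReD !ImD !ReN s1 /=.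
  by rewrite !subrr !add0r !addr0 expr0n add0r lerDr sqr_ge0.
pose M := nrm (s + (s - 1)) + 1.
apply: (@L_mertens s (fun x n => cpw n (s + (s - 1) + x%:C)) l2 (2 / D + 2 * M)) => //.
- move=> x /andP[x0 x1]; split.
  + exact: cpw0.
  + exact: cpw1.
  + by move=> m n; exact: cpwM.
  + exact: abs_bounded_cpw x0 (re2 x).
  + exact: l2P.
- move=> x /andP[x0 x1]; have := zeta_near_1 x0 (re2 x) (l2P x x0).
  have := ImD' x; set T := nrm (_ - 1) => DT; have T0 : 0 < T by exact: lt_le_trans DT.
  have sM : nrm (s + (s - 1) + x%:C) <= M.
    apply: le_trans (nrmD _ _) _; rewrite lerD2l nrm_nneg ?(ltW x0)//; lra.
  move=> h; have : T * nrm (l2 x) <= T * (2 / D + 2 * M).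
    apply: le_trans h _; rewrite mulrDr lerD//.
      by rewrite mulrA ler_pdivlMr// mulrC ler_wpM2r.
    by rewrite mulrCA -mulrA ler_wpM2l// ler_wpM2l// ltW.
  by rewrite ler_pM2l.
- move=> x p /andP[x0 x1] pp u; exists (cpw p (s - 1) ^+ 2).
    rewrite -cpw_real -cpw_double -cpwD; congr cpw; rewrite rmorphD /=; ring.
  have c1 : nrm (cpw p (s - 1)) = 1.
    by rewrite nrm_cpw ReD ReN s1 subrr pw_0// prime_gt0.
  case: (boolP (coprime p N)) => pN; [left|right].
    by rewrite /u nrmM (nrm_char N1 chiP pN) c1 mulr1 exprMn chi2// mul1r.
  by rewrite /u (char_notcoprime chiP pN) mul0r nrmX c1 expr1n.
Qed.

End NonVanishing.

(** * Positivity of divisor sums of a real character *)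

Section DivisorSum.
Local Open Scope ring_scope.
Variables (R : realType) (f : nat -> R).
Hypotheses (f1 : f 1%N = 1) (fM : forall m n, f (m * n)%N = f m * f n).
Hypothesis f3 : forall n, [\/ f n = 0, f n = 1 | f n = -1].

Definition divsum n := \sum_(d <- divisors n) f d.

Lemma divisors_prime_power p k m : prime p -> ~~ (p %| m)%N -> (0 < m)%N ->
  perm_eq (divisors (p ^ k * m)) [seq (p ^ i * d)%N | i <- iota 0 k.+1, d <- divisors m].
Proof.
move=> pp pm m0; have p0 := prime_gt0 pp.
have pk0 i : (0 < p ^ i)%N by rewrite expn_gt0 p0.
have pd d : (d %| m)%N -> logn p d = 0%N.
  by move=> dm; rewrite logn_coprime// prime_coprime//; apply: contra pm => /dvdn_trans; exact.
have lg i d : (d %| m)%N -> logn p (p ^ i * d) = i.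
  by move=> dm; rewrite lognM ?pk0 ?(dvdn_gt0 m0 dm)// pfactorK// pd// addn0.
apply: uniq_perm; first exact: divisors_uniq.
  apply: allpairs_uniq; [exact: iota_uniq|exact: divisors_uniq|].
  move=> [i d] [j e] /allpairsP[[i' d'] [_ dm [-> ->]]].
  move=> /allpairsP[[j' e'] [_ em [-> ->]]] /= E.
  rewrite -!dvdn_divisors// in dm em.
  have ij : i' = j' by rewrite -(lg i' d')// E lg.
  by move: E => /eqP; rewrite ij eqn_pmul2l// => /eqP->.
move=> x; rewrite -dvdn_divisors ?muln_gt0 ?pk0//; apply/idP/allpairsP => [xn|].
  have x0 : (0 < x)%N by apply: dvdn_gt0 xn; rewrite muln_gt0 pk0.
  exists (logn p x, (x`_p^')%N); rewrite /= -p_part partnC//; split=> //.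
    rewrite -[0%N :: _]/(iota 0 k.+1) mem_iota add0n ltnS /=.
    by have := dvdn_leq_log p _ xn; rewrite muln_gt0 pk0 m0 lg// => /(_ isT).
  rewrite -dvdn_divisors// -(@Gauss_dvdr _ (p ^ k)).
    by apply: dvdn_trans xn; exact: dvdn_part.
  rewrite coprime_sym; apply: (@pnat_coprime p); last exact: part_pnat.
  by rewrite pnatX pnat_id.
move=> [[i d] [+ + ->]]; rewrite mem_iota add0n ltnS -dvdn_divisors// => ik dm.
by rewrite dvdn_mul// dvdn_exp2l.
Qed.

Lemma divsum_prime_power p k m : prime p -> ~~ (p %| m)%N -> (0 < m)%N ->
  divsum (p ^ k * m) = (\sum_(i < k.+1) f p ^+ i) * divsum m.
Proof.
move=> pp pm m0; have fX i : f (p ^ i)%N = f p ^+ i.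
  by elim: i => [|i IH]; rewrite ?expn0// expnS fM IH exprS.
rewrite /divsum (perm_big _ (divisors_prime_power k pp pm m0)) big_allpairs_dep.
rewrite -(big_mkord xpredT (fun i => f p ^+ i)) /index_iota subn0 mulr_suml.
apply: eq_bigr => i _; rewrite mulr_sumr; apply: eq_bigr => d _.
by rewrite fM fX.
Qed.

Lemma geo_f_ge p k : 0 <= \sum_(i < k.+1) f p ^+ i.
Proof.
case: (f3 p) => ->.
- by rewrite big_ord_recl expr0 big1 ?addr0// => i _; rewrite expr0n.
- by apply: sumr_ge0 => i _; rewrite expr1n.
suff -> : \sum_(i < k.+1) (-1) ^+ i = (~~ odd k)%:R :> R by [].
elim: k => [|k IH]; first by rewrite big_ord1 expr0.
rewrite big_ord_recr IH /= -signr_odd /=; case: odd => /=; rewrite ?expr0 ?expr1 ?add0r//.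
by rewrite addrN.
Qed.

Lemma geo_f_ge1 p k : 1 <= \sum_(i < k.*2.+1) f p ^+ i.
Proof.
case: (f3 p) => ->.
- by rewrite big_ord_recl expr0 big1 ?addr0// => i _; rewrite expr0n.
- by rewrite big_ord_recl expr0 lerDl; apply: sumr_ge0 => i _; rewrite expr1n.
suff -> : \sum_(i < k.*2.+1) (-1) ^+ i = 1 :> R by [].
elim: k => [|k IH]; first by rewrite big_ord1 expr0.
rewrite doubleS 2!big_ord_recr IH /= -signr_odd /= odd_double /= expr1.
by rewrite exprS -signr_odd /= odd_double /= expr1; ring.
Qed.

Lemma prime_part_split n : (1 < n)%N -> exists p k m,
  [/\ prime p, ~~ (p %| m)%N, (0 < m < n)%N & n = (p ^ k * m)%N].
Proof.
move=> n1; have n0 : (0 < n)%N by rewrite ltnW.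
have pp := pdiv_prime n1; set p := pdiv n in pp.
have kpos : (0 < logn p n)%N by rewrite logn_gt0 mem_primes pp n0 pdiv_dvd.
exists p, (logn p n), (n`_p^')%N; rewrite -p_part partnC// part_gt0; split=> //.
  by rewrite -prime_coprime//; apply: (@pnat_coprime p); [exact: pnat_id|exact: part_pnat].
rewrite /= -[ltnRHS](partnC p n0) ltn_Pmull ?part_gt0// p_part.
by rewrite -(expn0 p) ltn_exp2l// prime_gt1.
Qed.

Lemma divsum_ge0 n : (0 < n)%N -> 0 <= divsum n.
Proof.
elim/ltn_ind: n => n IH n0; case: (ltnP 1 n) => [n1|]; last first.
  by case: n n0 {IH} => [|[|]]// _ _; rewrite /divsum big_seq1 f1.
have [p [k [m [pp pm /andP[m0 mn] E]]]] := prime_part_split n1.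
by rewrite E divsum_prime_power// mulr_ge0// ?geo_f_ge// IH.
Qed.

(** In a square every prime has even exponent, so each local factor is a sum of an odd number of
    powers of 0, 1 or -1 starting with 1, hence at least 1. *)
Lemma divsum_sqr_ge1 n : (0 < n)%N -> 1 <= divsum (n * n).
Proof.
elim/ltn_ind: n => n IH n0; case: (ltnP 1 n) => [n1|]; last first.
  by case: n n0 {IH} => [|[|]]// _ _; rewrite /divsum big_seq1 f1.
have [p [k [m [pp pm /andP[m0 mn] E]]]] := prime_part_split n1.
rewrite E mulnACA -expnD addnn divsum_prime_power ?muln_gt0 ?m0//.
  by rewrite -[leLHS]mulr1 ler_pM// ?geo_f_ge1// IH.
by rewrite Euclid_dvdM// orbb.
Qed.

End DivisorSum.

(** * Non-vanishing at s = 1 for real characters *)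

Section Monsky.
Local Open Scope ring_scope.
Local Open Scope complex_scope.
Variable R : realType.
Implicit Types (x y : R) (n : nat).

Lemma bernoulli x n : 0 <= x -> x <= 1 -> 1 - n%:R * x <= (1 - x) ^+ n.
Proof.
move=> x0 x1; elim: n => [|n IH]; first by rewrite mul0r subr0 expr0.
have h : 0 <= 1 - x by rewrite subr_ge0.
rewrite exprS; apply: le_trans (ler_wpM2l h IH).
by rewrite -natr1; have : 0 <= n%:R :> R by []; nra.
Qed.

(** Pair the exponents i and n - 1 - i. The base is a square so that the geometric mean is again a
    power of [y]. *)
Lemma geo_AMGM y n : 0 <= y -> n%:R * y ^+ n.-1 <= \sum_(i < n) (y ^+ 2) ^+ i.
Proof.
move=> y0; suff H : 2 * (n%:R * y ^+ n.-1) <= 2 * \sum_(i < n) (y ^+ 2) ^+ i.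
  by rewrite -(@ler_pM2l _ 2).
have ES : \sum_(i < n) (y ^+ 2) ^+ i = \sum_(i < n) (y ^+ 2) ^+ (n - i.+1).
  by rewrite (reindex_inj rev_ord_inj).
have -> : 2 * \sum_(i < n) (y ^+ 2) ^+ i =
    \sum_(i < n) ((y ^+ 2) ^+ (n - i.+1) + (y ^+ 2) ^+ i).
  by rewrite big_split -ES /=; ring.
have -> : 2 * (n%:R * y ^+ n.-1) = \sum_(i < n) 2 * y ^+ n.-1.
  by rewrite sumr_const card_ord -mulr_natl; ring.
apply: ler_sum => i _; rewrite -!exprM !(mulnC 2) !exprM.
have -> : y ^+ n.-1 = y ^+ (n - i.+1) * y ^+ i.
  by rewrite -exprD; congr (_ ^+ _); have := ltn_ord i; lia.
by rewrite -subr_ge0 (_ : _ - _ = (y ^+ (n - i.+1) - y ^+ i) ^+ 2) ?sqr_ge0//; ring.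
Qed.

(* The sequence [b_n = 1/(n(1-x)) - x^n/(1-x^n)] of Monsky's proof of [L(1,chi) <> 0]. *)
Definition lambert_gap x n := n%:R^-1 / (1 - x) - x ^+ n / (1 - x ^+ n).

Lemma lambert_gap1 x : 0 < x < 1 -> lambert_gap x 1 = 1.
Proof.
move=> /andP[x0 x1]; rewrite /lambert_gap expr1 invr1 -mulrBl divff//.
by rewrite subr_eq0 gt_eqF.
Qed.

Lemma lambert_gapE x n : 0 < x < 1 -> (0 < n)%N ->
  lambert_gap x n = (1 - x)^-1 * (n%:R^-1 - x ^+ n / \sum_(i < n) x ^+ i).
Proof.
move=> /andP[x0 x1] n0; have h : 1 - x != 0 by rewrite subr_eq0 gt_eqF.
rewrite /lambert_gap.
have -> : 1 - x ^+ n = (1 - x) * \sum_(i < n) x ^+ i.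
  by rewrite -opprB subrX1 -mulNr opprB.
by rewrite invfM; ring.
Qed.

Lemma geo_gt0 x n : 0 < x -> (0 < n)%N -> 0 < \sum_(i < n) x ^+ i.
Proof.
move=> x0; case: n => // n _; rewrite big_ord_recl expr0 ltr_pwDl//.
by apply: sumr_ge0 => i _; rewrite exprn_ge0// ltW.
Qed.

Lemma lambert_gap_ge0 x n : 0 < x < 1 -> (0 < n)%N -> 0 <= lambert_gap x n.
Proof.
move=> x01 n0; have /andP[x0 x1] := x01; rewrite lambert_gapE//.
rewrite mulr_ge0 ?invr_ge0 ?subr_ge0 ?(ltW x1)//.
rewrite ler_pdivrMr ?geo_gt0// mulrC ler_pdivlMr ?ltr0n// mulr_natr.
have -> : x ^+ n *+ n = \sum_(i < n) x ^+ n by rewrite sumr_const card_ord.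
by apply: ler_sum => i _; rewrite ler_wiXn2l ?(ltW x0) ?(ltW x1)// ltnW.
Qed.

(** With A and B the geometric sums of lengths n and n + 1, the difference has the sign of A B - n
    (n + 1) x^n. By [geo_AMGM], A B >= n (n + 1) y^(2n - 1), and y^(2n - 1) >= x^n. *)
Lemma lambert_gap_decr y n : 0 < y < 1 -> (0 < n)%N ->
  lambert_gap (y ^+ 2) n.+1 <= lambert_gap (y ^+ 2) n.
Proof.
move=> /andP[y0 y1] n0; set x := y ^+ 2.
have x0 : 0 < x by rewrite exprn_gt0.
have x1 : x < 1 by rewrite /x expr2; nra.
have x01 : 0 < x < 1 by rewrite x0.
rewrite !lambert_gapE// ler_wpM2l ?invr_ge0 ?subr_ge0 ?(ltW x1)//.
have G1 := geo_gt0 x0 n0; have G2 := geo_gt0 x0 (ltn0Sn n).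
have A1 := geo_AMGM n (ltW y0); have A2 := geo_AMGM n.+1 (ltW y0).
rewrite -/x in A1 A2.
have E : \sum_(i < n.+1) x ^+ i = 1 + x * \sum_(i < n) x ^+ i.
  by rewrite big_ord_recl mulr_sumr expr0; congr (_ + _); apply: eq_bigr => i _; rewrite exprS.
move: A1 A2 E G1 G2; set A := \sum_(i < n) x ^+ i; set B := \sum_(i < n.+1) x ^+ i.
move=> A1 A2 E G1 G2.
have n0' : (0 : R) < n%:R by rewrite ltr0n.
have n1' : (0 : R) < n.+1%:R by rewrite ltr0n.
have P : n%:R * n.+1%:R * x ^+ n <= A * B.
  apply: (@le_trans _ _ ((n%:R * y ^+ n.-1) * (n.+1%:R * y ^+ n))).
    rewrite mulrACA ler_wpM2l ?mulr_ge0// -exprD /x -exprM ler_wiXn2l ?(ltW y0) ?(ltW y1)//; lia.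
  by rewrite ler_pM// ?mulr_ge0 ?exprn_ge0// ltW.
rewrite -subr_ge0.
have -> : n%:R^-1 - x ^+ n / A - (n.+1%:R^-1 - x ^+ n.+1 / B) =
  (A * B - n%:R * n.+1%:R * x ^+ n) / (n%:R * n.+1%:R * A * B).
  have n1E : n.+1%:R = n%:R + 1 :> R by rewrite -natr1.
  rewrite exprS E n1E; rewrite n1E in n1'; rewrite E in G2.
  by field; rewrite !gt_eqF.
by rewrite divr_ge0 ?subr_ge0// !mulr_ge0 ?ltW.
Qed.

Variables (N : nat) (chi : nat -> R[i]).
Hypotheses (N1 : (1 < N)%N) (chiP : dirichlet_character N chi).
Hypothesis chi1 : exists2 a, coprime a N & chi a != 1.
Hypothesis chi2 : forall a, coprime a N -> chi a ^+ 2 = 1.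

Let f n := complex.Re (chi n).

Lemma real_charE n : chi n = (f n)%:C /\ [\/ f n = 0, f n = 1 | f n = -1].
Proof.
rewrite /f; case: (boolP (coprime n N)) => [/chi2/eqP|/(char_notcoprime chiP)->].
  rewrite sqrf_eq1 => /orP[/eqP->|/eqP->]; first by split=> //; exact: Or32.
  by split; [apply: complexP => //=; rewrite oppr0|exact: Or33].
by split => //; exact: Or31.
Qed.

Lemma real_char_mul : f 1%N = 1 /\ forall m n, f (m * n)%N = f m * f n.
Proof.
split=> [|m n]; first by rewrite /f (dirichlet1 chiP).
by rewrite /f (dirichletM chiP) (real_charE m).1 (real_charE n).1 -rmorphM.
Qed.

Lemma dconv_divisors (w : nat -> nat -> R[i]) n : (0 < n)%N ->
  dconv w n = \sum_(d <- divisors n) w d (n %/ d)%N.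
Proof.
move=> n0; have -> : \sum_(d <- divisors n) w d (n %/ d)%N =
   \sum_(d < n.+1 | (d %| n)%N) w d (n %/ d)%N.
  rewrite -(big_mkord (fun d => (d %| n)%N) (fun d => w d (n %/ d)%N)).
  rewrite -big_filter [RHS](perm_big (divisors n))//.
  apply: uniq_perm; rewrite ?filter_uniq ?iota_uniq ?divisors_uniq// => d.
  rewrite mem_filter mem_index_iota -dvdn_divisors// andbC /=.
  by apply/andP/idP => [[]//|h]; split=> //; rewrite ltnS dvdn_leq.
rewrite /dconv [RHS]big_mkcond; apply: eq_bigr => d _; case: ifP => [dn|nd].
  have d0 : (0 < d)%N := dvdn_gt0 n0 dn.
  have jn : (n %/ d < n.+1)%N by rewrite ltnS leq_div.
  rewrite (bigD1 (Ordinal jn)) /=; last by rewrite mulnC divnK.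
  rewrite big1 ?addr0// => i /andP[/eqP E /negP ij]; case: ij; apply/eqP/val_inj => /=.
  by apply/eqP; rewrite -(eqn_pmul2l d0) E mulnC divnK.
apply: big1 => j /eqP E; exfalso; move/negP: nd; apply.
by apply/dvdnP; exists j; rewrite mulnC.
Qed.

(** With x = y^2, the rows sum to the Lambert series of chi(d) x^d / (1 - x^d), and collecting by n
    = d j gives the power series of the divisor sums. *)
Definition lambert y d j : R[i] := if ((0 < d) && (0 < j))%N then chi d * (y ^+ 2)%:C ^+ (d * j) else 0.

(** For d, j >= 1, 2 d j >= d + j, so the terms are dominated by y^d y^j. *)
Lemma lambert_bounded y : 0 < y < 1 ->
  dbl_bounded (lambert y) ((1 - y)^-1 * (1 - y)^-1).
Proof.
move=> /andP[y0 y1] D E.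
have gB : abs_bounded (fun n => y%:C ^+ n) (1 - y)^-1.
  move=> M; under eq_bigr => i _ do rewrite nrmX nrm_nneg ?(ltW y0)//.
  by apply: geo_sum_le; rewrite ltW.
apply: le_trans (dbl_bounded_mul gB gB D E); apply: ler_sum => d _; apply: ler_sum => j _.
rewrite /lambert; case: ifP => [/andP[d0 j0]|_]; last by rewrite nrm0 nrm_ge0.
rewrite -exprD !nrmM !nrmX !nrm_nneg ?exprn_ge0 ?(ltW y0)//.
apply: (@le_trans _ _ ((y ^+ 2) ^+ (d * j))).
  by rewrite ler_piMl ?exprn_ge0 ?(ltW y0)// (nrm_char_le N1 chiP).
by rewrite -exprM ler_wiXn2l ?(ltW y0) ?(ltW y1)//; nia.
Qed.

Lemma lambert_row y d : 0 < y < 1 ->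
  has_sum (lambert y d) (chi d * ((y ^+ 2) ^+ d / (1 - (y ^+ 2) ^+ d))%:C).
Proof.
move=> /andP[y0 y1]; case: (posnP d) => [->|d0].
  rewrite (char0 N1 chiP) mul0r; by apply: (@has_sum_eq _ (fun=> 0) (lambert y 0) 0 (fun=> erefl)); exact: has_sum0.
set q := (y ^+ 2) ^+ d.
have q0 : 0 < q by rewrite !exprn_gt0.
have q1 : q < 1 by rewrite /q -exprM exprn_ilt1 ?(ltW y0)// muln_eq0 /= -lt0n d0.
have -> : chi d * (q / (1 - q))%:C = chi d * (q%:C * ((1 - q)^-1)%:C) by rewrite rmorphM.
have geo : has_sum (fun n => q%:C ^+ n) ((1 - q)^-1)%:C.
  move=> e e0; have [n H] := @pow_small R q (e * (1 - q)) ltac:(by rewrite ltW)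
     ltac:(by rewrite mulr_gt0// subr_gt0).
  exists n => M /H h; under eq_bigr => i _ do rewrite -rmorphXn.
  rewrite -rmorph_sum -rmorphB nrm_real.
  have -> : \sum_(i < M) q ^+ i - (1 - q)^-1 = - (q ^+ M / (1 - q)).
    apply: (mulIf (x := 1 - q)); first by rewrite subr_eq0 gt_eqF.
    rewrite mulrBl mulVf ?subr_eq0 ?gt_eqF// mulNr divfK ?subr_eq0 ?gt_eqF//.
    by rewrite -(opprB q 1) mulrN mulrC -subrX1; ring.
  rewrite normrN ger0_norm; last first.
    by apply: divr_ge0; [apply: exprn_ge0; exact: ltW|rewrite subr_ge0 ltW].
  by rewrite ler_pdivrMr ?subr_gt0.
have := has_sumZ (chi d) (has_sumZ q%:C geo) => H e /H[N0 HN].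
exists N0.+1 => -[|M] // NM; rewrite big_ord_recl /lambert ltnn andbF add0r.
have := HN M NM; congr (nrm (_ - _) <= _); apply: eq_bigr => i _.
by rewrite d0 lift0 /= exprM -exprS /q rmorphXn.
Qed.

Lemma lambert_conv y n : (0 < n)%N ->
  dconv (lambert y) n = ((y ^+ 2) ^+ n * divsum f n)%:C.
Proof.
move=> n0; rewrite dconv_divisors// rmorphM /divsum rmorph_sum mulr_sumr.
rewrite big_seq [RHS]big_seq; apply: eq_bigr => d; rewrite -dvdn_divisors// => dn.
have d0 : (0 < d)%N by exact: dvdn_gt0 dn.
rewrite /lambert d0 divn_gt0// dvdn_leq//= mulnC divnK//.
by rewrite {1}(real_charE d).1 -rmorphXn mulrC.
Qed.

(** If L(1) = 0, the Lambert series F is minus the sum of chi(d) [lambert_gap x d], bounded by N for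
    every x. But F is also the sum of x^n [divsum f n], and the squares alone make this large as x
    tends to 1. *)
Lemma L1_real_neq0 : Lfun chi 1 != 0.
Proof.
apply/eqP => L1.
have pB n := char_psum_le N1 chiP n chi1.
have chi0 := char0 N1 chiP.
have B0 : (0 : R) <= N%:R by [].
(* With these choices x^(M^2) = y^(2 M^2) >= 1/2 by Bernoulli, so the squares up to M^2 contribute
   at least M / 2 = N + 1/2 > N. *)
pose M := (N.*2).+1; pose y : R := 1 - (4 * (M ^ 2)%:R)^-1.
have M2 : (1 : R) <= (M ^ 2)%:R by rewrite ler1n expn_gt0.
have M4 : 0 < (4 * (M ^ 2)%:R : R) by lra.
have yh : (4 * (M ^ 2)%:R : R)^-1 <= 4^-1 by rewrite lef_pV2 ?posrE//; lra.
have yp : (0 : R) < (4 * (M ^ 2)%:R)^-1 by rewrite invr_gt0.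
have y01 : 0 < y < 1 by rewrite /y; apply/andP; split; lra.
have /andP[y0 y1] := y01; set x := y ^+ 2.
have x01 : 0 < x < 1 by rewrite exprn_gt0//= /x expr2; nra.
have [F wF] := dbl_bounded_sum (lambert_bounded y01).
have rowsF := dbl_sum_rows wF (fun d => lambert_row d y01).
have convF : has_sum (dconv (lambert y)) F.
  apply: (dbl_sum_dconv (lambert_bounded y01) wF) => [j|d]; rewrite /lambert//.
  by rewrite ltnn andbF.
have s1 : 0 < complex.Re (1 : R[i]) by rewrite /=.
have Lser := Lfun_dirichlet_series chi0 pB s1; rewrite L1 in Lser.
have gapF : has_sum (fun d => chi d * (lambert_gap x d)%:C) (- F).
  have := has_sumB (has_sumZ ((1 - x)^-1)%:C Lser) rowsF.
  rewrite mulr0 sub0r; apply: has_sum_eq => d.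
  have -> : cpw d 1 = (d%:R^-1 : R)%:C by rewrite -pwV -cpw_real rmorph1.
  by rewrite /lambert_gap rmorphB !rmorphM -/x; ring.
have FN : nrm F <= N%:R.
  rewrite -nrmN; apply: (clim_nrm_le (clim_sub gapF leqnSn)) => K.
  rewrite (abel_sum chi0 (fun d => (lambert_gap x d)%:C)).
  have bd n : (0 < n)%N -> 0 <= lambert_gap x n by move=> n0; exact: lambert_gap_ge0.
  have dec n : (0 < n)%N -> lambert_gap x n.+1 <= lambert_gap x n.
    by move=> n0; exact: lambert_gap_decr.
  apply: le_trans (nrmD _ _) _.
  (* The gaps decrease from [lambert_gap x 1 = 1], so after Abel summation the differences
     telescope. *)
  have T : \sum_(n < K.+1) nrm (psum chi n * ((lambert_gap x n)%:C - (lambert_gap x n.+1)%:C))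
      <= N%:R * (1 - lambert_gap x K.+1).
    elim: K => [|K IH].
      by rewrite big_ord1 psum0// mul0r nrm0 lambert_gap1// subrr mulr0.
    rewrite big_ord_recr /=.
    have H : nrm (psum chi K.+1 * ((lambert_gap x K.+1)%:C - (lambert_gap x K.+2)%:C))
        <= N%:R * (lambert_gap x K.+1 - lambert_gap x K.+2).
      rewrite nrmM -rmorphB nrm_nneg ?subr_ge0 ?dec//.
      by rewrite ler_wpM2r ?subr_ge0 ?dec// pB.
    by apply: le_trans (lerD IH H) _; rewrite -mulrDr; lra.
  apply: le_trans (lerD (nrm_sum _ _ _) (lexx _)) _.
  have T2 : nrm (psum chi K * (lambert_gap x K.+1)%:C) <= N%:R * lambert_gap x K.+1.
    by rewrite nrmM nrm_nneg ?bd// ler_wpM2r ?bd// pB.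
  by apply: le_trans (lerD T T2) _; rewrite -mulrDr subrK mulr1.
have [fm1 fM] := real_char_mul.
have f3 n := (real_charE n).2.
have FM : M%:R / 2 <= complex.Re F.
  apply: (has_sum_ge convF); exists (M ^ 2).+1 => K MK.
  rewrite Re_sum.
  have E n : (0 < n)%N -> complex.Re (dconv (lambert y) n) = x ^+ n * divsum f n.
    by move=> n0; rewrite lambert_conv.
  have d0 : dconv (lambert y) 0 = 0.
    by rewrite /dconv big_ord1 big_mkcond big_ord1 /lambert.
  have pos (n : 'I_K) : 0 <= complex.Re (dconv (lambert y) n).
    case: (posnP n) => [->|n0]; first by rewrite d0.
    by rewrite E// mulr_ge0 ?exprn_ge0 ?divsum_ge0// ltW//; case/andP: x01.
  have sq (i : 'I_M) : (i.+1 * i.+1 < K)%N.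
    by rewrite (leq_trans _ MK)// ltnS -mulnn leq_mul.
  pose h (i : 'I_M) : 'I_K := Ordinal (sq i).
  have hinj : injective h.
    move=> i j /(congr1 val) /= /eqP; rewrite mulnn mulnn eqn_exp2r// => /eqP[ij].
    exact: val_inj.
  rewrite (bigID (mem [set h i | i : 'I_M])) /= -[leLHS]addr0 lerD//; last first.
    by apply: sumr_ge0 => n _; exact: pos.
  rewrite big_imset /=; last by move=> i j _ _; exact: hinj.
  have -> : M%:R / 2 = \sum_(i in 'I_M) (2^-1 : R).
    by rewrite sumr_const card_ord mulr_natl.
  apply: ler_sum => i _; rewrite E ?muln_gt0//.
  have xM : 2^-1 <= x ^+ (i.+1 * i.+1).
    apply: (@le_trans _ _ (y ^+ (2 * M ^ 2))).
      have h4 : (4^-1 : R) <= 1 by lra.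
      have := @bernoulli (4 * (M ^ 2)%:R)^-1 (2 * M ^ 2) (ltW yp) (le_trans yh h4).
      apply: le_trans; rewrite natrM; move: M2; move: ((M ^ 2)%:R) => q q1.
      have q0 : q != 0 by rewrite gt_eqF//; lra.
      by rewrite [leRHS](_ : _ = 2^-1)//; field.
    rewrite /x -exprM ler_wiXn2l ?(ltW y0) ?(ltW y1)// leq_mul2l /= -mulnn.
    by rewrite leq_mul.
  rewrite -[leLHS]mulr1 ler_pM// ?invr_ge0//.
  by apply: divsum_sqr_ge1.
have := Re_le_nrm F; rewrite ler_norml => /andP[_ h].
have := le_trans FM (le_trans h FN); rewrite ler_pdivrMr// /M.
rewrite -natr1 -muln2 natrM; lra.
Qed.

End Monsky.

(** * The Borel-Caratheodory inequality *)

Section PrimitiveRoots.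
Local Open Scope ring_scope.
Local Open Scope complex_scope.
Variable R : realType.
Implicit Types (u v z w eta : R[i]).

Lemma prim_root_ex n : (0 < n)%N -> exists z : R[i], n.-primitive_root z.
Proof.
pose p : {poly R[i]} := 'X^n - 1; have [r Dp] := closed_field_poly_normal p.
move=> n_gt0; rewrite (monicP _) ?monicXnsubC // scale1r in Dp.
have rn1 : all n.-unity_root r by apply/allP => z; rewrite -root_prod_XsubC -Dp.
have sz_r : (n < (size r).+1)%N by rewrite -(size_prod_XsubC r id) -Dp size_XnsubC.
have [|z _ hz] := hasP (has_prim_root n_gt0 rn1 _ sz_r); last by exists z.
by rewrite -separable_prod_XsubC -Dp separable_Xn_sub_1 // pnatr_eq0 -lt0n.
Qed.

Variables (n : nat) (om : R[i]).
Hypothesis om_prim : n.-primitive_root om.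

Let n0 : (0 < n)%N. Proof. exact: prim_order_gt0 om_prim. Qed.

Lemma nrm_prim_root : nrm om = 1.
Proof.
have := congr1 (@nrm R) (prim_expr_order om_prim); rewrite nrmX nrm1 => /eqP.
by rewrite pexpr_eq1 ?nrm_ge0// => /eqP.
Qed.

Lemma conj_prim_root : om^* = om ^+ n.-1.
Proof.
have h : om != 0 by rewrite -nrm_gt0 nrm_prim_root.
apply: (mulfI h); rewrite -exprS prednK// (prim_expr_order om_prim).
by rewrite -sqr_normc normE nrm_prim_root rmorph1 expr1n.
Qed.

Lemma conj_prim_rootX k : (k <= n)%N -> (om ^+ k)^* = om ^+ (n - k).
Proof.
move=> kn; rewrite rmorphXn /= conj_prim_root -exprM.
apply/eqP; rewrite (eq_prim_root_expr om_prim); apply/eqP.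
case: k kn => [|k] kn; first by rewrite muln0 subn0 modnn mod0n.
apply/eqP; rewrite -(eqn_modDr k.+1) subnK// modnn -mulSnr prednK//.
by rewrite modnMr.
Qed.

Lemma sum_prim_root j : \sum_(l < n) (om ^+ j) ^+ l = if (n %| j)%N then n%:R else 0.
Proof.
rewrite (prim_order_dvd om_prim); case: eqP => [->|/eqP h].
  by under eq_bigr => l _ do rewrite expr1n; rewrite sumr_const card_ord.
apply/eqP; move: h; rewrite -subr_eq0 => h.
rewrite -(inj_eq (mulfI h)) mulr0 -subrX1 -exprM mulnC exprM.
by rewrite (prim_expr_order om_prim) expr1n subrr.
Qed.

Lemma Re_mul_Re u v : complex.Re u * complex.Re v =
  (complex.Re (u * v) + complex.Re (conjc u * v)) / 2.
Proof. by case: u v => a b [c d] /=; field. Qed.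

Variables (k : nat) (eta : R[i]).
Hypotheses (k0 : (0 < k)%N) (kn : (k < n)%N) (eta1 : nrm eta = 1).

(** A nonnegative kernel of mean 1; the exponent [n - k] stands for [- k]. *)
Definition bc_weight (l : nat) : R := 1 + complex.Re (eta * (om ^+ (n - k)) ^+ l).

Lemma bc_weight_bound l : 0 <= bc_weight l <= 2.
Proof.
have := Re_le_nrm (eta * (om ^+ (n - k)) ^+ l).
rewrite nrmM eta1 !nrmX nrm_prim_root !expr1n mulr1 ler_norml /bc_weight.
by move=> /andP[h1 h2]; apply/andP; split; lra.
Qed.

Lemma bc_weight_sum : \sum_(l < n) bc_weight l = n%:R.
Proof.
rewrite big_split /= sumr_const card_ord -Re_sum -mulr_sumr sum_prim_root.
rewrite ifF ?mulr0 ?addr0//; apply/negP => /dvdn_leq; rewrite subn_gt0 kn => /(_ isT).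
by rewrite leqNgt ltn_subrL k0 n0.
Qed.

(** Besides the wanted frequency j = k, sampling at n points also lets through its alias j = n -
    k. *)
Lemma bc_moment v j : (0 < j < n)%N ->
  \sum_(l < n) bc_weight l * complex.Re ((v * om ^+ l) ^+ j) =
  n%:R / 2 * ((if j == k then complex.Re (eta * v ^+ j) else 0) +
              (if j == (n - k)%N then complex.Re (conjc eta * v ^+ j) else 0)).
Proof.
move=> /andP[j0 jn].
have E (l : 'I_n) : bc_weight l * complex.Re ((v * om ^+ l) ^+ j) =
  complex.Re (v ^+ j * (om ^+ j) ^+ l) +
  (complex.Re (eta * v ^+ j * (om ^+ (n - k + j)) ^+ l) +
   complex.Re (conjc eta * v ^+ j * (om ^+ (k + j)) ^+ l)) / 2.
  have -> : (v * om ^+ l) ^+ j = v ^+ j * (om ^+ j) ^+ l.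
    by rewrite exprMn -!exprM mulnC.
  rewrite /bc_weight mulrDl mul1r Re_mul_Re; congr (_ + (_ + _) / _).
    by congr complex.Re; rewrite exprD exprMn; ring.
  have h := conj_prim_rootX (leq_subr k n); rewrite subKn ?(ltnW kn)// in h.
  have -> : (eta * (om ^+ (n - k)) ^+ l)^* = conjc eta * (om ^+ k) ^+ l.
    by rewrite -h rmorphM rmorphXn.
  by congr complex.Re; rewrite exprD exprMn; ring.
under eq_bigr => l _ do rewrite E.
rewrite big_split /= -mulr_suml big_split /= -!Re_sum -!mulr_sumr !sum_prim_root.
rewrite ifF ?mulr0 ?add0r; last first.
  by apply/negP => /dvdn_leq; rewrite j0 leqNgt jn => /(_ isT).
have -> : (n %| n - k + j)%N = (j == k).
  apply/idP/eqP => [/dvdnP[q E1]|->]; last by rewrite subnK// ltnW.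
  have : (q * n < 2 * n)%N by rewrite -E1; lia.
  rewrite ltn_pmul2r// => q2; have q0 : (0 < q)%N.
    by case: (q) E1 => // E1; lia.
  have q1 : q = 1%N by lia.
  by rewrite q1 in E1; lia.
have -> : (n %| k + j)%N = (j == n - k)%N.
  apply/idP/eqP => [/dvdnP[q E1]|->]; last by rewrite subnKC// ltnW.
  have : (q * n < 2 * n)%N by rewrite -E1; lia.
  rewrite ltn_pmul2r// => q2; have q0 : (0 < q)%N.
    by case: (q) E1 => // E1; lia.
  have q1 : q = 1%N by lia.
  by rewrite q1 in E1; lia.
have nC : n%:R = (n%:R : R)%:C by rewrite rmorph_nat.
rewrite nC; move: (n%:R : R) => m.
by do 2 case: ifP => _; rewrite ?mulr0 ?(mulrC _ m%:C) ?ReMr /=; field.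
Qed.

Lemma pick_sum (x : nat -> R) j : (0 < j < n)%N ->
  \sum_(i < n.-1) (if i.+1 == j then x i.+1 else 0) = x j.
Proof.
case: j => // j /andP[_ jn]; have jn' : (j < n.-1)%N by rewrite -ltnS prednK.
rewrite (bigD1 (Ordinal jn')) //= eqxx big1 ?addr0// => i /negP ij.
by case: eqP => // -[E]; case: ij; apply/eqP/val_inj.
Qed.

(** The first error term comes from the alias, the second from cutting the logarithmic series after
    [n - 1] terms; both vanish as [n] grows. *)
Lemma bc_average v : nrm v < 1 ->
  `|(\sum_(l < n) bc_weight l * ln (nrm (1 - v * om ^+ l))) / n%:R
    + complex.Re (eta * v ^+ k) / (2 * k%:R)|
  <= nrm v ^+ (n - k) + 2 * (nrm v ^+ n / (1 - nrm v)).
Proof.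
move=> v1; have n0' : (0 : R) < n%:R by rewrite ltr0n.
have k0' : (0 : R) < k%:R by rewrite ltr0n.
have nk0 : (0 < n - k)%N by rewrite subn_gt0.
have nk0' : (0 : R) < (n - k)%:R by rewrite ltr0n.
have nv (l : nat) : nrm (v * om ^+ l) = nrm v by rewrite nrmM nrmX nrm_prim_root expr1n mulr1.
have S : \sum_(l < n) bc_weight l * logsum n.-1 (v * om ^+ l) =
   n%:R / 2 * (complex.Re (eta * v ^+ k) / k%:R + complex.Re (conjc eta * v ^+ (n - k)) / (n - k)%:R).
  rewrite /logsum; under eq_bigr => l _ do rewrite mulr_sumr.
  rewrite exchange_big /=.
  have E (j : 'I_n.-1) : \sum_(l < n) bc_weight l * (complex.Re ((v * om ^+ l) ^+ j.+1) / j.+1%:R) =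
    n%:R / 2 * ((if j.+1 == k then complex.Re (eta * v ^+ j.+1) / j.+1%:R else 0) +
      (if j.+1 == (n - k)%N then complex.Re (conjc eta * v ^+ j.+1) / j.+1%:R else 0)).
    under eq_bigr => l _ do rewrite mulrA.
    rewrite -mulr_suml bc_moment; last by have := ltn_ord j; move: n0; lia.
    by do 2 case: ifP => _; ring.
  under eq_bigr => j _ do rewrite E.
  rewrite -mulr_sumr big_split /=; congr (_ * (_ + _)).
    by rewrite (pick_sum (fun j => complex.Re (eta * v ^+ j) / j%:R))// k0.
  rewrite (pick_sum (fun j => complex.Re (conjc eta * v ^+ j) / j%:R))// nk0.
  by rewrite ltn_subrL k0 n0.
set T := \sum_(l < n) _.
have D : `|T + \sum_(l < n) bc_weight l * logsum n.-1 (v * om ^+ l)| <=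
   n%:R * (2 * (nrm v ^+ n / (1 - nrm v))).
  rewrite -big_split /= (le_trans (ler_norm_sum _ _ _))//.
  have -> : n%:R * (2 * (nrm v ^+ n / (1 - nrm v))) =
     \sum_(l < n) (2 * (nrm v ^+ n / (1 - nrm v))).
    by rewrite sumr_const card_ord mulr_natl.
  apply: ler_sum => l _; rewrite -mulrDr normrM.
  have /andP[w0 w2] := bc_weight_bound l.
  rewrite (ger0_norm w0) ler_pM//.
  have := @ln_nrm_1B R n.-1 (v * om ^+ l); rewrite nv prednK//; exact.
rewrite S in D; set X := complex.Re _ / (2 * _).
set Y := complex.Re (conjc eta * _) / _ in D.
have YB : `|Y| <= nrm v ^+ (n - k).
  rewrite /Y normrM normfV (ger0_norm (ltW nk0')) ler_pdivrMr//.
  apply: le_trans (Re_le_nrm _) _; rewrite nrmM nrm_conj eta1 mul1r nrmX.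
  by rewrite ler_peMr ?exprn_ge0 ?nrm_ge0// ler1n.
have -> : T / n%:R + X = (T + n%:R / 2 * (complex.Re (eta * v ^+ k) / k%:R + Y)) / n%:R - Y / 2.
  by rewrite /X; field; rewrite !gt_eqF.
apply: le_trans (ler_normB _ _) _; rewrite addrC lerD//.
  have -> : `|Y / 2| = `|Y| / 2 by rewrite normrM (@ger0_norm _ 2^-1)// invr_ge0.
  by apply: le_trans YB; rewrite ler_piMr//; lra.
by rewrite normrM normfV (ger0_norm (ltW n0')) ler_pdivrMr// [leRHS]mulrC.
Qed.

End PrimitiveRoots.

Section BorelCaratheodory.
Local Open Scope ring_scope.
Local Open Scope complex_scope.
Variable R : realType.
Implicit Types (us : seq R[i]).

Lemma bc_error v k e : nrm v < 1 -> 0 < e -> exists n0, forall n, (n0 <= n)%N ->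
  nrm v ^+ (n - k) + 2 * (nrm v ^+ n / (1 - nrm v)) <= e :> R.
Proof.
move=> v1 e0; have v01 : 0 <= nrm v < 1 by rewrite nrm_ge0.
have [n1 H1] := pow_small v01 (e := e / 2) ltac:(by rewrite divr_gt0).
have [n2 H2] := pow_small v01 (e := e / 4 * (1 - nrm v))
  ltac:(by rewrite mulr_gt0 ?subr_gt0// divr_gt0).
exists (maxn (n1 + k) n2) => n; rewrite geq_max => /andP[h1 h2].
have := H1 (n - k)%N ltac:(by rewrite leq_subRL ?(leq_trans (leq_addl n1 k))// addnC).
have := H2 n h2; rewrite -ler_pdivrMr ?subr_gt0//; lra.
Qed.

Lemma bc_error_seq us k e : (forall u, u \in us -> nrm u < 1) -> 0 < e ->
  exists n0, forall n u, (n0 <= n)%N -> u \in us ->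
  nrm u ^+ (n - k) + 2 * (nrm u ^+ n / (1 - nrm u)) <= e :> R.
Proof.
move=> us1 e0; elim: us us1 => [|v us IH] us1; first by exists 0%N.
have [n1 H1] := IH (fun u uus => us1 u (mem_behead (s := v :: us) uus)).
have [n2 H2] := bc_error k (us1 v (mem_head _ _)) e0.
exists (maxn n1 n2) => n u; rewrite geq_max => /andP[h1 h2].
by rewrite inE => /orP[/eqP->|/H1]; [exact: H2|apply].
Qed.

Lemma ln_prod (T : eqType) (us : seq T) (F : T -> R) :
  (forall u, u \in us -> 0 < F u) -> \sum_(u <- us) ln (F u) = ln (\prod_(u <- us) F u).
Proof.
elim: us => [|v us IH] H; first by rewrite !big_nil ln1.
have H' u : u \in us -> 0 < F u by move=> uus; rewrite H// inE uus orbT.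
rewrite !big_cons IH// lnM// posrE ?H ?mem_head//.
by rewrite big_seq; apply: prodr_gt0 => u; exact: H'.
Qed.

(* Averaging [log |P|] over the n-th roots of unity with the weights [1 + Re (eta zeta^(-k))]
   picks out the k-th Taylor coefficient of [log P] as n tends to infinity. *)
Lemma borel_caratheodory us (a0 : R[i]) (rho M : R) k : (0 < k)%N -> 0 < rho ->
  a0 != 0 -> (forall u, u \in us -> nrm (rho%:C * u) < 1) ->
  (forall z, nrm z = rho -> nrm (a0 * \prod_(u <- us) (1 - u * z)) <= M) ->
  nrm (\sum_(u <- us) u ^+ k) * rho ^+ k <= 2 * k%:R * ln (M / nrm a0).
Proof.
move=> k0 rho0 a00 us1 PM; set S := \sum_(u <- us) u ^+ k.
have a0p : 0 < nrm a0 by rewrite nrm_gt0.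
have k0' : (0 : R) < k%:R by rewrite ltr0n.
have us1' u : u \in [seq rho%:C * u | u <- us] -> nrm u < 1.
  by move=> /mapP[w wus ->]; exact: us1.
(* The phase [eta] is then taken as minus the conjugate of S / |S|, which turns the left side into
   the modulus of [S]. *)
suff H eta : nrm eta = 1 -> - complex.Re (eta * S) * rho ^+ k <= 2 * k%:R * ln (M / nrm a0).
  have [S0|S0] := eqVneq S 0.
    by have := H 1 (nrm1 R); rewrite S0 mulr0 nrm0 oppr0.
  have Sp : 0 < nrm S by rewrite nrm_gt0.
  have := H (- (S^* / (nrm S)%:C)).
  rewrite nrmN nrmM nrm_conj nrmV nrm_nneg ?nrm_ge0// divff ?gt_eqF// => /(_ erefl).
  have -> : - (S^* / (nrm S)%:C) * S = - (nrm S)%:C.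
    have nS0 : (nrm S)%:C != 0 by rewrite -normE normr_eq0.
    rewrite mulNr mulrAC (mulrC _ S) -sqr_normc normE expr2 mulfK//.
  by rewrite ReN opprK.
move=> eta1; apply: le_addeps => e e0.
pose N := (size us).+1; have N0 : (0 : R) < N%:R by rewrite ltr0n.
have d0 : 0 < e / (2 * k%:R * N%:R) by rewrite divr_gt0 ?mulr_gt0.
have [n0 Hn] := bc_error_seq k us1' d0.
pose n := (maxn n0 k.+1); have kn : (k < n)%N by rewrite leq_maxr.
have [om omP] := prim_root_ex R (leq_ltn_trans (leq0n k) kn).
have n0' : (0 : R) < n%:R by rewrite ltr0n (leq_ltn_trans (leq0n k) kn).
pose W := bc_weight n om k eta.
have W0 l : 0 <= W l by have /andP[] := bc_weight_bound omP k eta1 l.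
have u_neq u l : u \in us -> 0 < nrm (1 - rho%:C * u * om ^+ l).
  move=> uus; have := nrm_lb 1 (- (rho%:C * u * om ^+ l)).
  rewrite nrm1 nrmN [nrm (_ * om ^+ l)]nrmM nrmX (nrm_prim_root omP) expr1n mulr1.
  have := us1 u uus; lra.
have LE l : \sum_(u <- us) ln (nrm (1 - rho%:C * u * om ^+ l)) <= ln (M / nrm a0).
  rewrite ln_prod; last by move=> u; exact: u_neq.
  have Pp : 0 < \prod_(u <- us) nrm (1 - rho%:C * u * om ^+ l).
    by rewrite big_seq; apply: prodr_gt0 => u; exact: u_neq.
  have := PM (rho%:C * om ^+ l); rewrite nrmM nrmX (nrm_prim_root omP) expr1n mulr1.
  rewrite nrm_nneg ?(ltW rho0)// nrmM nrm_prod => /(_ erefl).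
  have -> : \prod_(u <- us) nrm (1 - u * (rho%:C * om ^+ l)) =
     \prod_(u <- us) nrm (1 - rho%:C * u * om ^+ l).
    by apply: eq_bigr => u _; congr (nrm (_ - _)); ring.
  move=> h; have Mp : 0 < M by apply: lt_le_trans h; rewrite mulr_gt0.
  by rewrite ler_ln ?posrE ?divr_gt0// ler_pdivlMr// mulrC.
have main : \sum_(u <- us) (\sum_(l < n) W l * ln (nrm (1 - rho%:C * u * om ^+ l))) / n%:R
    <= ln (M / nrm a0).
  rewrite -mulr_suml ler_pdivrMr// exchange_big /= mulrC.
  rewrite -(bc_weight_sum omP eta k0 kn) mulr_suml; apply: ler_sum => l _.
  by rewrite -mulr_sumr ler_wpM2l// LE.
have low : \sum_(u <- us) (- complex.Re (eta * (rho%:C * u) ^+ k) / (2 * k%:R) - e / (2 * k%:R * N%:R))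
   <= \sum_(u <- us) (\sum_(l < n) W l * ln (nrm (1 - rho%:C * u * om ^+ l))) / n%:R.
  rewrite !big_seq; apply: ler_sum => u uus.
  have := bc_average omP k0 kn eta1 (us1 u uus).
  have := Hn n (rho%:C * u) (leq_maxl _ _) (map_f _ uus).
  move=> h1 /le_trans -/(_ _ h1); rewrite ler_norml => /andP[+ _].
  by rewrite -/W mulNr; lra.
have := le_trans low main; rewrite big_split /= -mulr_suml.
have -> : \sum_(u <- us) - complex.Re (eta * (rho%:C * u) ^+ k) =
   - complex.Re (eta * S) * rho ^+ k.
  rewrite sumrN -Re_sum -mulr_sumr; have -> : \sum_(u <- us) (rho%:C * u) ^+ k = (rho ^+ k)%:C * S.
    by rewrite /S mulr_sumr; apply: eq_bigr => u _; rewrite exprMn rmorphXn.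
  by rewrite mulrCA ReMr; ring.
have -> : \sum_(i <- us) - (e / (2 * k%:R * N%:R)) = - (e / (2 * k%:R * N%:R)) * (size us)%:R.
  by rewrite big_const_seq count_predT iter_addr_0 [RHS]mulr_natr.
set X := - complex.Re _ * _.
rewrite -(ler_pM2l (x := 2 * k%:R)) ?mulr_gt0// mulrDr.
have -> : 2 * k%:R * (X / (2 * k%:R)) = X by field; rewrite gt_eqF.
have : e / (2 * k%:R * N%:R) * (size us)%:R * (2 * k%:R) <= e.
  rewrite [leLHS](_ : _ = e * ((size us)%:R / N%:R)); last by field; rewrite !gt_eqF.
  by rewrite ler_piMr ?(ltW e0)// ler_pdivrMr// mul1r ler_nat.
lra.
Qed.

End BorelCaratheodory.

(** * Character values under GRH *)

Section Mangoldt.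
Local Open Scope ring_scope.
Local Open Scope complex_scope.
Variable R : realType.
Implicit Types (n m k : nat) (x y : R).

Definition mangoldt n : R :=
  if (1 < n)%N && (n == pdiv n ^ logn (pdiv n) n)%N then lnn R (pdiv n) else 0.

Lemma mangoldt_ge0 n : 0 <= mangoldt n.
Proof. by rewrite /mangoldt; case: ifP => // _; exact: lnn_ge0. Qed.

Lemma mangoldt_le n : mangoldt n <= lnn R n.
Proof.
rewrite /mangoldt; case: ifP => [/andP[n1 _]|_]; last exact: lnn_ge0.
by apply: lnn_le; rewrite pdiv_gt0 pdiv_leq// ltnW.
Qed.

Lemma mangoldt_prime_power p i : prime p -> (0 < i)%N -> mangoldt (p ^ i) = lnn R p.
Proof.
move=> pp i0; have E : pdiv (p ^ i) = p by case: i i0 => // i _; rewrite pdiv_pfactor.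
by rewrite /mangoldt E pfactorK// eqxx andbT -[1%N](expn0 p) ltn_exp2l ?prime_gt1// i0.
Qed.

Lemma mangoldt_other p i m : prime p -> ~~ (p %| m)%N -> (0 < i)%N -> (1 < m)%N ->
  mangoldt (p ^ i * m) = 0.
Proof.
move=> pp pm i0 m1; rewrite /mangoldt; case: ifP => // /andP[n1 /eqP E]; exfalso.
have qp := pdiv_prime n1; set q := pdiv _ in E qp.
have pq : p = q.
  have : (p %| q ^ logn q (p ^ i * m))%N.
    by rewrite -E dvdn_mulr// -(prednK i0) expnS dvdn_mulr.
  by rewrite Euclid_dvdX// dvdn_prime2// => /andP[/eqP].
have : (m %| p ^ logn q (p ^ i * m))%N by rewrite {1}pq -E dvdn_mull.
move/(dvdn_pfactor _ _ pp) => [j _ mj].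
by move: pm m1; rewrite mj; case: j {mj} => // j; rewrite expnS dvdn_mulr.
Qed.

Lemma sum_mangoldt n : (0 < n)%N -> \sum_(d <- divisors n) mangoldt d = lnn R n.
Proof.
elim/ltn_ind: n => n IH n0; case: (ltnP 1 n) => [n1|]; last first.
  case: n n0 {IH} => [|[|]]// _ _.
  by rewrite big_seq1 /mangoldt /= lnn1.
have [p [k [m [pp pm /andP[m0 mn] E]]]] := prime_part_split n1.
rewrite E (perm_big _ (divisors_prime_power k pp pm m0)) big_allpairs_dep.
rewrite -[iota 0 k.+1]/(index_iota 0 k.+1) big_mkord big_ord_recl.
have -> : \sum_(d <- divisors m) mangoldt (p ^ @ord0 k * d) = lnn R m.
  by rewrite -(IH m mn m0); apply: eq_bigr => d _; rewrite expn0 mul1n.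
have -> : \sum_(i < k) \sum_(d <- divisors m) mangoldt (p ^ lift ord0 i * d) =
    \sum_(i < k) lnn R p.
  apply: eq_bigr => i _; rewrite lift0.
  rewrite (big_rem 1%N) /=; last by rewrite -dvdn_divisors.
  rewrite muln1 mangoldt_prime_power// big_seq big1 ?addr0// => d.
  rewrite mem_rem_uniq ?divisors_uniq// inE => /andP[d1].
  rewrite -dvdn_divisors// => dm; rewrite mangoldt_other//.
    by apply: contra pm => /dvdn_trans; exact.
  by rewrite ltn_neqAle eq_sym d1 (dvdn_gt0 m0 dm).
have pk0 : (0 < p ^ k)%N by rewrite expn_gt0 prime_gt0.
rewrite sumr_const card_ord lnnM// addrC; congr (_ + _).
by rewrite /lnn natrX lnXn// ltr0n prime_gt0.
Qed.

Lemma dconv_0 (w : nat -> nat -> R[i]) : w 0%N 0%N = 0 -> dconv w 0 = 0.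
Proof.
by move=> w0; rewrite /dconv big_ord1 big1// => j _; rewrite (ord1 j) /= w0.
Qed.

Lemma ecoef_0 (s : R[i]) k : ecoef s k 0 = 0.
Proof. by rewrite /ecoef cpw0 mul0r. Qed.

Lemma lnn_le_expR n (d : R) : 0 < d -> lnn R n <= d^-1 * expR (d * lnn R n).
Proof.
move=> d0; rewrite mulrC ler_pdivlMr// mulrC.
by have := expR_ge1Dx (d * lnn R n); lra.
Qed.

Lemma dpow_le_expR k y (d : R) : 0 <= y -> 0 < d -> dpow k y <= d^-1 ^+ k * expR (d * y).
Proof.
move=> y0 d0; have dy : 0 <= d * y by rewrite mulr_ge0// ltW.
have -> : dpow k y = d^-1 ^+ k * dpow k (d * y).
  by rewrite dpowM mulrA -exprMn mulVf ?gt_eqF// expr1n mul1r.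
rewrite ler_wpM2l ?exprn_ge0 ?invr_ge0 ?(ltW d0)//.
apply: le_trans (sum_dpow_le k.+1 dy); rewrite big_ord_recr /= lerDr.
by apply: sumr_ge0 => i _; exact: dpow_ge0.
Qed.

Section LogDerivative.
Variables (f : nat -> R[i]).
Hypotheses (fM : forall m n, f (m * n)%N = f m * f n) (f1 : forall n, nrm (f n) <= 1).

(* [L (2 - z)] and [- L'/L (2 - z)] are the power series in [z] with coefficients [acf k]
   and [lamf k]. *)
Definition acf k := csum (fun n => f n * ecoef 2 k n).
Definition lamf k := csum (fun n => (mangoldt n)%:C * f n * ecoef 2 k n).

(** The factor 4^k is far too large for estimates; it only serves to establish convergence at the
    fixed point 2. *)
Lemma nrm_ecoef2 k n : nrm (ecoef (2 : R[i]) k n) <= 4 ^+ k * pw n (2 - 4^-1).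
Proof.
have Re2 : complex.Re (2 : R[i]) = 2 by rewrite (_ : 2 = 1 + 1)// ReD.
rewrite nrm_ecoef Re2 pw_mul_expR [leRHS]mulrCA ler_wpM2l ?pw_ge0//.
by have := @dpow_le_expR k (lnn R n) 4^-1 (lnn_ge0 R n); rewrite invr_gt0 invrK; exact.
Qed.

Lemma acf_bounded k : abs_bounded (fun n => f n * ecoef 2 k n) (4 ^+ k * (1 + 2)).
Proof.
move=> N; apply: (@le_trans _ _ (\sum_(i < N) 4 ^+ k * pw i (1 + 2^-1))).
  apply: ler_sum => n _; rewrite nrmM -[leRHS]mul1r ler_pM ?nrm_ge0//.
  apply: le_trans (nrm_ecoef2 k n) _.
  by rewrite ler_wpM2l ?exprn_ge0// pw_le//; lra.
rewrite -mulr_sumr ler_wpM2l ?exprn_ge0//.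
by have := @sum_pw_le R 2^-1 N; rewrite invr_gt0 invrK; exact.
Qed.

Lemma lamf_bounded k :
  abs_bounded (fun n => (mangoldt n)%:C * f n * ecoef 2 k n) (4 ^+ k.+1 * (1 + 2)).
Proof.
move=> N; apply: (@le_trans _ _ (\sum_(i < N) 4 ^+ k.+1 * pw i (1 + 2^-1))).
  apply: ler_sum => n _; rewrite nrmM nrmM nrm_nneg ?mangoldt_ge0//.
  apply: (@le_trans _ _ (4 * expR (4^-1 * lnn R n) * (4 ^+ k * pw n (2 - 4^-1)))).
    rewrite ler_pM ?mulr_ge0 ?mangoldt_ge0 ?nrm_ge0 ?nrm_ecoef2//.
    apply: (@le_trans _ _ (mangoldt n)); first by rewrite ler_piMr ?mangoldt_ge0.
    apply: le_trans (mangoldt_le n) _.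
    by have := @lnn_le_expR n 4^-1; rewrite invr_gt0 invrK; exact.
  rewrite exprS -!mulrA ler_wpM2l// mulrCA ler_wpM2l ?exprn_ge0// mulrC.
  by rewrite -pw_mul_expR pw_le//; lra.
rewrite -mulr_sumr ler_wpM2l ?exprn_ge0//.
by have := @sum_pw_le R 2^-1 N; rewrite invr_gt0 invrK; exact.
Qed.

(** Coefficients of the identity A' = (- L'/L)(2 - z) A for A(z) = L(2 - z). For each n it combines
    the sum of Lambda over the divisors of n, which is ln n, with the binomial formula for ln d + ln
    (n / d). *)
Lemma newton_lamf k : k.+1%:R * acf k.+1 = \sum_(i < k.+1) lamf i * acf (k - i).
Proof.
pose W i := dconv (fun d j => ((mangoldt d)%:C * f d * ecoef 2 i d) * (f j * ecoef 2 (k - i) j)).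
have HW i : has_sum (W i) (lamf i * acf (k - i)).
  apply: (has_sum_dconv_mul (lamf_bounded i) (acf_bounded (k - i))).
  - by rewrite ecoef_0 mulr0.
  - by rewrite ecoef_0 mulr0.
  - exact: csumP (lamf_bounded i).
  - exact: csumP (acf_bounded (k - i)).
have HS : has_sum (fun n => \sum_(i < k.+1) W i n) (\sum_(i < k.+1) lamf i * acf (k - i)).
  have := @clim_sum R 'I_k.+1 (index_enum 'I_k.+1) (fun i N => \sum_(n < N) W i n) _ (fun i => HW i).
  by apply: clim_eq => N; rewrite exchange_big.
have HA := has_sumZ k.+1%:R (csumP (acf_bounded k.+1)).
apply: (has_sum_uniq HA); apply: has_sum_eq HS => n.
case: (posnP n) => [->|n0].
  rewrite ecoef_0 !mulr0 big1// => i _; rewrite /W dconv_0//.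
  by rewrite !ecoef_0 !mulr0.
rewrite /W; under eq_bigr => i _ do rewrite dconv_divisors//.
rewrite exchange_big /=.
have E d : d \in divisors n -> \sum_(i < k.+1) (mangoldt d)%:C * f d * ecoef 2 i d *
    (f (n %/ d)%N * ecoef 2 (k - i) (n %/ d)) =
    (mangoldt d)%:C * (f n * cpw n 2 * (dpow k (lnn R n))%:C).
  rewrite -dvdn_divisors// => dn; have d0 := dvdn_gt0 n0 dn.
  have nd0 : (0 < n %/ d)%N by rewrite divn_gt0// dvdn_leq.
  have nE : n = (d * (n %/ d))%N by rewrite mulnC divnK.
  move: (n %/ d)%N nd0 nE => j j0 nE; rewrite nE fM cpwM lnnM//.
  have -> : (dpow k (lnn R d + lnn R j))%:C =
      \sum_(i < k.+1) (dpow i (lnn R d))%:C * (dpow (k - i) (lnn R j))%:C.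
    by rewrite dpowD rmorph_sum; apply: eq_bigr => i _; rewrite rmorphM.
  rewrite !mulr_sumr; apply: eq_bigr => i _; rewrite /ecoef; ring.
rewrite big_seq; under eq_bigr => d dn do rewrite E//.
rewrite -big_seq -mulr_suml -rmorph_sum sum_mangoldt// /ecoef.
have -> : k.+1%:R * (f n * (cpw n 2 * (dpow k.+1 (lnn R n))%:C)) =
   f n * cpw n 2 * (k.+1%:R * dpow k.+1 (lnn R n))%:C.
  by rewrite [(k.+1%:R * _)%:C]rmorphM rmorph_nat; ring.
by rewrite dpowS [(lnn R n * _)%:C]rmorphM /=; ring.
Qed.

End LogDerivative.

Lemma has_sum_real_exists (a : nat -> R) B : (forall n, 0 <= a n) ->
  (forall N, \sum_(n < N) a n <= B) ->
  exists l, [/\ has_sum (fun n => (a n)%:C) l%:C, l <= B & forall N, \sum_(n < N) a n <= l].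
Proof.
move=> a0 aB.
have ab : abs_bounded (fun n => (a n)%:C) B.
  by move=> N; under eq_bigr => i _ do rewrite nrm_nneg//; exact: aB.
have [l hl] := abs_bounded_sum ab.
have Iml : complex.Im l = 0.
  apply/eqP; rewrite -normr_eq0 eq_le normr_ge0 andbT; apply: le_addeps => e e0.
  have [N H] := hl e e0; have := H N (leqnn _); rewrite -rmorph_sum => h.
  by rewrite add0r; apply: le_trans h; apply: le_trans (Im_le_nrm _); rewrite ImD ImN /= sub0r normrN.
have lE : l = (complex.Re l)%:C by apply: complexP.
exists (complex.Re l); rewrite -lE; split=> //.
  apply: le_trans (ler_norm _) _; apply: le_trans (Re_le_nrm _) _.
  exact: has_sum_nrm_le hl ab.
move=> N; apply: (has_sum_ge hl); exists N => k Nk; rewrite -rmorph_sum /=.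
rewrite -(subnKC Nk) big_split_ord /= lerDl; exact: sumr_ge0.
Qed.

Lemma zeta_real (d : R) : 0 < d -> exists z,
  [/\ has_sum (fun n => (pw n (1 + d))%:C) z%:C, d^-1 <= z & z <= 1 + d^-1].
Proof.
move=> d0; have [z [hz zB zN]] := has_sum_real_exists (fun n => pw_ge0 n (1 + d))
  (fun N => sum_pw_le N d0).
exists z; split=> //; apply: le_addeps => e e0.
have [n0 H] := pw_small d0 (e := e * d) ltac:(by rewrite mulr_gt0).
have := H n0.+1 (leqnSn _); have := sum_pw_ge n0 d0; have := zN n0.+1.
rewrite -ler_pdivrMr// mulrBl mul1r; lra.
Qed.

(** Two-sided bounds for - zeta' (1 + d), of the exact order 1 / d^2. The upper one absorbs ln n
    into n^(d / 2). *)
Lemma lnn_zeta_real (d : R) : 0 < d <= 4^-1 -> exists z,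
  [/\ has_sum (fun n => (lnn R n * pw n (1 + d))%:C) z%:C,
      (4 * d ^+ 2)^-1 <= z & z <= 6 / d ^+ 2].
Proof.
move=> /andP[d0 d1]; have di : 0 < d^-1 by rewrite invr_gt0.
have di4 : 4 <= d^-1 by rewrite -[4]invrK lef_pV2// posrE invr_gt0.
have h2 : 0 < d / 2 by rewrite divr_gt0.
have up n : lnn R n * pw n (1 + d) <= (d / 2)^-1 * pw n (1 + d / 2).
  have := ler_wpM2r (pw_ge0 n (1 + d)) (lnn_le_expR n h2).
  move/le_trans; apply; rewrite -[leLHS]mulrA ler_wpM2l ?invr_ge0 ?(ltW h2)// mulrC -pw_mul_expR.
  by rewrite pw_le//; lra.
have [z [hz zB zN]] := @has_sum_real_exists (fun n => lnn R n * pw n (1 + d))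
  ((d / 2)^-1 * (1 + (d / 2)^-1))
  (fun n => mulr_ge0 (lnn_ge0 R n) (pw_ge0 n (1 + d))) ltac:(by
    move=> N; apply: (@le_trans _ _ (\sum_(n < N) (d / 2)^-1 * pw n (1 + d / 2)));
    [by apply: ler_sum => n _; exact: up|];
    rewrite -mulr_sumr ler_wpM2l ?invr_ge0 ?(ltW h2)//; exact: sum_pw_le).
exists z; split=> //; last first.
  apply: le_trans zB _; rewrite invf_div -[6 / _]mulr1.
  have -> : 6 / d ^+ 2 * 1 = 6 * (d^-1 * d^-1) by field; rewrite gt_eqF.
  by rewrite [2 / d]mulrC; nra.
have [z1 [hz1 l1 u1]] := zeta_real d0.
have d20 : 0 < 2 * d by rewrite mulr_gt0.
have [z2 [hz2 l2 u2]] := zeta_real d20.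
(* The lower bound is a difference quotient of zeta between 1 + d and 1 + 2d, since n^(-1-d) -
   n^(-1-2d) <= d ln n n^(-1-d). *)
have hd := has_sumZ (d^-1)%:C (has_sumB hz1 hz2).
have hdiff := has_sumB hz hd.
have : 0 <= complex.Re (z%:C - (d^-1)%:C * (z1%:C - z2%:C)).
  apply: (has_sum_ge hdiff); exists 0%N => k _; rewrite Re_sum; apply: sumr_ge0 => n _.
  rewrite -rmorphB -rmorphM -rmorphB /= subr_ge0 mulrC ler_pdivrMr//.
  rewrite (_ : 1 + 2 * d = (1 + d) - (- d)); last by ring.
  rewrite pw_mul_expR -[X in X - _]mulr1 -mulrBr -[leRHS]mulrA mulrCA ler_wpM2l ?pw_ge0//.
  have := expR_ge1Dx (- d * lnn R n); lra.
rewrite -rmorphB -rmorphM -rmorphB /= subr_ge0; apply: le_trans.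
have -> : (4 * d ^+ 2)^-1 = d^-1 * (4^-1 * d^-1) by field; rewrite gt_eqF.
rewrite ler_wpM2l ?(ltW di)//; rewrite invfM in u2; lra.
Qed.

(** Divide the bounds for - zeta' by those for zeta: the convolution of Lambda with 1 is the
    logarithm, so g zeta (1 + d) = - zeta' (1 + d). *)
Lemma mangoldt_real (d : R) : 0 < d <= 4^-1 -> exists g,
  [/\ has_sum (fun n => (mangoldt n * pw n (1 + d))%:C) g%:C, (8 * d)^-1 <= g &
      forall N, \sum_(n < N) mangoldt n * pw n (1 + d) <= 6 / d].
Proof.
move=> d01; have /andP[d0 d1] := d01.
have [z1 [hz1 l1 u1]] := lnn_zeta_real d01.
have [z [hz lz uz]] := zeta_real d0.
have [z1' [hz1' _ hN]] := @has_sum_real_exists (fun n => lnn R n * pw n (1 + d)) z1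
  (fun n => mulr_ge0 (lnn_ge0 R n) (pw_ge0 n (1 + d))) ltac:(by
   move=> N; apply: (has_sum_ge hz1); exists N => k Nk; rewrite -rmorph_sum /=;
   rewrite -(subnKC Nk) big_split_ord /= lerDl; apply: sumr_ge0 => i _;
   rewrite mulr_ge0 ?lnn_ge0 ?pw_ge0).
have [g [hg _ gN]] := @has_sum_real_exists (fun n => mangoldt n * pw n (1 + d)) z1'
  (fun n => mulr_ge0 (mangoldt_ge0 n) (pw_ge0 n (1 + d))) ltac:(by
   move=> N; apply: le_trans (hN N); apply: ler_sum => n _;
   rewrite ler_wpM2r ?pw_ge0 ?mangoldt_le).
have gb : abs_bounded (fun n => (mangoldt n * pw n (1 + d))%:C) g.
  move=> N; under eq_bigr => n _ do rewrite nrm_nneg ?mulr_ge0 ?mangoldt_ge0 ?pw_ge0//.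
  exact: gN.
have zb : abs_bounded (fun n => (pw n (1 + d))%:C) (1 + d^-1).
  by move=> N; under eq_bigr => n _ do rewrite nrm_nneg ?pw_ge0//; exact: sum_pw_le.
have H := has_sum_dconv_mul gb zb _ _ hg hz.
have gz : g * z = z1.
  apply: (@complexI R); rewrite rmorphM; apply: (has_sum_uniq (H _ _)); rewrite ?pw0 ?mulr0//.
  apply: has_sum_eq hz1 => n; case: (posnP n) => [->|n0].
    by rewrite dconv_0 pw0 !mulr0.
  rewrite dconv_divisors// -sum_mangoldt// mulr_suml rmorph_sum big_seq [RHS]big_seq.
  apply: eq_bigr => e; rewrite -dvdn_divisors// => en.
  by rewrite -rmorphM -mulrA -pwM mulnC divnK.
have di : 0 < d^-1 by rewrite invr_gt0.
have z0 : 0 < z by apply: lt_le_trans lz.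
have di4 : 4 <= d^-1 by rewrite -[4]invrK lef_pV2// posrE invr_gt0.
have g0 : 0 <= g by have := gN 0%N; rewrite big_ord0.
exists g; split=> //.
  rewrite -(ler_pM2r z0) gz; apply: le_trans l1.
  have -> : (4 * d ^+ 2)^-1 = (8 * d)^-1 * (2 * d^-1) by field; rewrite gt_eqF.
  by rewrite ler_wpM2l ?invr_ge0 ?mulr_ge0 ?(ltW d0)//; lra.
move=> N; apply: le_trans (gN N) _; rewrite -(ler_pM2r z0) gz (le_trans u1)//.
have -> : 6 / d ^+ 2 = 6 / d * d^-1 by field; rewrite gt_eqF.
by rewrite ler_wpM2l// mulr_ge0// ltW.
Qed.

End Mangoldt.

(** * Newton's identities for a polynomial given by its inverse roots *)

Section NewtonPolynomial.
Local Open Scope ring_scope.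
Variable F : fieldType.
Implicit Types us : seq F.

Definition unit_prod us : {poly F} := \prod_(u <- us) (1 - u *: 'X).

(** The logarithmic derivative is - sum u / (1 - u X); its power series is truncated modulo X^n to
    stay among polynomials. *)
Lemma deriv_unit_prod us (a0 : F) n : exists T : {poly F},
  (a0 *: unit_prod us)^`() =
  (\poly_(i < n) - (\sum_(u <- us) u ^+ i.+1)) * (a0 *: unit_prod us) + 'X^n * T.
Proof.
elim: us => [|v us [T IH]].
  exists 0; rewrite /unit_prod big_nil derivZ derivC scaler0 mulr0 addr0.
  rewrite (_ : \poly_(i < n) _ = 0) ?mul0r//.
  by apply/polyP => i; rewrite coef_poly big_nil oppr0 if_same coef0.
set Q := a0 *: unit_prod us in IH *.
have -> : a0 *: unit_prod (v :: us) = (1 - v *: 'X) * Q.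
  by rewrite /unit_prod big_cons /Q scalerAr.
exists ((1 - v *: 'X) * T - (v ^+ n.+1) *: Q).
pose V : {poly F} := \poly_(i < n) v ^+ i.+1.
have HV : (1 - v *: 'X) * V = v%:P - v ^+ n.+1 *: 'X^n.
  have -> : V = v%:P * \sum_(i < n) (v *: 'X) ^+ i.
    rewrite /V poly_def mulr_sumr; apply: eq_bigr => i _.
    by rewrite exprZn mul_polyC scalerA exprS.
  rewrite mulrCA -[1 - _]opprB mulNr -subrX1 exprZn exprS -scalerA opprB.
  by rewrite mulrBr mulr1 mul_polyC.
have EB : \poly_(i < n) - (\sum_(u <- v :: us) u ^+ i.+1) =
   (\poly_(i < n) - (\sum_(u <- us) u ^+ i.+1)) - V.
  by apply/polyP => i; rewrite coefB !coef_poly; case: ifP => _; rewrite ?subr0// big_cons opprD addrC.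
rewrite EB derivM IH derivB derivZ derivX derivC sub0r.
set B := \poly_(i < n) _.
rewrite (_ : (B - V) * _ = (1 - v *: 'X) * B * Q - (1 - v *: 'X) * V * Q); last by ring.
by rewrite HV -!mul_polyC; ring.
Qed.

(** The recurrence of [newton_lamf], with minus the power sums in the role of [lamf]. *)
Lemma newton_unit_prod us (a0 : F) k : let Q := a0 *: unit_prod us in
  k.+1%:R * Q`_k.+1 = - \sum_(i < k.+1) (\sum_(u <- us) u ^+ i.+1) * Q`_(k - i).
Proof.
move=> Q; have [T] := deriv_unit_prod us a0 k.+1; rewrite -/Q => /polyP /(_ k).
rewrite coef_deriv coefD coefXnM ltnSn addr0 coefM => E.
rewrite mulr_natl E.
rewrite -sumrN; apply: eq_bigr => i _.
by rewrite coef_poly ltn_ord mulNr.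
Qed.

Lemma unit_prod_factor (r : seq F) (c : F) : 0 \notin r ->
  c *: \prod_(z <- r) ('X - z%:P) =
  (c * \prod_(z <- r) - z) *: unit_prod [seq z^-1 | z <- r].
Proof.
move=> r0; rewrite -scalerA; congr (_ *: _).
elim: r r0 => [|z r IH]; first by rewrite /unit_prod !big_nil scale1r.
rewrite inE negb_or eq_sym => /andP[z0 /IH E].
rewrite big_cons E /unit_prod [map _ _]/= !big_cons -scalerA scalerAr scalerAl.
congr (_ * _); rewrite scalerBr scalerA scaleNr mulNr mulfV// scaleN1r opprK addrC.
by rewrite alg_polyC.
Qed.

End NewtonPolynomial.

(** * Taylor coefficients of - L'/L at 2 under GRH *)

Section Ankeny.
Local Open Scope ring_scope.
Local Open Scope complex_scope.
Variable R : realType.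
Hypothesis grh : GRH R.

Section Character.
Variables (N : nat) (chi : nat -> R[i]).
Hypotheses (N1 : (1 < N)%N) (chiP : dirichlet_character N chi).
Hypothesis chi1 : exists2 a, coprime a N & chi a != 1.

Local Notation L := (Lfun chi).

Let chi0 := char0 N1 chiP.
Let pB n := char_psum_le N1 chiP n chi1.

(** GRH covers the open strip, the Euler product Re s > 1, the 3-4-1 inequality the line Re s = 1,
    and [L1_real_neq0] the point 1 for a real character. *)
Lemma L_neq0_half s : 1 / 2 < complex.Re s -> L s != 0.
Proof.
move=> s2; have s0 : 0 < complex.Re s by apply: lt_trans s2.
case: (ltgtP (complex.Re s) 1) => [s1|s1|s1].
- apply/eqP => Ls; have := grh (ltnW N1) chiP (Lfun_dirichlet_L chi0 pB) _ Ls.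
  by rewrite s0 s1 => /(_ isT) E; rewrite E ltxx in s2.
- exact: (L_neq0_gt1 N1 chiP chi1).
- case: (boolP ((s != 1) || [exists a : 'I_N, coprime a N && (chi a ^+ 2 != 1)])).
    exact: (L_neq0_line N1 chiP chi1).
  rewrite negb_or negbK => /andP[/eqP -> /existsPn H].
  apply: (L1_real_neq0 N1 chiP chi1) => a aN.
  have N0 : (0 < N)%N by rewrite ltnW.
  have := H (Ordinal (ltn_pmod a N0)); rewrite /= coprime_modl aN (char_mod chiP) /=.
  by rewrite negbK => /eqP.
Qed.

(** Compactness of the square of half-side [rho], which is mapped into Re s > 1/2. The constant is
    not explicit: it only decides how long a Taylor polynomial has to be and does not reach the
    final bounds. *)
Lemma L_lower_bound rho : 0 < rho -> rho < 3 / 2 ->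
  exists2 d : R, 0 < d & forall z, nrm z <= rho -> d <= nrm (L (2 - z)).
Proof.
move=> rho0 rho1.
pose g (p : R * R) : R := nrm (L (2 - (p.1 +i* p.2))).
pose A : set (R * R) := (`[- rho, rho] `*` `[- rho, rho])%classic.
have re p : complex.Re (2 - (p.1 +i* p.2)) = 2 - p.1 :> R.
  by rewrite ReD ReN (_ : 2 = 1 + 1)// ReD.
have cA : compact A by apply: compact_setX; exact: segment_compact.
have A0 : (A !=set0)%classic by exists (0, 0); split; rewrite /= in_itv /=; apply/andP; split; lra.
have cont : {within A, continuous g}%classic.
  apply: continuous_in_subspaceT => p; rewrite inE => -[/= + _]; rewrite in_itv /= => /andP[_ p1].
  have ps0 : 0 < complex.Re (2 - (p.1 +i* p.2)) by rewrite re; lra.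
  have [C C0 HC] := Lfun_lipschitz chi0 pB ps0.
  apply/cvgrPdist_le => e e0.
  pose d := Num.min ((2 - p.1) / 4) (e / (2 * (C + 1))).
  have d0 : 0 < d by rewrite lt_min divr_gt0 ?divr_gt0 ?mulr_gt0//; lra.
  exists (ball p.1 d, ball p.2 d); first by split; exact: nbhsx_ballx.
  move=> q [/= h1 h2]; rewrite /ball /= in h1 h2.
  have [d1 d2] : d <= (2 - p.1) / 4 /\ d <= e / (2 * (C + 1)).
    by rewrite /d !ge_min !lexx orbT.
  have hd := lt_le_trans h1 d1; have Dz : 2 * d <= e / (C + 1).
    by rewrite mulrC -ler_pdivlMr// -mulrA -invfM [_ * 2]mulrC.
  pose z := (p.1 - q.1) +i* (p.2 - q.2); have zle : nrm z <= 2 * d.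
    by apply: le_trans (nrm_le_ReIm _) _; rewrite /=; lra.
  have zs : nrm z <= complex.Re (2 - (p.1 +i* p.2)) / 2 by rewrite re; lra.
  have := HC z zs; have -> : 2 - (p.1 +i* p.2) + z = 2 - (q.1 +i* q.2).
    by apply: complexP; rewrite /z !(ReD, ReN, ImD, ImN) /=; ring.
  move=> HCz; have {HCz} : nrm (L (2 - (q.1 +i* q.2)) - L (2 - (p.1 +i* p.2))) <= e.
    apply: le_trans HCz _; apply: (@le_trans _ _ (C * (e / (C + 1)))).
      by rewrite ler_wpM2l// (le_trans zle).
    by rewrite mulrCA ler_piMr ?(ltW e0)// ler_pdivrMr ?mul1r; lra.
  rewrite /g; move: (L (2 - (p.1 +i* p.2))) (L (2 - (q.1 +i* q.2))) => a b ab.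
  have := nrm_tri b a 0; have := nrm_tri a b 0; rewrite !subr0 (nrmC a) ler_norml; lra.
have [c cA' Hc] := compact_EVT_min A0 cA cont.
have gc : 0 < g c.
  rewrite /g nrm_gt0; apply: L_neq0_half; rewrite re.
  by move: cA'; rewrite inE => -[/= + _]; rewrite in_itv /= => /andP[_ h]; lra.
exists (g c) => // z zr; have := Hc (complex.Re z, complex.Im z).
rewrite /g /= (_ : complex.Re z +i* complex.Im z = z); last exact: complexP.
apply; rewrite inE; split; rewrite /= in_itv /= -ler_norml.
  exact: le_trans (Re_le_nrm z) zr.
exact: le_trans (Im_le_nrm z) zr.
Qed.

(** The two expressions differ by the boundary term of Abel summation, which tends to 0 at the point
    2. *)
Lemma acoef_acf k : acoef chi 2 k = acf chi k.
Proof.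
have Re2 : 0 < complex.Re (2 : R[i]) by rewrite (_ : 2 = 1 + 1)// ReD /=; lra.
have H1 := csumP (acf_bounded (nrm_char_le N1 chiP) k).
have H2 := acoef_has_sum chi0 pB k Re2.
have E : clim (fun M => psum chi M * ecoef 2 k M.+1) 0.
  move=> e e0; have B1 : 0 < N%:R * 4 ^+ k + 1 :> R by rewrite ltr_wpDl// mulr_ge0// exprn_ge0.
  have [n0 H] := @pw_small R (2 - 4^-1) (e / (N%:R * 4 ^+ k + 1)) ltac:(lra) ltac:(by rewrite divr_gt0).
  exists n0 => M nM; rewrite subr0 nrmM.
  apply: (@le_trans _ _ (N%:R * (4 ^+ k * pw M.+1 (2 - 4^-1)))).
    by rewrite ler_pM ?nrm_ge0// ?pB// nrm_ecoef2.
  have := H M.+1 (leqW nM); rewrite ler_pdivlMr// mulrA; apply: le_trans.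
  by rewrite mulrC ler_wpM2l ?pw_ge0// lerDl.
have := climD (clim_sub H2 leqnSn) E; rewrite addr0 => H3.
apply: (clim_uniq H3); apply: clim_eq (clim_sub H1 leqnSn) => M.
exact: (abel_sum chi0 (fun n => ecoef 2 k n)).
Qed.

Lemma sum_pw2_tail M : \sum_(i < M) pw (2 + i) (1 + 1) <= 3 / 4 :> R.
Proof.
case: M => [|M]; first by rewrite big_ord0; lra.
rewrite big_ord_recl /= addn0 pwD !pwV.
have : \sum_(i < M) pw (2 + bump 0 i) (1 + 1) <= 2^-1 :> R.
  apply: (@le_trans _ _ (\sum_(i < M) (pw (2 + i) 1 - pw (2 + i).+1 1))).
    apply: ler_sum => i _; rewrite /bump /= add1n addnS.
    by have := @pw_step_ge R (2 + i) 1 ltr01 isT; rewrite divr1.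
  have -> : \sum_(i < M) (pw (2 + i) 1 - pw (2 + i).+1 1) = pw 2 1 - pw (2 + M) 1 :> R.
    elim: M => [|M IH]; first by rewrite big_ord0 addn0 subrr.
    by rewrite big_ord_recr IH /= addnS; ring.
  by have := pw_ge0 (2 + M) (1 : R); rewrite !pwV; lra.
lra.
Qed.

(** |L(2) - 1| <= zeta(2) - 1 <= 3/4. *)
Lemma acf0_ge : 4^-1 <= nrm (acf chi 0).
Proof.
have H := csumP (acf_bounded (nrm_char_le N1 chiP) 0).
have E : \sum_(i < 2) chi i * ecoef 2 0 i = 1.
  rewrite !big_ord_recl big_ord0 /= chi0 mul0r add0r addr0 /bump /=.
  by rewrite (dirichlet1 chiP) /ecoef dpow0 cpw1 !mulr1.
have : nrm (acf chi 0 - 1) <= 3 / 4.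
  rewrite -E; apply: (has_sum_dist_le H) => M; apply: le_trans (sum_pw2_tail M).
  apply: ler_sum => i _; rewrite nrmM nrm_ecoef dpow0 mulr1.
  rewrite (_ : complex.Re 2 = 1 + 1); last by rewrite (_ : 2 = 1 + 1)// ReD.
  by rewrite ler_piMl ?pw_ge0// (nrm_char_le N1 chiP).
by have := nrm_lb 1 (acf chi 0 - 1); rewrite addrCA subrr addr0 nrm1; lra.
Qed.

(** [Lbound] for the point 2, the radius 5/4 and partial sums bounded by [N]. *)
Definition Lmax : R := N%:R * ((2 + 5 / 4) * expR (5 / 4) * (1 + (2 - 5 / 4)^-1)).

(** A long Taylor polynomial P of [L (2 - z)] has no zero for |z| <= 5/4, so its inverse roots are
    smaller than 4/5. Its first coefficients are those of [L], so the two Newton recurrences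
    identify [lamf k] with minus a power sum, to which Borel-Caratheodory applies. The constant 4
    comes from |L(2)| >= 1/4. *)
Lemma lamf_bound k :
  nrm (lamf chi k) <= 2 * k.+1%:R * ln (4 * Lmax) * (4 / 5) ^+ k.+1.
Proof.
have Re2 : complex.Re (2 : R[i]) = 2 by rewrite (_ : 2 = 1 + 1)// ReD.
have nrm2 : nrm (2 : R[i]) = 2 by exact: nrm_nat.
pose rho : R := 5 / 4; pose rho' : R := 11 / 8.
have rho0 : 0 < rho by rewrite /rho; lra.
have rho'0 : 0 < rho' by rewrite /rho'; lra.
have rho1 : rho < 3 / 2 by rewrite /rho; lra.
have [d d0 Hd] := L_lower_bound rho0 rho1.
have aB : abs_bounded (fun j => acoef chi 2 j * rho%:C ^+ j) Lmax.
  have := acoef_bounded chi0 pB (s := 2) (ltW rho0) ltac:(rewrite Re2 /rho; lra).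
  by rewrite /Lbound Re2 nrm2.
have aB' := acoef_bounded chi0 pB (s := 2) (ltW rho'0) ltac:(rewrite Re2 /rho'; lra).
have B'0 := abs_bounded_ge0 aB'; set B' := Lbound _ _ _ in aB' B'0.
(* Convergence at the larger radius 11/8 makes polynomials of length at least [K0] approximate [L]
   within d / 2 on the disc of radius 5/4. The length [k + 2] below guarantees the right
   coefficients up to index [k + 1]. *)
have [K0 HK0] := @pow_small R (rho / rho') (d / (2 * (B' + 1)))
  ltac:(by rewrite divr_ge0 ?(ltW rho0) ?(ltW rho'0)//= ltr_pdivrMr// mul1r /rho /rho'; lra)
  ltac:(by rewrite divr_gt0// mulr_gt0//; lra).
pose K := (maxn K0 k.+2); pose P : {poly R[i]} := \poly_(j < K) acoef chi 2 j.
have PE z : P.[z] = \sum_(j < K) acoef chi 2 j * z ^+ j by rewrite horner_poly.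
have P0 : P`_0 = acoef chi 2 0 by rewrite coef_poly /K leq_max orbT.
have a00 : acoef chi 2 0 != 0.
  by rewrite acoef_acf -nrm_gt0; apply: lt_le_trans acf0_ge; rewrite invr_gt0.
have Pneq0 z : nrm z <= rho -> P.[z] != 0.
  move=> zr; have zr' : nrm z <= rho' by apply: le_trans zr _; rewrite /rho /rho'; lra.
  have [H _] := Lfun_power_series chi0 pB (s := 2) (ltW rho'0) ltac:(rewrite Re2 /rho'; lra) zr'.
  have := power_series_rem K rho'0 aB' zr' H; rewrite -PE => h.
  have h2 : B' * (nrm z / rho') ^+ K <= d / 2.
    apply: (@le_trans _ _ (B' * (d / (2 * (B' + 1))))).
      rewrite ler_wpM2l//; apply: le_trans (HK0 K (leq_maxl _ _)).
      by rewrite lerXn2r ?nnegrE ?divr_ge0 ?nrm_ge0 ?(ltW rho'0) ?(ltW rho0)// ler_wpM2r ?invr_ge0 ?(ltW rho'0).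
    rewrite mulrA ler_pdivrMr ?mulr_gt0//; last by lra.
    have := ltW d0; nra.
  rewrite -nrm_gt0; have := nrm_lb (L (2 - z)) (P.[z] - L (2 - z)).
  rewrite addrCA subrr addr0 (nrmC P.[z]) => h3; have := Hd z zr; lra.
have [r Pr] := closed_field_poly_normal P.
have Pn0 : P != 0.
  by apply/eqP => E; have := Pneq0 0; rewrite nrm0 E horner0 eqxx (ltW rho0) => /(_ isT).
have rootP z : z \in r -> P.[z] = 0.
  by move=> zr; apply/rootP; rewrite Pr rootZ ?lead_coef_eq0// root_prod_XsubC.
have r0 : 0 \notin r.
  by apply/negP => /rootP E; have := Pneq0 0; rewrite nrm0 E eqxx (ltW rho0) => /(_ isT).
set us := [seq z^-1 | z <- r].
have [a PU] : exists a, P = a *: unit_prod us.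
  by exists (lead_coef P * \prod_(z <- r) - z); rewrite {1}Pr unit_prod_factor.
have U0 : (unit_prod us)`_0 = 1.
  rewrite -horner_coef0 /unit_prod horner_prod big1// => u _.
  by rewrite hornerD hornerN hornerZ hornerX mulr0 subr0 hornerC.
have aE : a = acoef chi 2 0 by rewrite -P0 PU coefZ U0 mulr1.
(* Strong induction: both recurrences have the same earlier terms, and the last one is multiplied by
   the nonzero constant coefficient. *)
have lamE i : (i < k.+1)%N -> lamf chi i = - \sum_(u <- us) u ^+ i.+1.
  elim/ltn_ind: i => i IH ik.
  have h1 := newton_lamf (dirichletM chiP) (nrm_char_le N1 chiP) i.
  have h2 := newton_unit_prod us a i; rewrite /= -PU in h2.
  have iK j : (j <= i.+1)%N -> P`_j = acf chi j.
    move=> ji; rewrite coef_poly acoef_acf ifT// /K leq_max; apply/orP; right; lia.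
  move: h1 h2; rewrite iK// => ->; rewrite !big_ord_recr /= subnn iK//.
  have -> : \sum_(j < i) lamf chi j * acf chi (i - j) =
     \sum_(j < i) - ((\sum_(u <- us) u ^+ j.+1) * P`_(i - j)).
    apply: eq_bigr => j _; rewrite IH ?mulNr//; last exact: ltn_trans ik.
    by rewrite iK// (leq_trans (leq_subr _ _)).
  rewrite opprD -[in X in _ = X -> _]sumrN => /addrI; rewrite -mulNr => /mulIf; apply.
  by rewrite -acoef_acf.
rewrite lamE// nrmN.
have usr u : u \in us -> nrm (rho%:C * u) < 1.
  move=> /mapP[z zr ->]; rewrite nrmM nrmV nrm_nneg ?(ltW rho0)//.
  have z0 : 0 < nrm z by rewrite nrm_gt0; apply: contraNneq r0 => <-.
  rewrite ltr_pdivrMr// mul1r ltNge; apply/negP => h.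
  by have := Pneq0 z h; rewrite rootP// eqxx.
have PM z : nrm z = rho -> nrm (a * \prod_(u <- us) (1 - u * z)) <= Lmax.
  move=> zr; have -> : a * \prod_(u <- us) (1 - u * z) = P.[z].
    rewrite PU hornerZ /unit_prod horner_prod; congr (_ * _); apply: eq_bigr => u _.
    by rewrite hornerD hornerN hornerZ hornerX hornerC.
  rewrite PE; apply: le_trans (nrm_sum _ _ _) _; apply: le_trans (aB K).
  by apply: ler_sum => j _; rewrite !nrmM !nrmX zr nrm_nneg// ltW.
have := borel_caratheodory (ltn0Sn k) rho0 _ usr PM; rewrite aE => /(_ a00) H.
have rk : 0 < rho ^+ k.+1 by rewrite exprn_gt0.
have -> : (4 / 5) ^+ k.+1 = (rho ^+ k.+1)^-1 :> R by rewrite -exprVn /rho invf_div.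
rewrite ler_pdivlMr//; apply: le_trans H _; rewrite ler_wpM2l ?mulr_ge0//.
have a0p : 0 < nrm (acoef chi 2 0) by rewrite nrm_gt0.
have Lp : 0 < Lmax.
  have i1 : 0 < (2 - 5 / 4)^-1 :> R by rewrite invr_gt0; lra.
  have i2 : 0 < 2 + 5 / 4 :> R by lra.
  have N0 : 0 < N%:R :> R by rewrite ltr0n ltnW.
  exact: (mulr_gt0 N0 (mulr_gt0 (mulr_gt0 i2 (expR_gt0 _)) (addr_gt0 ltr01 i1))).
have p1 : 0 < Lmax / nrm (acoef chi 2 0) by exact: divr_gt0.
have p2 : 0 < 4 * Lmax by exact: mulr_gt0.
rewrite ler_ln ?posrE//.
rewrite ler_pdivrMr// mulrAC ler_peMl ?(ltW Lp)//.
by have := acf0_ge; rewrite -acoef_acf; lra.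
Qed.

End Character.

End Ankeny.

Lemma ltn_bitlen k : (k < 2 ^ bitlen k)%N.
Proof. by rewrite /bitlen; exact: trunc_log_ltn. Qed.

(** * A small argument where a nonprincipal character differs from 1 *)

Section AnkenyBound.
Local Open Scope ring_scope.
Local Open Scope complex_scope.
Variable R : realType.

(** Absorbs the factor k + 1 of [lamf_bound] by writing 4/5 = 8/9 * 9/10. *)
Lemma natr_mul_pow_le j : j%:R * (8 / 9) ^+ j <= 9 :> R.
Proof.
apply: (@le_trans _ _ (\sum_(i < j) (8 / 9) ^+ i)).
  rewrite -[j in j%:R]card_ord -sumr_const mulr_suml; apply: ler_sum => i _.
  have h : 8 / 9 <= 1 :> R by lra.
  by rewrite mul1r ler_wiXn2l// (ltnW (ltn_ord i)).
apply: le_trans (geo_sum_le _ _) _; first by apply/andP; split; lra.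
by rewrite (_ : 1 - 8 / 9 = 9^-1) ?invrK//; field.
Qed.

Section Character.
Hypothesis grh : GRH R.
Variables (N : nat) (chi : nat -> R[i]).
Hypotheses (N1 : (1 < N)%N) (chiP : dirichlet_character N chi).
Hypothesis chi1 : exists2 a, coprime a N & chi a != 1.

Let ell : R := ln (4 * Lmax R N).

Lemma ell_ge0 : 0 <= ell.
Proof.
have := lamf_bound grh N1 chiP chi1 0; rewrite expr1 -/ell.
have := nrm_ge0 (lamf chi 0); lra.
Qed.

Lemma lamf_geo k : nrm (lamf chi k) <= 18 * ell * (9 / 10) ^+ k.+1.
Proof.
apply: le_trans (lamf_bound grh N1 chiP chi1 k) _; rewrite -/ell.
have -> : 4 / 5 = 8 / 9 * (9 / 10) :> R by field.
rewrite exprMn mulrA ler_wpM2r ?exprn_ge0//.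
have := ler_wpM2l ell_ge0 (natr_mul_pow_le k.+1); lra.
Qed.

Lemma lamf_tail K M : \sum_(i < M) nrm (lamf chi (K + i)) <= 180 * ell * (9 / 10) ^+ K.
Proof.
apply: (@le_trans _ _ (18 * ell * (9 / 10) ^+ K * \sum_(i < M) (9 / 10) ^+ i)).
  rewrite mulr_sumr; apply: ler_sum => i _; apply: le_trans (lamf_geo _) _.
  rewrite -addnS exprD mulrA ler_wpM2l ?mulr_ge0 ?exprn_ge0 ?ell_ge0//.
  by rewrite exprS ler_piMl ?exprn_ge0//; lra.
rewrite mulrAC mulrC; have -> : 180 * ell * (9 / 10) ^+ K = (9 / 10) ^+ K * (18 * ell * 10) by ring.
rewrite ler_wpM2l ?exprn_ge0// ler_wpM2l ?mulr_ge0 ?ell_ge0//.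
apply: le_trans (geo_sum_le _ _) _; first by apply/andP; split; lra.
by rewrite (_ : 1 - 9 / 10 = 10^-1) ?invrK//; field.
Qed.

(** Taking z = 1 - d leads from the centre 2 to the point 1 + d, and |chi| <= 1 leaves the series of
    zeta as a bound. *)
Lemma mangoldt_dbl_bounded d : 0 < d <= 4^-1 ->
  dbl_bounded (fun n k => (mangoldt R n)%:C * chi n * ecoef 2 k n * (1 - d)%:C ^+ k) (6 / d).
Proof.
move=> d01; have /andP[d0 d1] := d01; have [g [_ _ gN]] := mangoldt_real d01.
have d10 : 0 <= 1 - d by lra.
move=> D E; apply: le_trans (gN D); apply: ler_sum => n _.
have Re2 : complex.Re (2 : R[i]) = 2 by rewrite (_ : 2 = 1 + 1)// ReD.
apply: (@le_trans _ _ (mangoldt R n * pw n 2 * \sum_(k < E) dpow k ((1 - d) * lnn R n))).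
  rewrite mulr_sumr; apply: ler_sum => k _.
  rewrite nrmM nrmX nrmM nrmM nrm_ecoef Re2 (nrm_nneg d10) nrm_nneg ?mangoldt_ge0//.
  rewrite dpowM; have := nrm_char_le N1 chiP n; have := mangoldt_ge0 R n.
  have := pw_ge0 n (2 : R); have := dpow_ge0 k (lnn_ge0 R n); have := exprn_ge0 k d10.
  move: (mangoldt R n) (pw n 2) (dpow k _) (_ ^+ k) (nrm _) => a b x y c y0 x0 b0 a0 c1.
  rewrite (_ : a * c * (b * x) * y = a * b * (y * x) * c); last by ring.
  by rewrite ler_piMr// !mulr_ge0.
rewrite -mulrA ler_wpM2l ?mangoldt_ge0// (_ : 1 + d = 2 - (1 - d)); last by ring.
by rewrite pw_mul_expR ler_wpM2l ?pw_ge0// sum_dpow_le// mulr_ge0 ?lnn_ge0.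
Qed.

Lemma lamf_series_bounded d : 0 < d <= 4^-1 ->
  abs_bounded (fun k => lamf chi k * (1 - d)%:C ^+ k) (6 / d).
Proof.
move=> d01; apply: abs_bounded_rows (dbl_bounded_tr (mangoldt_dbl_bounded d01)) _ => k.
have := has_sumZ ((1 - d)%:C ^+ k) (csumP (lamf_bounded (nrm_char_le N1 chiP) k)).
by rewrite mulrC; apply: has_sum_eq => n; rewrite mulrC.
Qed.

Lemma mangoldt_lamf_sum d : 0 < d <= 4^-1 -> exists T,
  has_sum (fun n => (mangoldt R n)%:C * chi n * (pw n (1 + d))%:C) T /\
  has_sum (fun k => lamf chi k * (1 - d)%:C ^+ k) T.
Proof.
move=> d01; have [T HT] := dbl_bounded_sum (mangoldt_dbl_bounded d01).
exists T; split.
  apply: (dbl_sum_rows HT) => n.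
  have := has_sumZ ((mangoldt R n)%:C * chi n) (ecoef_has_sum 2 (1 - d)%:C n).
  have -> : 2 - (1 - d)%:C = (1 + d)%:C :> R[i].
    by rewrite (_ : 2 = 1 + 1)//; apply: complexP; rewrite !(ReD, ReN, ImD, ImN) /=; ring.
  by rewrite cpw_real; apply: has_sum_eq => k; rewrite mulrA.
apply: (dbl_sum_cols HT) => k.
have := has_sumZ ((1 - d)%:C ^+ k) (csumP (lamf_bounded (nrm_char_le N1 chiP) k)).
by rewrite [_ * lamf _ _]mulrC; apply: has_sum_eq => n; rewrite mulrC.
Qed.

(** The sums with and without [chi] differ only from [X] on. Half of the exponent d is spent on this
    tail: it is at most 2 X^(-d/2) times the full sum at 1 + d/2, which is at most 12 / d. So the
    loss is at most 0.06 / d, and 1/8 - 0.06 > 1/16. *)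
Lemma mangoldt_twist_ge d X T : 0 < d <= 4^-1 -> (0 < X)%N -> 400 * pw X (d / 2) <= 1 ->
  (forall n, (0 < n < X)%N -> chi n = 1) ->
  has_sum (fun n => (mangoldt R n)%:C * chi n * (pw n (1 + d))%:C) T ->
  (16 * d)^-1 <= nrm T.
Proof.
move=> d01 X0 pX H HT; have /andP[d0 d1] := d01.
have d2 : 0 < d / 2 <= 4^-1 by apply/andP; split; lra.
have [g [hg gd _]] := mangoldt_real d01; have [_ [_ _ hN]] := mangoldt_real d2.
have di : 0 < d^-1 by rewrite invr_gt0.
have hd := has_sumB hg HT.
have ub : abs_bounded (fun n => (mangoldt R n * pw n (1 + d))%:C -
    (mangoldt R n)%:C * chi n * (pw n (1 + d))%:C) (2 * pw X (d / 2) * (6 / (d / 2))).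
  move=> M; apply: le_trans (ler_wpM2l _ (hN M)); last by rewrite mulr_ge0 ?pw_ge0.
  rewrite mulr_sumr; apply: ler_sum => n _.
  rewrite rmorphM (_ : _ - _ = (mangoldt R n * pw n (1 + d))%:C * (1 - chi n)); last first.
    by rewrite rmorphM /=; ring.
  have [nX|Xn] := ltnP n X.
    case: (posnP n) => [->|n0]; first by rewrite !pw0 mulr0 mul0r nrm0 !mulr0.
    by rewrite H ?n0// subrr mulr0 nrm0 !mulr_ge0 ?mangoldt_ge0 ?pw_ge0.
  rewrite nrmM nrm_nneg ?mulr_ge0 ?mangoldt_ge0 ?pw_ge0//.
  have c2 : nrm (1 - chi n) <= 2.
    by apply: le_trans (nrmB _ _) _; rewrite nrm1 (_ : 2 = 1 + 1)// lerD2l (nrm_char_le N1 chiP).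
  have p2 : pw n (1 + d) <= pw X (d / 2) * pw n (1 + d / 2).
    rewrite (_ : 1 + d = d / 2 + (1 + d / 2)); last by field.
    rewrite pwD ler_wpM2r ?pw_ge0//.
    by apply: pw_mono; [lra|rewrite X0].
  apply: (@le_trans _ _ (mangoldt R n * (pw X (d / 2) * pw n (1 + d / 2)) * 2)).
    by rewrite ler_pM ?mulr_ge0 ?nrm_ge0 ?mangoldt_ge0 ?pw_ge0// ler_wpM2l ?mangoldt_ge0.
  by rewrite (_ : _ * 2 = 2 * pw X (d / 2) * (mangoldt R n * pw n (1 + d / 2)))//; ring.
have := has_sum_nrm_le hd ub.
rewrite invf_div (_ : _ * (6 * (2 / d)) = (400 * pw X (d / 2)) * (6 / 100 * d^-1)); last first.
  by field; rewrite gt_eqF.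
have := ler_wpM2r (_ : 0 <= 6 / 100 * d^-1) pX; rewrite mul1r.
move: (400 * _ * _) => u Hu; have {Hu} : u <= 6 / 100 * d^-1 by apply: Hu; lra.
have := nrm_lb g%:C (T - g%:C); rewrite addrCA subrr addr0 (nrmC g%:C).
rewrite invfM in gd; rewrite invfM.
have := ler_norm g; rewrite -(nrm_real g); lra.
Qed.

(** At d = 1 / K the comparison with zeta bounds the weighted sum by 6 K, and each weight (1 -
    1/K)^k with k < K is at least 1/4. Evenness of K = 2 h lets Bernoulli be applied to the exponent
    h, followed by a squaring. *)
Lemma lamf_head h : (2 <= h)%N -> \sum_(k < h.*2) nrm (lamf chi k) <= 24 * (h.*2)%:R.
Proof.
move=> h2; set K := h.*2; have K4 : 4 <= K%:R :> R by rewrite ler_nat /K; lia.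
have K0 : 0 < K%:R :> R by lra.
have i1 : K%:R^-1 <= 4^-1 :> R by rewrite lef_pV2// posrE.
have i0 : 0 < K%:R^-1 :> R by rewrite invr_gt0.
have d01 : 0 < (K%:R^-1 : R) <= 4^-1 by rewrite i0.
have q : 4^-1 <= (1 - K%:R^-1) ^+ K :> R.
  rewrite [X in _ ^+ X](_ : K = (h * 2)%N) ?exprM; last by rewrite /K; lia.
  have := @bernoulli R K%:R^-1 h (ltW i0) ltac:(lra).
  have -> : h%:R * K%:R^-1 = 2^-1 :> R.
    rewrite /K -mul2n natrM; field; rewrite pnatr_eq0; lia.
  move: (_ ^+ h) => y hy; rewrite expr2; nra.
have := lamf_series_bounded d01 K; rewrite invrK => H.
suff : 4^-1 * \sum_(k < K) nrm (lamf chi k) <= 6 * K%:R by lra.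
apply: le_trans H; rewrite mulr_sumr; apply: ler_sum => k _.
rewrite nrmM nrmX nrm_nneg; last by lra.
rewrite mulrC ler_wpM2l ?nrm_ge0//; apply: le_trans q _.
by rewrite ler_wiXn2l ?(ltnW (ltn_ord k))//; lra.
Qed.

Lemma pw_pow2 n a : pw (2 ^ n) a = expR (- (a * (n%:R * ln 2))) :> R.
Proof.
have : (0 < 2 ^ n)%N by rewrite expn_gt0.
have : lnn R (2 ^ n) = n%:R * ln 2 by rewrite /lnn natrX lnXn// mulr_natl.
by case: (2 ^ n)%N => // k E _; rewrite /pw E.
Qed.

Lemma nontrivial_value h : (2 <= h)%N -> 180 * ell * (9 / 10) ^+ h.*2 <= 1 ->
  exists2 m, (0 < m < 2 ^ (9 * (802 * h.*2)))%N & chi m != 1.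
Proof.
move=> h2 hell; set K := h.*2 in hell *; apply: contrapT => nH.
have H n : (0 < n < 2 ^ (9 * (802 * K)))%N -> chi n = 1.
  by move=> hn; apply/eqP; case: eqVneq => // E; case: nH; exists n.
have K4 : 4 <= K%:R :> R by rewrite ler_nat /K; lia.
pose d : R := (401 * K%:R)^-1.
have d0 : 0 < d by rewrite invr_gt0; lra.
have d1 : d <= 4^-1 by rewrite lef_pV2 ?posrE; lra.
have d01 : 0 < d <= 4^-1 by rewrite d0.
have dE : (16 * d)^-1 = 401 / 16 * K%:R by rewrite /d; field; rewrite gt_eqF//; lra.
have [T [T1 T2]] := mangoldt_lamf_sum d01.
have pX : 400 * pw (2 ^ (9 * (802 * K))) (d / 2) <= 1.
  (* The exponent 9 * 802 * K is made so that X^(d / 2) = 2^9 = 512 >= 400. *)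
  rewrite pw_pow2 (_ : d / 2 * _ = 9 * ln 2); last first.
    by rewrite /d !natrM; field; rewrite gt_eqF//; lra.
  have -> : 9 * ln 2 = ln (2 ^+ 9) :> R by rewrite lnXn// mulr_natl.
  have e0 : 0 < 2 ^+ 9 :> R by rewrite exprn_gt0.
  rewrite expRN lnK ?posrE; last exact: e0.
  by rewrite ler_pdivrMr; [lra|exact: e0].
have := mangoldt_twist_ge d01 _ pX H T1; rewrite expn_gt0 => /(_ isT); rewrite dE.
have ub : abs_bounded (fun k => lamf chi k * (1 - d)%:C ^+ k) (24 * K%:R + 1).
  move=> M; apply: (@le_trans _ _ (\sum_(k < K + M) nrm (lamf chi k))).
    rewrite addnC big_split_ord /=; apply: (@le_trans _ _ (\sum_(k < M) nrm (lamf chi k))).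
      apply: ler_sum => k _; rewrite nrmM nrmX nrm_nneg; last by lra.
      by rewrite ler_piMr ?nrm_ge0// exprn_ile1//; lra.
    by rewrite lerDl; apply: sumr_ge0 => i _; exact: nrm_ge0.
  rewrite big_split_ord /= lerD ?lamf_head//.
  exact: le_trans (lamf_tail K M) hell.
by have := has_sum_nrm_le T2 ub; lra.
Qed.

End Character.

Lemma ln_Lmax_le : exists2 C : R, 0 <= C & forall N, (1 < N)%N ->
  ln (4 * Lmax R N) <= C * (bitlen N)%:R.
Proof.
pose c : R := (2 + 5 / 4) * expR (5 / 4) * (1 + (2 - 5 / 4)^-1).
have c0 : 0 < c.
  have i1 : 0 < (2 - 5 / 4)^-1 :> R by rewrite invr_gt0; lra.
  have i2 : 0 < 2 + 5 / 4 :> R by lra.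
  exact: (mulr_gt0 (mulr_gt0 i2 (expR_gt0 _)) (addr_gt0 ltr01 i1)).
have c4 : 0 < 4 * c by rewrite mulr_gt0.
exists (4 * c + 1) => [|N N1]; first by lra.
have Np : 0 < N%:R :> R by rewrite ltr0n ltnW.
rewrite /Lmax -/c mulrCA lnM ?posrE//.
have B1 : 1 <= (bitlen N)%:R :> R by rewrite ler1n.
have l1 : ln (4 * c) <= 4 * c by have := expR_ge1Dx (ln (4 * c)); rewrite lnK ?posrE//; lra.
have l2 : ln N%:R <= (bitlen N)%:R :> R.
  apply: (@le_trans _ _ (ln (2 ^+ bitlen N))).
    by rewrite ler_ln ?posrE ?exprn_gt0// -natrX ler_nat ltnW// ltn_bitlen.
  rewrite lnXn// -[leLHS]mulr_natl ler_piMr//; have := expR_ge1Dx (ln 2 : R); rewrite lnK ?posrE//; lra.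
nra.
Qed.

(** Since K grows like log log N, the bound 2^(9 * 802 * K) is polynomial in log N. *)
Theorem ankeny : GRH R -> exists c0 : nat, forall (N : nat) (chi : nat -> R[i]),
  (1 < N)%N -> dirichlet_character N chi ->
  (exists2 a, coprime a N & chi a != 1) ->
  exists2 m, (0 < m < 2 ^ (9 * (802 * (4 * (c0 + bitlen (bitlen N))).*2)))%N & chi m != 1.
Proof.
move=> grh; have [C C0 HC] := ln_Lmax_le.
have [c0 Hc] : exists c0 : nat, 180 * C <= 2 ^+ c0.
  have [k hk] : exists k : nat, 180 * C <= k%:R.
    exists (Num.truncn (180 * C)).+1; apply: ltW; apply: truncnS_gt.
  by exists k; apply: le_trans hk _; rewrite -natrX ler_nat ltnW// ltn_expl.
exists c0 => N chi N1 chiP chi1; set B := bitlen N; set j := (c0 + bitlen B)%N.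
apply: (nontrivial_value grh N1 chiP chi1); first by rewrite /j /bitlen; lia.
have B0 : 0 <= B%:R :> R by [].
apply: (@le_trans _ _ (180 * (C * B%:R) * (9 / 10) ^+ (4 * j).*2)).
  by rewrite ler_wpM2r ?exprn_ge0// ler_wpM2l ?HC.
(* K = 8 j because (9/10)^8 <= 1/2. With j = c0 + [bitlen B], the power 2^j exceeds 180 C B, so the
   tail is at most 1. *)
have -> : (9 / 10) ^+ (4 * j).*2 = ((9 / 10) ^+ 8) ^+ j :> R.
  by rewrite -exprM; congr (_ ^+ _); lia.
have h8 : (9 / 10) ^+ 8 <= 2^-1 :> R.
  by lra.
apply: (@le_trans _ _ (180 * (C * B%:R) * 2^-1 ^+ j)).
  by rewrite ler_wpM2l ?mulr_ge0// lerXn2r ?nnegrE ?invr_ge0 ?exprn_ge0.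
rewrite exprVn ler_pdivrMr ?exprn_gt0// mul1r /j exprD mulrA ler_pM ?mulr_ge0//.
by rewrite -natrX ler_nat ltnW// ltn_bitlen.
Qed.

End AnkenyBound.

(** * Prime factors of m ^ n + 1 *)

Section FpArith.
Local Open Scope ring_scope.

Lemma Fp_nat_eq q a b : prime q -> (a = b %[mod q])%N -> a%:R = b%:R :> 'F_q.
Proof. by move=> qp ab; rewrite -(Fp_nat_mod qp a) ab Fp_nat_mod. Qed.

Lemma Fp_nat_eq0 q a : prime q -> (a%:R == 0 :> 'F_q) = (q %| a)%N.
Proof. by move=> qp; rewrite -(dvdn_pcharf (pchar_Fp qp)). Qed.

Lemma Fp_nat_inj q a b : prime q -> (a < q)%N -> (b < q)%N ->
  a%:R = b%:R :> 'F_q -> a = b.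
Proof.
move=> qp; wlog ab : a b / (a <= b)%N.
  move=> H aq bq E; case: (leqP a b) => [ab|/ltnW ba]; first exact: H.
  by apply/esym/H.
move=> aq bq E; have : (b - a)%:R == 0 :> 'F_q by rewrite natrB// E subrr.
rewrite Fp_nat_eq0// => /dvdn_leq; lia.
Qed.

Lemma Fp_fermat q (x : 'F_q) : prime q -> x != 0 -> x ^+ q.-1 = 1.
Proof.
move=> qp x0; apply: (mulfI x0); rewrite mulr1 -exprS prednK ?prime_gt0//.
by have := expf_card x; rewrite card_Fp.
Qed.

Lemma natr_prime_divisors_eq1 (A : pzSemiRingType) T : (0 < T)%N ->
  (forall r, prime r -> (r %| T)%N -> r%:R = 1 :> A) -> T%:R = 1 :> A.
Proof.
elim/ltn_ind: T => T IH T0 H; have [T1|T1] := leqP T 1.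
  by have -> : T = 1%N by lia.
have pp := pdiv_prime T1; have pT := pdiv_dvd T.
have p1 := prime_gt1 pp.
rewrite -(divnK pT) natrM (H _ pp pT) mulr1; apply: IH.
- by rewrite ltn_Pdiv.
- by rewrite divn_gt0 ?pdiv_gt0// dvdn_leq.
- by move=> r rp rT; apply: H => //; apply: dvdn_trans rT (dvdn_div pT).
Qed.

(** Raising m^e = -1 to an inverse u of e modulo r - 1 recovers m = (-1)^u. *)
Lemma prime_dvd_exp1 r m e : prime r -> (0 < e)%N -> (r %| m ^ e + 1)%N ->
  coprime e r.-1 -> (r %| m + 1)%N.
Proof.
move=> rp e0 re co; have r0 := prime_gt0 rp.
have E : (m%:R : 'F_r) ^+ e = -1.
  by apply/eqP; rewrite -subr_eq0 opprK -natrX natr1 Fp_nat_eq0// -addn1.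
have x0 : (m%:R : 'F_r) != 0.
  apply/eqP => E0; move/eqP: E.
  by rewrite E0 expr0n gtn_eqF// eq_sym oppr_eq0 oner_eq0.
case: (eqVneq r 2) => [r2|rn2].
  have : ~~ (r %| m)%N by rewrite -Fp_nat_eq0.
  rewrite r2 dvdn2 negbK => om.
  by rewrite dvdn2 addn1 /= om.
rewrite -Fp_nat_eq0// addn1 -natr1 addr_eq0; apply/eqP.
have rodd : odd r by have := even_prime rp; case: (odd r) => [//|[/eqP|//]]; rewrite (negPf rn2).
have [u [v uv]] : exists u v, (u * e = v * r.-1 + 1)%N.
  have [u v uv _] := egcdnP r.-1 e0; exists u, v; rewrite uv; congr (_ + _)%N.
  by apply/eqP; rewrite -/(coprime _ _).
(* r - 1 is even, hence u e is odd; this is where r = 2 had to be set apart. *)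
have uo : odd u.
  have : odd (u * e) by rewrite uv oddD oddM -subn1 oddB// rodd andbF.
  by rewrite oddM => /andP[].
have := Fp_fermat rp x0 => F.
have E2 : (m%:R : 'F_r) ^+ (v * r.-1 + 1) = m%:R.
  by rewrite addn1 exprSr mulnC exprM F expr1n mul1r.
by rewrite -[LHS]E2 -uv mulnC exprM E -signr_odd uo expr1.
Qed.

(** The cofactor is the alternating sum of the powers of m, with m^(2i+2) - m^(2i+1) grouped to
    avoid subtraction of larger terms. *)
Lemma exp_odd_succ m k : (0 < m)%N ->
  ((m + 1) * (1 + (m - 1) * m * \sum_(i < k) (m ^ 2) ^ i) = m ^ k.*2.+1 + 1)%N.
Proof.
move=> m0; have := predn_exp (m ^ 2) k; rewrite -expnM mul2n (expnS m k.*2).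
have : (0 < m ^ k.*2)%N by rewrite expn_gt0 m0.
move: (m ^ k.*2)%N (\sum_(i < k) _)%N => y s y0 Ey.
have {Ey} -> : y = ((m ^ 2).-1 * s + 1)%N by rewrite -Ey addn1 prednK.
case: m m0 => [//|m] _; rewrite -[(m.+1 ^ 2)%N]/(m.+1 * m.+1)%N.
have -> : (m.+1 * m.+1).-1 = (m * m.+2)%N by lia.
by rewrite subn1 /=; nia.
Qed.

Definition good p q m : bool :=
  [&& (1 < m)%N, ~~ (q %| m)%N, (m%:R : 'F_q) ^+ p.-1 != 1, ~~ (p %| m + 1)%N &
      all (fun r => r != 1 %[mod p])%N (primes (m + 1))].

Lemma good_factor p q m : prime p -> odd p -> prime q -> good p q m ->
  exists r, [/\ prime r, (r %| m ^ (p * q) + 1)%N &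
    r %% (p * q) \notin (1 %% (p * q) :: S_classes (p * q) m)]%N.
Proof.
move=> pp podd qp /and5P[m1 qm mp pm /allP Hall]; set n := (p * q)%N.
have qodd : odd q \/ q = 2 by case: (even_prime qp); [right|left].
pose k := p./2; have pE : p = k.*2.+1 by rewrite -[LHS]odd_double_half podd.
pose s := (\sum_(i < k) (m ^ 2) ^ i)%N; pose T := (1 + (m - 1) * m * s)%N.
have TE : ((m + 1) * T = m ^ p + 1)%N by rewrite pE -exp_odd_succ ?(ltnW m1).
have Tm r : prime r -> (r %| T)%N -> ~~ (r %| m + 1)%N.
  move=> rp rT; apply: contra pm => rm.
  have mE : m%:R = -1 :> 'F_r.
    by apply/eqP; rewrite -subr_eq0 opprK natr1 Fp_nat_eq0// -addn1.
  move: rT; rewrite -Fp_nat_eq0// /T /s natrD !natrM natrB ?(ltnW m1)// natr_sum mE.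
  under eq_bigr => i _ do rewrite !natrX mE sqrrN expr1n expr1n.
  rewrite sumr_const card_ord (_ : 1 + _ = (1 + k.*2)%:R); last first.
    by rewrite natrD -mul2n natrM; ring.
  (* Modulo a divisor of m + 1, T becomes p, so a common prime factor would be p itself. *)
  by rewrite Fp_nat_eq0// add1n -pE dvdn_prime2// => /eqP <-.
have T1p r : prime r -> (r %| T)%N -> (r = 1 %[mod p])%N.
  move=> rp rT; have r0 := prime_gt0 rp; apply/eqP; rewrite eqn_mod_dvd//.
  apply: contraT => npr; have := Tm r rp rT; case/negP.
  apply: (@prime_dvd_exp1 r m p) => //; first exact: prime_gt0.
    by rewrite -TE dvdn_mull.
  by rewrite prime_coprime// -subn1.
(* Otherwise T = 1 modulo q, so m^p + 1 = m + 1 there and m^(p-1) = 1. *)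
have [r rp /andP[rT rq]] : exists2 r, prime r & (r %| T)%N && (r%:R != 1 :> 'F_q).
  apply: contrapT => nH; have T1 : T%:R = 1 :> 'F_q.
    apply: natr_prime_divisors_eq1 => // r rp rT; apply/eqP; case: eqVneq => // h.
    by case: nH; exists r => //; rewrite rT.
  move/negP: mp; apply; have m0 : (m%:R : 'F_q) != 0 by rewrite Fp_nat_eq0.
  apply/eqP/(mulfI m0); rewrite mulr1 -exprS prednK ?prime_gt0//.
  apply: (addIr 1); have := congr1 (fun x => x%:R : 'F_q) TE.
  by rewrite natrM T1 mulr1 !natrD natrX.
exists r; split=> //.
  apply: (@dvdn_trans (m ^ p + 1)); first by rewrite -TE dvdn_mull.
  case: qodd => [qo|q2]; last first.
    exfalso; move: rq; rewrite q2.
    have r0 := prime_gt0 rp; have r2 : odd r.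
      apply: contraT => re; have r2 : r = 2 by case: (even_prime rp) => [//|h]; rewrite h in re.
      have := T1p r rp rT; rewrite r2; have := prime_gt1 pp => p1.
      rewrite pE in p1 *; case: (k) p1 => [//|k'] _; rewrite !modn_small//; lia.
    have h : r%:R = 1 :> 'F_2 by apply: (@Fp_nat_eq 2 r 1); rewrite // modn2 r2.
    by move/eqP; apply.
  rewrite /n expnM; set x := (m ^ p)%N.
  have x0 : (0 < x)%N by rewrite expn_gt0 (ltnW m1).
  by rewrite -[q]odd_double_half qo add1n -exp_odd_succ// dvdn_mulr.
rewrite inE negb_or; apply/andP; split.
  apply: contra rq => /eqP E; rewrite (@Fp_nat_eq q r 1)//.
  by rewrite -(modn_dvdm r (dvdn_mull p (dvdnn q))) E modn_dvdm// dvdn_mull.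
apply/negP => /mapP[r0 r0m E]; have /negP := Hall r0 r0m; apply; apply/eqP.
rewrite -(T1p r rp rT) -(modn_dvdm r0 (dvdn_mulr q (dvdnn p))) -E modn_dvdm//.
exact: dvdn_mulr.
Qed.

Lemma good_small p q : prime p -> odd p -> prime q -> (p < q)%N ->
  exists2 m, (m <= p)%N & good p q m.
Proof.
move=> pp podd qp pq; have p1 := prime_gt1 pp.
have p3 : (2 < p)%N by case: (ltngtP p 2) podd p1 => // ->.
have qodd : odd q by have := even_prime qp; case: (odd q) => [//|[|//]]; lia.
(* The p - 1 candidates together with q - 1 = -1 would be p distinct roots of X^(p-1) - 1, one too
   many. The number p - 1 is left out because p divides (p - 1) + 1; distinctness uses q >= p +
   2. *)
pose ms := rcons (iota 1 (p - 2)) p.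
have E1 : all (fun i => i < q.-1)%N ms.
  apply/allP => i; rewrite mem_rcons inE mem_iota => /orP[/eqP ->|]; last lia.
  by case: (ltngtP p q.-1) => // h; move: podd qodd; [lia|]; rewrite h; case: (q) pq => //= q' _ ->.
have ums : uniq (rcons ms q.-1).
  rewrite rcons_uniq rcons_uniq iota_uniq mem_iota andbT; apply/andP; split.
    by apply/negP => /(allP E1); rewrite ltnn.
  by apply/negP; lia.
have [/allP Hall|/allPn[m mms mp]] := boolP (all (fun m => (m%:R : 'F_q) ^+ p.-1 == 1) ms).
  exfalso; pose rs : seq 'F_q := [seq i%:R | i <- rcons ms q.-1].
  have qm1 : (q.-1)%:R = -1 :> 'F_q.
    apply/eqP; rewrite -subr_eq0 opprK natr1 prednK ?prime_gt0// Fp_nat_eq0//.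
  have ur : all p.-1.-unity_root rs.
    apply/allP => x /mapP[i ims ->]; apply/unity_rootP.
    move: ims; rewrite mem_rcons inE => /orP[/eqP ->|/Hall/eqP//].
    by rewrite qm1 -signr_odd -subn1 oddB ?(ltnW p1)// podd expr0.
  have us : uniq rs.
    rewrite map_inj_in_uniq// => i j.
    have small l : l \in rcons ms q.-1 -> (l < q)%N.
      rewrite mem_rcons inE => /orP[/eqP ->|/(allP E1)]; have := prime_gt0 qp; lia.
    by move=> /small hi /small hj; exact: Fp_nat_inj.
  have := max_unity_roots _ ur us; rewrite size_map !size_rcons size_iota; lia.
have m1 : m != 1%N by apply: contra mp => /eqP ->; rewrite expr1n.
have [m2 mle mp1] : [/\ 1 < m, m <= p & m != p.-1]%N.
  move: mms; rewrite mem_rcons inE mem_iota => /orP[/eqP ->|h]; split; lia.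
exists m => //; apply/and5P; split=> //.
- by apply/negP => /dvdn_leq; lia.
- apply/negP => /dvdnP[[|[|j]]]; [lia|lia|nia].
(* A prime r <= p + 1 with r = 1 modulo p would be p + 1, which is even and larger than 2. *)
- apply/allP => r; rewrite mem_primes => /and3P[rp _ /dvdn_leq rm].
  apply/negP => /eqP E; have r1 := prime_gt1 rp.
  have : (p %| r - 1)%N by rewrite -eqn_mod_dvd ?(ltnW r1)//; apply/eqP.
  clear - podd rp r1 rm p1 mle; case/dvdnP => -[|[|j]] Ej; [lia| |nia].
  have rE : r = p.+1 by lia.
  by have := even_prime rp; rewrite rE /= podd => -[|//]; lia.
Qed.

End FpArith.

(** * Characters detecting powers, and the existence of a small [m] *)

Section PowerCharacter.
Local Open Scope ring_scope.
Local Open Scope complex_scope.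
Variable R : realType.

(** [psi] sends a generator of the units modulo q to a primitive (q - 1)-th root of unity, through
    the discrete logarithm. Its e-th power is 1 wherever a^e = 1, and is nonprincipal as e < q -
    1. *)
Lemma power_character q e : prime q -> (0 < e < q.-1)%N ->
  exists2 chi : nat -> R[i], dirichlet_character q chi &
    (exists2 a, coprime a q & chi a != 1) /\
    (forall a, (a%:R : 'F_q) ^+ e = 1 -> chi a = 1).
Proof.
move=> qp /andP[e0 eq1]; have q10 : (0 < q.-1)%N by apply: ltn_trans eq1.
have [g gP] : exists g : 'F_q, q.-1.-primitive_root g.
  pose rs := [seq x <- enum 'F_q | x != 0].
  have := @has_prim_root _ q.-1 rs q10.
  have -> : all q.-1.-unity_root rs.
    apply/allP => x; rewrite mem_filter => /andP[x0 _]; apply/unity_rootP.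
    exact: Fp_fermat.
  rewrite filter_uniq ?enum_uniq// size_filter.
  have -> : (q.-1 <= count (fun x : 'F_q => x != 0%R) (enum 'F_q))%N.
    have := count_predC (pred1 (0%R : 'F_q)) (enum 'F_q).
    rewrite (@eq_count _ (predC (pred1 (0%R : 'F_q))) (fun x : 'F_q => x != 0))//.
    rewrite count_uniq_mem ?enum_uniq// mem_enum -cardE card_Fp//; lia.
  by move=> /(_ isT isT isT) /hasP[g _ gP]; exists g.
have [z zP] := prim_root_ex R q10.
pose psi a : R[i] := if [pick i : 'I_q.-1 | a%:R == g ^+ i :> 'F_q] is Some i then z ^+ i else 0.
have g0 i : g ^+ i != 0.
  rewrite expf_eq0 negb_and; apply/orP; right; apply/eqP => g00.
  by have := prim_expr_order gP; rewrite g00 expr0n gtn_eqF.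
have psiE a i : a%:R = g ^+ i :> 'F_q -> psi a = z ^+ i.
  move=> E; rewrite /psi; case: pickP => [j /eqP Ej|/(_ (Ordinal (ltn_pmod i q10)))]; last first.
    by rewrite /= prim_expr_mod// E eqxx.
  apply/eqP; rewrite (eq_prim_root_expr zP) -(eq_prim_root_expr gP).
  by rewrite -Ej -E.
have psi0 a : (q %| a)%N -> psi a = 0.
  rewrite -Fp_nat_eq0// => /eqP E; rewrite /psi; case: pickP => // j; rewrite E eq_sym => /eqP h.
  by have := g0 j; rewrite h eqxx.
have dlog a : ~~ (q %| a)%N -> exists i, a%:R = g ^+ i :> 'F_q.
  rewrite -Fp_nat_eq0// => a0; have [i ->] := prim_rootP gP (Fp_fermat qp a0).
  by exists i.
have coE a : coprime a q = ~~ (q %| a)%N by rewrite coprime_sym prime_coprime.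
have z0 i : z ^+ i != 0.
  rewrite expf_eq0 negb_and; apply/orP; right; apply/eqP => z00.
  have := prim_expr_order zP; rewrite z00 expr0n gtn_eqF// mulr0n => h.
  by have := oner_neq0 R[i]; rewrite -h eqxx.
exists (fun a => psi a ^+ e); split.
- by rewrite (@psiE 1 0)// expr0 expr1n.
- move=> a b; rewrite -exprMn; congr (_ ^+ _).
  have [qa|/dlog[i Ei]] := boolP (q %| a)%N.
    by rewrite (psi0 a qa) (psi0 _ (dvdn_mulr b qa)) mul0r.
  have [qb|/dlog[j Ej]] := boolP (q %| b)%N.
    by rewrite (psi0 b qb) (psi0 _ (dvdn_mull a qb)) mulr0.
  by rewrite (psiE _ _ Ei) (psiE _ _ Ej) -exprD; apply: psiE; rewrite natrM Ei Ej exprD.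
- move=> a; congr (_ ^+ _); rewrite /psi.
  by have -> : (a + q)%:R = a%:R :> 'F_q by apply: Fp_nat_eq; rewrite // modnDr.
- move=> a; rewrite expf_eq0 e0 /= coE.
  have [qa|/dlog[i Ei]] := boolP (q %| a)%N.
    by rewrite psi0// eqxx.
  by rewrite (psiE _ _ Ei) z0.
- exists (g : nat).
    by rewrite coE -Fp_nat_eq0// natr_Zp; have := g0 1%N; rewrite expr1.
  rewrite (@psiE _ 1) ?natr_Zp// expr1 -(prim_order_dvd zP).
  by apply/negP => /dvdn_leq; lia.
- move=> a ae1; have a0 : ~~ (q %| a)%N.
    rewrite -Fp_nat_eq0//; apply/eqP => E; move/eqP: ae1.
    by rewrite E expr0n gtn_eqF// eq_sym oner_eq0.
  have [i Ei] := dlog a a0; rewrite (psiE _ _ Ei) -exprM; apply/eqP.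
  by rewrite -(prim_order_dvd zP) (prim_order_dvd gP) exprM -Ei ae1.
Qed.

(** The bound X of [ankeny] also serves as the threshold between small and large p. If p > X, the m
    found satisfies m + 1 < p < q, and all conditions of [good] but the power one hold for reasons
    of size. *)
Lemma good_exists : GRH R -> exists c0 : nat, forall p q,
  prime p -> odd p -> prime q -> (p < q)%N ->
  exists2 m, (m <= 2 ^ (9 * (802 * (4 * (c0 + bitlen (bitlen q))).*2)))%N & good p q m.
Proof.
move=> /ankeny[c0 H]; exists c0 => p q pp podd qp pq.
move: (H q); set X := (2 ^ _)%N => {}H.
have [pX|Xp] := leqP p X.
  by have [m mp gm] := good_small pp podd qp pq; exists m => //; apply: leq_trans pX.
have p1 := prime_gt1 pp.
have p10 : (0 < p.-1 < q.-1)%N by lia.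
have [chi chiP [nt tr]] := power_character qp p10.
have [m /andP[m0 mX] cm] := H chi (prime_gt1 qp) chiP nt.
exists m; first exact: ltnW.
have m1 : m != 1%N by apply: contra cm => /eqP ->; rewrite tr// expr1n.
apply/and5P; split=> //.
- lia.
- by apply/negP => /dvdn_leq; lia.
- by apply: contra cm => /eqP /tr ->.
- by apply/negP => /dvdn_leq; lia.
apply/allP => r; rewrite mem_primes => /and3P[rp _ /dvdn_leq rm].
have r1 := prime_gt1 rp; rewrite !modn_small; lia.
Qed.

End PowerCharacter.

(** * Execution and its cost *)

Section Exec.
Local Open Scope nat_scope.
Variable O : oracle.

(** Total correctness with a time budget; budgets are only upper bounds, so that they compose by
    addition. *)
Definition exec c st (T : nat) (P : state -> Prop) : Prop :=
  exists st' t, [/\ run O c st st' t, t <= T & P st'].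

Lemma exec_weaken c st T T' (P P' : state -> Prop) : T <= T' ->
  (forall st', P st' -> P' st') -> exec c st T P -> exec c st T' P'.
Proof.
move=> TT PP [st' [t [rt tT Pst]]]; exists st', t.
by split=> //; [exact: leq_trans TT|exact: PP].
Qed.

Lemma exec_skip st T (P : state -> Prop) : 0 < T -> P st -> exec Skip st T P.
Proof. by move=> T0 Pst; exists st, 1; split=> //; constructor. Qed.

Lemma exec_set st x e T (P : state -> Prop) : cost_expr st e < T ->
  P (update st x (val_expr st e)) -> exec (Assign x e) st T P.
Proof. by move=> cT Pst; do 2!eexists; split; [exact: run_set|exact: cT|]. Qed.

Lemma exec_ask st e1 e2 T (P : state -> Prop) :
  let st' := query O (val_expr st e1) (val_expr st e2) st in
  cost_expr st e1 + cost_expr st e2 + list_cost (answer st') <= T ->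
  P st' -> exec (Ask e1 e2) st T P.
Proof. by move=> st' cT Pst; do 2!eexists; split; [exact: run_ask|exact: cT|]. Qed.

Lemma exec_seq c1 c2 st T1 T2 T (P1 P : state -> Prop) : T1 + T2 <= T ->
  exec c1 st T1 P1 -> (forall st1, P1 st1 -> exec c2 st1 T2 P) ->
  exec (Seq c1 c2) st T P.
Proof.
move=> TT [st1 [t1 [r1 l1 h1]]] /(_ _ h1)[st2 [t2 [r2 l2 h2]]].
exists st2, (t1 + t2); split=> //; first exact: run_seq r1 r2.
exact: leq_trans (leq_add l1 l2) TT.
Qed.

Lemma exec_if st e c1 c2 C T T' (P : state -> Prop) : C + T <= T' ->
  cost_expr st e <= C -> exec (if val_expr st e != 0 then c1 else c2) st T P ->
  exec (If e c1 c2) st T' P.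
Proof.
move=> TT cC [st1 [t1 [r1 l1 h1]]]; exists st1, (cost_expr st e + t1).
by split=> //; [exact: run_if|exact: leq_trans (leq_add cC l1) TT].
Qed.

(** The index [k] of the invariant bounds the number of remaining iterations and drops by one in
    each. *)
Lemma exec_while (I : nat -> state -> Prop) e c C T K T' (P : state -> Prop) :
  (forall k st, I k st -> cost_expr st e <= C /\
     (val_expr st e = 0 /\ P st \/
      exists k', [/\ k = k'.+1, val_expr st e != 0 & exec c st T (I k')])) ->
  C + K * (C + T) <= T' ->
  forall k st, k <= K -> I k st -> exec (While e c) st T' P.
Proof.
move=> HI KT k st kK Ik.
apply: (@exec_weaken _ _ (C + k * (C + T)) _ P) => //.
  by apply: leq_trans KT; rewrite leq_add2l leq_mul2r kK orbT.
elim: k {kK} st Ik => [|k IH] st /HI[cC [[v0 Pst]|[k' [kk' v0 ex]]]]; last 1 first.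
- case: kk' ex => <- [st1 [t1 [r1 l1 h1]]].
  have [st2 [t2 [r2 l2 h2]]] := IH _ h1.
  exists st2, (cost_expr st e + t1 + t2); split=> //; first exact: run_while_loop r1 r2.
  by rewrite mulSn; lia.
- by exists st, (cost_expr st e); split=> //; [exact: run_while_stop|lia].
- by [].
- by exists st, (cost_expr st e); split=> //; [exact: run_while_stop|lia].
Qed.

End Exec.

(** * Cost of expressions *)

Section Cost.
Local Open Scope nat_scope.

Lemma bitlen_gt0 k : 0 < bitlen k. Proof. by []. Qed.

Lemma leq_bitlen a b : a <= b -> bitlen a <= bitlen b.
Proof. by move=> ab; rewrite /bitlen ltnS; exact: leq_trunc_log. Qed.

Lemma bitlen_leS k : bitlen k <= k.+1.
Proof.
rewrite /bitlen ltnS; case: k => [|k]; first by rewrite trunc_log0.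
apply: leq_trans (_ : 2 ^ trunc_log 2 k.+1 <= _); first by rewrite ltnW// ltn_expl.
by rewrite trunc_logP.
Qed.

Lemma bitlenD a b : bitlen (a + b) <= bitlen a + bitlen b.
Proof.
rewrite -(@leq_exp2l 2)//.
have : 2 ^ trunc_log 2 (a + b) <= maxn 1 (a + b).
  case: (posnP (a + b)) => [->|h]; first by rewrite trunc_log0.
  exact: leq_trans (@trunc_logP 2 (a + b) isT h) (leq_maxr _ _).
rewrite [bitlen (a + b)]/bitlen expnS expnD.
have := ltn_bitlen a; have := ltn_bitlen b.
have := bitlen_gt0 a; have := bitlen_gt0 b.
case: (bitlen a) => // i; case: (bitlen b) => // j _ _; rewrite !expnS.
have : 0 < 2 ^ i by rewrite expn_gt0.
have : 0 < 2 ^ j by rewrite expn_gt0.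
by move: (2 ^ i) (2 ^ j) (2 ^ _) => x y z; nia.
Qed.

Fixpoint esize (e : expr) : nat :=
  match e with
  | Bin _ a b => (esize a + esize b).+1
  | Ans a => (esize a).+1
  | _ => 1
  end.

(** All subexpressions are bounded, since the cost of an operation depends on its operands and not
    only on its result. *)
Fixpoint fits (V : nat) (st : state) (e : expr) : bool :=
  (val_expr st e <= V) &&
  match e with
  | Bin _ a b => fits V st a && fits V st b
  | Ans a => fits V st a
  | _ => true
  end.

Lemma fits_val V st e : fits V st e -> val_expr st e <= V.
Proof. by case: e => [?|?|? ? ?|?|] /andP[]. Qed.

Lemma cost_expr_le V L st e : bitlen V ^ 2 <= L -> list_cost (answer st) <= L ->
  fits V st e -> cost_expr st e <= esize e * L.
Proof.
move=> VL AL; have BL : bitlen V <= L.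
  by apply: leq_trans VL; rewrite -mulnn leq_pmulr.
elim: e => [k|x|o a IHa b IHb|a IHa|] /andP[hv].
- by move=> _; rewrite mul1n (leq_trans (leq_bitlen hv)).
- by move=> _; rewrite mul1n (leq_trans (leq_bitlen hv)).
- case/andP => ha hb; rewrite /= mulSn mulnDl addnC leq_add//; last first.
    by rewrite leq_add ?IHa ?IHb.
  by apply: leq_trans VL; rewrite -mulnn leq_mul// leq_bitlen// fits_val.
- by move=> ha; rewrite /= mulSn addnC leq_add ?IHa.
- by move=> _; rewrite mul1n (leq_trans _ BL).
Qed.

End Cost.

(** * Correctness and running time of the phases of the algorithm *)

Section Algorithm.
Local Open Scope nat_scope.
Variables (O : oracle) (n V L S Y : nat).
Hypotheses (n1 : 1 < n) (nV : n <= V) (YV : Y + 3 <= V) (SV : S < V)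
  (VL : bitlen V ^ 2 <= L)
  (HS : forall m, 1 < m <= Y -> size (odflt [::] (O (Defs.code n) m)) <= S)
  (HL : forall m, 1 < m <= Y -> list_cost (odflt [::] (O (Defs.code n) m)) <= L)
  (Hn : forall m, 1 < m <= Y -> all (fun x => x < n) (odflt [::] (O (Defs.code n) m))).

(** Every expression of the program has at most 7 nodes of cost at most [L] each; the strict
    inequality below pays for the extra unit of an assignment. *)
Let U := 8 * L.

Lemma L_gt0 : 0 < L.
Proof. by apply: leq_trans VL; rewrite expn_gt0. Qed.

Lemma expr_cost st e : list_cost (answer st) <= L -> fits V st e -> esize e < 8 ->
  cost_expr st e < U.
Proof.
move=> lL fe e8; apply: leq_ltn_trans (cost_expr_le VL lL fe) _.
by rewrite /U ltn_pmul2r ?L_gt0.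
Qed.

Lemma find_m_exec st m0 : reg st Reg.n = n -> answer st = [::] ->
  1 < m0 <= Y -> O (Defs.code n) m0 <> None ->
  exec O find_m st (U + (U + (U + Y * (U + (U + U)))))
    (fun st' => exists2 m, 1 < m <= Y & exists2 A, O (Defs.code n) m = Some A &
       [/\ reg st' Reg.n = n, reg st' Reg.m = m & ans st' = Some A]).
Proof.
move=> stn sta /andP[m01 m0Y] Om0.
have lc0 : list_cost (answer st) <= L by rewrite sta /list_cost big_nil L_gt0.
have L0 := L_gt0.
pose I k st := [/\ reg st Reg.n = n, 1 < reg st Reg.m <= m0,
  k = m0 - reg st Reg.m & ans st = O (Defs.code n) (reg st Reg.m)].
have lcI k st' : I k st' -> list_cost (answer st') <= L.
  case=> _ /andP[m1 mm] _; rewrite /answer => ->; apply: HL; lia.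
apply: (exec_seq (P1 :=
    fun s => [/\ reg s Reg.n = n, reg s Reg.m = 2 & answer s = [::]]) (leqnn _)).
  by apply: exec_set => //; apply: expr_cost => //=; lia.
move=> s1 [s1n s1m s1a]; apply: (exec_seq (P1 := I (m0 - 2)) (leqnn _)).
  have lc1 : list_cost (answer s1) <= L by rewrite s1a /list_cost big_nil.
  have c1 := @cost_expr_le V L s1 (Var Reg.n) VL lc1 ltac:(by rewrite /= s1n; lia).
  have c2 := @cost_expr_le V L s1 (Var Reg.m) VL lc1 ltac:(by rewrite /= s1m; lia).
  have c3 := HL (m := 2) ltac:(by lia).
  apply: exec_ask; rewrite /= s1n s1m.
    by move: c1 c2; rewrite /= s1n s1m /answer /= /U; lia.
  by split=> //=; rewrite ?s1m//; lia.
move=> s2 Is2; apply: (exec_while (I := I) _ (leqnn _) (k := m0 - 2)) Is2 => [k s|]; last by lia.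
move=> Iks; have lcs := lcI _ _ Iks; case: Iks => sn sm sk sa; split.
  by apply/ltnW/expr_cost => //=; case: (ans s == None) => /=; lia.
case E : (ans s) => [A|]; [left|right]; rewrite /= E.
  split=> //; exists (reg s Reg.m); first by lia.
  by exists A; rewrite -?sa ?E.
have mm0 : reg s Reg.m < m0.
  rewrite ltn_neqAle; case/andP: (sm) => _ ->; rewrite andbT; apply/eqP => h.
  by apply: Om0; rewrite -h -sa E.
exists k.-1; split=> //; first by lia.
apply: (exec_seq (P1 :=
    fun s' => [/\ reg s' Reg.n = n, reg s' Reg.m = (reg s Reg.m).+1 & list_cost (answer s') <= L]) (leqnn _)).
  apply: exec_set; first by apply: expr_cost => //=; lia.
  by split=> //=; rewrite addn1.
move=> s3 [s3n s3m s3a].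
have c1 := @cost_expr_le V L s3 (Var Reg.n) VL s3a ltac:(by rewrite /= s3n; lia).
have c2 := @cost_expr_le V L s3 (Var Reg.m) VL s3a ltac:(by rewrite /= s3m; lia).
have c3 := HL (m := (reg s Reg.m).+1) ltac:(by lia).
apply: exec_ask; rewrite /= s3n s3m.
  by move: c1 c2; rewrite /= s3n s3m /answer /= /U; lia.
by split=> //=; rewrite ?s3m//; lia.
Qed.

Section Test.
Variables (m x : nat).
Hypotheses (mY : 1 < m <= Y) (xn : x < n).

Definition frame i (A : option (seq nat)) (s : state) :=
  [/\ reg s Reg.n = n, reg s Reg.m = m, reg s Reg.r = x, reg s Reg.i = i & ans s = A].

(** Invariant of the outer loop of [test_r]: the classes that have been compared once all candidates
    below [j] are done. *)
Definition classes_below j := 1 %% n :: [seq r %% n | r <- primes (m + 1) & r < j].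

Lemma classes_belowS j : x \in classes_below j.+1 =
  (x \in classes_below j) || [&& prime j, j %| m + 1 & x == j %% n].
Proof.
rewrite !inE -orbA; congr orb; apply/mapP/orP.
  case=> r; rewrite mem_filter ltnS leq_eqVlt andb_orl => /orP[/andP[/eqP -> jp]|rj] xr.
    by right; move: jp; rewrite mem_primes xr eqxx => /and3P[-> _ ->].
  by left; apply/mapP; exists r; rewrite ?mem_filter.
case=> [/mapP[r]|/and3P[jp jm /eqP xj]].
  by rewrite mem_filter => /andP[rj rp] xr; exists r; rewrite // mem_filter ltnS ltnW.
by exists j => //; rewrite mem_filter ltnSn mem_primes jp jm addn1.
Qed.

Lemma test_r_exec st i A : list_cost (odflt [::] A) <= L -> frame i A st ->
  exec O test_r st (U + (U + (U + Y * (U + (U + ((U + Y * (U + U)) + ((U + (U + (U + U))) + U)))))))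
    (fun s => frame i A s /\ (reg s Reg.bad = (x \in 1 %% n :: S_classes n m))).
Proof.
move=> lA fst; have L0 := L_gt0.
have lc s : frame i A s -> list_cost (answer s) <= L by case=> _ _ _ _; rewrite /answer => ->.
have U0 : 0 < U by rewrite /U; lia.
pose I k s := [/\ frame i A s, 1 < reg s Reg.s <= m + 2, k = m + 2 - reg s Reg.s &
  reg s Reg.bad = (x \in classes_below (reg s Reg.s))].
apply: (exec_seq (P1 := fun s => frame i A s /\ reg s Reg.bad = (x == 1 %% n)) (leqnn _)).
  case: (fst) => h1 h2 h3 h4 h5; apply: exec_set.
    apply: expr_cost; rewrite /= ?lc// h1 h3; have := leq_mod 1 n; case: eqP => /=; lia.
  by split; [split|rewrite /= h1 h3].
move=> s1 [fs1 b1]; apply: (exec_seq (P1 := I m) (leqnn _)).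
  apply: exec_set; first by apply: expr_cost; rewrite /= ?lc//; lia.
  case: fs1 => h1 h2 h3 h4 h5; split=> //=; [lia|lia|].
  rewrite b1 inE (_ : [seq _ | r <- _ & _] = [::]) ?orbF//.
  rewrite (eq_in_filter (a2 := pred0)) ?filter_pred0// => r.
  by rewrite mem_primes => /andP[/prime_gt1 r1 _]; apply/negbTE; rewrite -leqNgt.
move=> s2 Is2.
have km : m <= Y by lia.
apply: (exec_while (I := I) _ (leqnn _) (k := m)) km Is2 => k s Iks.
case: (Iks) => fs ss sk sb; have lcs := lc _ fs; case: (fs) => h1 h2 h3 h4 h5; split.
  by apply/ltnW/expr_cost; rewrite //= h2; case: (_ < _) => /=; lia.
rewrite /= h2; case: ltnP => ms; [right|left]; last first.
  split=> //; split=> //; rewrite sb; have -> : reg s Reg.s = m + 2 by lia.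
  congr (nat_of_bool (x \in _ :: _)); rewrite /S_classes (eq_in_filter (a2 := predT)) ?filter_predT// => r.
  rewrite mem_primes => /and3P[_ m0 /(dvdn_leq m0) rm].
  by have -> : r < m + 2 by apply: leq_ltn_trans rm _; rewrite addn2 addn1.
exists k.-1; split=> //; first by lia.
set j := reg s Reg.s in ss sk sb ms.
(* Trial division: no d with 1 < d < t divides j, so the first t that divides j is its least
   divisor. *)
pose G t s' := [/\ frame i A s', reg s' Reg.s = j, reg s' Reg.bad = (x \in classes_below j) &
  1 < reg s' Reg.t <= j /\ (t = j - reg s' Reg.t /\ forall d, 1 < d < reg s' Reg.t -> ~~ (d %| j))].
apply: (exec_seq (P1 := G (j - 2)) (leqnn _)).
  apply: exec_set; first by apply: expr_cost; rewrite //=; lia.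
  by split=> //=; split; [lia|split=> // d; lia].
move=> s3 G3; apply: (exec_seq (P1 := fun s' => [/\ frame i A s', reg s' Reg.s = j,
   reg s' Reg.bad = (x \in classes_below j), reg s' Reg.t <= j & (reg s' Reg.t == j) = prime j]) (leqnn _)).
  apply: (exec_while (I := G) _ (leqnn _) (k := j - 2)) G3 => [t s4|]; last by lia.
  case=> f4 s4s s4b [s4t [tE Ht]]; have lc4 := lc _ f4; split.
    apply/ltnW/expr_cost; rewrite //= s4s.
    by have := leq_mod j (reg s4 Reg.t); lia.
  rewrite /= s4s; case: (eqVneq (j %% reg s4 Reg.t) 0) => jt; [left|right].
    split=> //; split=> //; first by lia.
    apply/eqP/idP => [tj|jp].
      apply/primeP; split=> [|d dj]; first by lia.
      have d0 : 0 < d by apply: dvdn_gt0 dj; lia.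
      have dlej : d <= j by apply: dvdn_leq dj; lia.
      have [d1|d1] := leqP d 1; first by apply/orP; left; lia.
      case: (ltngtP d j) dlej => // [dltj|->] _; last by rewrite orbT.
      by have := Ht d ltac:(by rewrite tj d1); rewrite dj.
    have tj : reg s4 Reg.t %| j by apply/eqP.
    have := primeP jp => -[_ /(_ _ tj)]; lia.
  exists t.-1; have tj : reg s4 Reg.t < j.
    rewrite ltn_neqAle; case/andP: s4t => _ ->; rewrite andbT; apply/eqP => h.
    by move: jt; rewrite h modnn.
  split=> //; first by lia.
  apply: exec_set; first by apply: expr_cost; rewrite //=; lia.
  case: f4 => g1 g2 g3 g4 g5; split=> //=; split; first by lia.
  split; first by lia.
  move=> d hd; case: (eqVneq d (reg s4 Reg.t)) => [->|dt]; last by apply: Ht; lia.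
  exact: jt.
move=> s5 [f5 s5s s5b s5t s5p].
apply: (exec_seq (P1 := fun s' => [/\ frame i A s', reg s' Reg.s = j &
   reg s' Reg.bad = (x \in classes_below j.+1)]) (leqnn _)).
  have lc5 := lc _ f5; case: (f5) => g1 g2 g3 g4 g5.
  apply: (@exec_if _ _ _ _ _ U (U + (U + U))) => //.
    apply/ltnW/expr_cost; rewrite //= s5s; case: (_ == _) => /=; lia.
  rewrite /= s5s s5p classes_belowS.
  case jp : (prime j); last first.
    by apply: exec_skip; [lia|split=> //; rewrite s5b orbF].
  apply: (@exec_if _ _ _ _ _ U (U + U)) => //.
    apply/ltnW/expr_cost; rewrite //= s5s g2.
    by have := leq_mod (m + 1) j; case: (_ == _) => /=; lia.
  rewrite /= s5s g2 -/(dvdn _ _).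
  case jm : (j %| m + 1); last first.
    by apply: exec_skip; [lia|split=> //; rewrite s5b orbF].
  apply: (@exec_if _ _ _ _ _ U U) => //.
    apply/ltnW/expr_cost; rewrite //= s5s g1 g3.
    by have := leq_mod j n; case: (_ == _) => /=; lia.
  rewrite /= s5s g1 g3; case xj : (x == j %% n); last first.
    by apply: exec_skip; [lia|split=> //; rewrite s5b orbF].
  apply: exec_set; first by apply: expr_cost; rewrite //=; lia.
  by split=> //=; rewrite orbT.
move=> s6 [f6 s6s s6b]; have lc6 := lc _ f6; case: (f6) => g1 g2 g3 g4 g5.
apply: exec_set; first by apply: expr_cost; rewrite //= s6s; lia.
by split=> //=; rewrite s6s ?addn1//; lia.
Qed.

End Test.

Lemma find_r_exec st m A : 1 < m <= Y -> O (Defs.code n) m = Some A ->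
  ~ {subset A <= 1 %% n :: S_classes n m} ->
  reg st Reg.n = n -> reg st Reg.m = m -> ans st = Some A ->
  exec O find_r st (U + (U + (U + S * (U + (U + ((U + (U + (U + Y * (U + (U + ((U + Y * (U + U)) + ((U + (U + (U + U))) + U))))))) + U))))))
    (fun s => [/\ reg s Reg.n = n, reg s Reg.r \in A, reg s Reg.r \notin 1 %% n :: S_classes n m & list_cost (answer s) <= L]).
Proof.
move=> mY OA nsub stn stm sta; have L0 := L_gt0.
have := HS mY; have := HL mY; have := Hn mY; rewrite OA /= => An AL AS.
set B := 1 %% n :: S_classes n m in nsub *.
have [x0 x0A x0B] : exists2 x, x \in A & x \notin B.
  have /allPn[x xA xB] : ~~ all (fun x => x \in B) A by apply/negP => /allP.
  by exists x.
pose I k s := [/\ reg s Reg.n = n, reg s Reg.m = m, ans s = Some A,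
  reg s Reg.i <= size A & k = size A - reg s Reg.i /\
  ((reg s Reg.bad = 1 /\ forall l, l < reg s Reg.i -> nth 0 A l \in B) \/
   [/\ reg s Reg.bad = 0, reg s Reg.r \in A & reg s Reg.r \notin B])].
have lc s : ans s = Some A -> list_cost (answer s) <= L by rewrite /answer => ->.
apply: (exec_seq (P1 :=
    fun s => [/\ reg s Reg.n = n, reg s Reg.m = m, ans s = Some A & reg s Reg.i = 0]) (leqnn _)).
  by apply: exec_set; first by apply: expr_cost; rewrite //= ?lc.
move=> s1 [s1n s1m s1a s1i]; apply: (exec_seq (P1 := I (size A)) (leqnn _)).
  apply: exec_set; first by apply: expr_cost; rewrite //= ?lc//; lia.
  by split=> //=; rewrite s1i// subn0; split=> //; left.
move=> s2 Is2; apply: (exec_while (I := I) _ (leqnn _) (k := size A)) (AS) Is2 => k s.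
case=> sn sm sa si [sk sb]; have lcs := lc _ sa; split.
  by apply/ltnW/expr_cost; rewrite //=; case: sb => -[->]; lia.
case: sb => [[sb Hl]|[sb rA rB]]; [right|left]; rewrite /= sb//.
(* If the index ran past the list, all of [A] would lie in [B], against the choice of [x0]. *)
have iA : reg s Reg.i < size A.
  rewrite ltnNge; apply/negP => h; move/negP: x0B; apply.
  by rewrite -(nth_index 0 x0A); apply: Hl; apply: leq_trans h; rewrite index_mem.
exists k.-1; split=> //; first by lia.
set i := reg s Reg.i in si sk Hl iA; pose x := nth 0 A i.
have xA : x \in A by exact: mem_nth.
have xn : x < n by move/allP: An; exact.
apply: (exec_seq (P1 := frame m x i (Some A)) (leqnn _)).
  apply: exec_set; last by split=> //=; rewrite /answer sa.
  have aE : answer s = A by rewrite /answer sa.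
  have xV : nth 0 A (reg s Reg.i) <= V by exact: leq_trans (ltnW xn) nV.
  have iV : reg s Reg.i <= V by rewrite -/i; lia.
  by apply: expr_cost => //=; rewrite aE xV iV.
move=> s3 fs3; apply: (exec_seq (leqnn _) (test_r_exec mY xn _ fs3)); first exact: AL.
move=> s4 [[g1 g2 g3 g4 g5] b4]; apply: exec_set.
  by apply: expr_cost; rewrite //= ?lc// g4; lia.
split=> //=; rewrite g4 ?addn1//; split; first by lia.
rewrite b4 -/B; case xB : (x \in B); [left|right]; split=> //; rewrite ?g3 ?xB// => l.
by rewrite ltnS leq_eqVlt => /orP[/eqP ->|/Hl].
Qed.

Lemma compute_d_exec st : reg st Reg.n = n -> reg st Reg.r < n -> list_cost (answer st) <= L ->
  exec O compute_d st (U + (U + ((U + (bitlen n).*2.+1 * (U + (U + (U + U)))) + U)))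
    (fun s => output s = gcdn (reg st Reg.r - 1) n).
Proof.
move=> stn rn lst; have L0 := L_gt0; set g := gcdn _ _; set r := reg st Reg.r in rn g *.
(* The potential is the product a b: for a >= b it is more than halved by (a, b) -> (b, a mod b). A
   step with a < b merely swaps the two, which can occur only at the start and costs the extra
   unit. *)
pose I k s := [/\ list_cost (answer s) <= L, gcdn (reg s Reg.a) (reg s Reg.b) = g,
  reg s Reg.a <= n, reg s Reg.b <= n & (reg s Reg.a < reg s Reg.b) <= k /\
  reg s Reg.a * reg s Reg.b < 2 ^ (k - (reg s Reg.a < reg s Reg.b))].
apply: (exec_seq (P1 :=
    fun s => [/\ list_cost (answer s) <= L, reg s Reg.n = n & reg s Reg.a = r - 1]) (leqnn _)).
  by apply: exec_set; first by apply: expr_cost; rewrite //= -/r; lia.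
move=> s1 [l1 s1n s1a]; apply: (exec_seq (P1 := I (bitlen n).*2.+1) (leqnn _)).
  apply: exec_set; first by apply: expr_cost; rewrite //= s1n; lia.
  split=> //=; rewrite ?s1a ?s1n//; [lia|].
  have -> : r - 1 < n by lia.
  split=> //; have -> : (bitlen n).*2.+1 - true = bitlen n + bitlen n by lia.
  rewrite expnD.
  have := ltn_bitlen n; nia.
move=> s2 Is2; apply: (exec_seq (P1 :=
    fun s => [/\ list_cost (answer s) <= L, reg s Reg.a = g & reg s Reg.a <= n]) (leqnn _)).
  apply: (exec_while (I := I) _ (leqnn _) (k := (bitlen n).*2.+1)) (leqnn _) Is2 => k s.
  case=> ls sg sa sb [sk sab]; split.
    by apply/ltnW/expr_cost; rewrite //=; lia.
  case: (posnP (reg s Reg.b)) => b0; [left|right].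
    by split=> //; split=> //; move: sg; rewrite b0 gcdn0.
  have k0 : 0 < k.
    rewrite lt0n; apply/eqP => k0; move: sk sab; rewrite k0; case: ltnP => //= ba _.
    by rewrite subn0 expn0 ltnS leqn0 muln_eq0; lia.
  exists k.-1; split; [by rewrite prednK|by []|].
  set a := reg s Reg.a in sg sa sk sab; set b := reg s Reg.b in sg sb sk sab b0.
  apply: (exec_seq (P1 :=
      fun s => [/\ list_cost (answer s) <= L, reg s Reg.a = a, reg s Reg.b = b & reg s Reg.t = a %% b]) (leqnn _)).
    apply: exec_set; last by split.
    by apply: expr_cost; rewrite //= -/a -/b; have := leq_mod a b; lia.
  move=> s3 [l3 a3 b3 t3].
  apply: (exec_seq (P1 :=
      fun s => [/\ list_cost (answer s) <= L, reg s Reg.a = b & reg s Reg.t = a %% b]) (leqnn _)).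
    apply: exec_set; last by split.
    by apply: expr_cost; rewrite //= b3; lia.
  move=> s4 [l4 a4 t4]; have ltab := ltn_pmod a b0; have leab := leq_mod a b.
  apply: exec_set; first by apply: expr_cost; rewrite //= t4; lia.
  split=> //=; rewrite ?a4 ?t4//; [by rewrite gcdnC gcdn_modl|lia|].
  rewrite ltnNge (ltnW ltab) /=; split=> //; rewrite subn0.
  case: (ltnP a b) sab => ab; rewrite /= ?subn0 => sab.
    by rewrite modn_small// mulnC -subn1.
  have := divn_eq a b; have : 0 < a %/ b by rewrite divn_gt0.
  rewrite -(prednK k0) expnS in sab; nia.
move=> s3 [l3 a3 a3n]; apply: exec_set; first by apply: expr_cost; rewrite //=; lia.
by rewrite /output /= a3.
Qed.

End Algorithm.

(** * From residue classes to a prime factor; assembling the polynomial bounds *)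

Section Factoring.
Local Open Scope nat_scope.

Lemma prime_dvd_semiprime p q g : prime p -> prime q -> g %| p * q ->
  g != 1 -> g != p * q -> prime g.
Proof.
move=> pp qp gn g1 gpq; have [pg|npg] := boolP (p %| g).
  case/dvdnP: pg gn g1 gpq => k ->; rewrite mulnC dvdn_pmul2l ?prime_gt0// => kq.
  case/primeP: qp => _ /(_ k kq) /orP[] /eqP ->; first by rewrite muln1.
  by rewrite eqxx.
have co : coprime g p by rewrite coprime_sym prime_coprime.
rewrite Gauss_dvdr// in gn; case/primeP: (qp) => _ /(_ g gn) /orP[]; first by rewrite (negPf g1).
by move=> /eqP ->.
Qed.

(** The gcd is 1 only if r divides m + 1, by [prime_dvd_exp1], and n only if r = 1 modulo n; both
    classes are excluded. *)
Lemma prime_gcd_factor p q m r : prime p -> prime q -> p < q ->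
  prime r -> r %| m ^ (p * q) + 1 ->
  r %% (p * q) \notin 1 %% (p * q) :: S_classes (p * q) m ->
  prime (gcdn (r %% (p * q) - 1) (p * q)).
Proof.
move=> pp qp pq rp rm; set n := p * q; rewrite inE negb_or => /andP[r1 rS].
have n0 : 0 < n by rewrite muln_gt0 !prime_gt0.
(* For class 0 the truncated subtraction would compute 0 instead of -1; it cannot occur, as the
   prime r would be divisible by both p and q. *)
have x0 : 0 < r %% n.
  rewrite lt0n; apply/negP => nr.
  have : p %| r by apply: dvdn_trans nr; exact: dvdn_mulr.
  have : q %| r by apply: dvdn_trans nr; exact: dvdn_mull.
  by rewrite !dvdn_prime2// => /eqP qr /eqP pr; lia.
have -> : gcdn (r %% n - 1) n = gcdn r.-1 n.
  have -> : r.-1 = r %/ n * n + (r %% n - 1) by have := divn_eq r n; lia.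
  by rewrite [RHS]gcdnC gcdnMDl gcdnC.
apply: (prime_dvd_semiprime pp qp); first exact: dvdn_gcdr.
- apply: contra rS => g1; apply/mapP; exists r => //.
  rewrite mem_primes rp addn1 /= -addn1; apply: (prime_dvd_exp1 rp n0 rm).
  by rewrite coprime_sym.
- apply: contra r1 => /eqP E; rewrite eqn_mod_dvd ?prime_gt0// subn1.
  by rewrite /n -E dvdn_gcdl.
Qed.

Lemma admissible_singleton n m r : prime r -> r %| m ^ n + 1 ->
  r %% n \notin 1 %% n :: S_classes n m -> admissible n m [:: r %% n].
Proof.
move=> rp rm rS; split=> // [x|sub].
  rewrite inE => /eqP ->; apply/mapP; exists r => //.
  by rewrite mem_primes rp addn1 /= -addn1.
by move/negP: rS; apply; apply: sub; rewrite inE.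
Qed.

(** The case p = 2: 5 = 2^2 + 1 divides 4^q + 1 for odd q, and 2 q > 5 keeps the classes 1, 3 and 5
    apart. *)
Lemma admissible_double q : prime q -> 2 < q -> admissible (2 * q) 2 [:: 5 %% (2 * q)].
Proof.
move=> qp q2; apply: admissible_singleton => //.
  have qo : odd q by have := even_prime qp; case: (odd q) => // -[]; lia.
  rewrite expnM -[q]odd_double_half qo -[2 ^ 2]/4 add1n -exp_odd_succ//.
  by rewrite dvdn_mulr.
rewrite /S_classes -[primes (2 + 1)]/[:: 3] /= !inE !modn_small//; lia.
Qed.

Lemma leq_exp_base a b e : a <= b -> a ^ e <= b ^ e.
Proof. by case: e => // e; rewrite leq_exp2r. Qed.

Lemma horner_nat_mono (P : {poly nat}) a b : a <= b -> P.[a]%R <= P.[b]%R.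
Proof.
move=> ab; rewrite !horner_coef.
elim/big_ind2: _ => [//|x1 x2 y1 y2 h1 h2|i _]; first exact: leq_add.
by rewrite !(natrDE, natrME, natrXE) leq_mul// leq_exp_base.
Qed.

Lemma admissible_exists (R : realType) : GRH R -> exists Y : {poly nat},
  forall n, rsa_modulus n ->
    exists2 m, 1 < m <= Y.[bitlen n]%R & exists A, admissible n m A.
Proof.
move=> /good_exists[c0 H].
have [D HD] : exists D, forall k, 9 * (802 * (4 * k).*2) = k * D.
  by exists (9 * (802 * (2 * 4))) => k; rewrite -mul2n [RHS]mulnC !mulnA.
(* As 2^(bitlen x) <= 2 x for x > 0, the doubly logarithmic exponent becomes a power of [bitlen n];
   the summand 2 admits m = 2 when p = 2. *)
pose Y : {poly nat} := (((2 ^ c0 * 2)%N%:P * 'X) ^+ D + 2%N%:P)%R.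
have YE x : Y.[x]%R = (2 ^ c0 * 2 * x) ^ D + 2 by rewrite /Y !hornerE !(natrDE, natrME, natrXE).
exists Y => n [p [q [pp qp pq ->]]]; rewrite YE.
have [p2|podd] := even_prime pp.
  exists 2; first by rewrite leq_addl.
  by exists [:: 5 %% (p * q)]; rewrite p2; apply: admissible_double => //; rewrite -p2.
have [m mY gm] := H p q pp podd qp pq; exists m.
  have /and5P[-> _ _ _ _] := gm; apply: leq_trans mY _; apply: leq_trans (leq_addr 2 _).
  rewrite HD expnM leq_exp_base// expnD -mulnA leq_mul2l; apply/orP; right.
  rewrite /bitlen expnS leq_mul2l /=; apply: leq_trans (trunc_logP _ _) _ => //.
  by rewrite ltnS leq_trunc_log// leq_pmull// prime_gt0.
have [r [rp rm rS]] := good_factor pp podd qp gm.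
by exists [:: r %% (p * q)]; exact: admissible_singleton.
Qed.

(** Stated over a semiring so that one formula gives both the polynomial and, by evaluation, the
    number of operations; [b + b + 1] counts the Euclidean steps. *)
Definition total_cost (A : pzSemiRingType) (b u y s : A) : A :=
  (u + (u + (u + y * (u + (u + u)))) +
   (u + (u + (u + s * (u + (u + ((u + (u + (u + y * (u + (u + ((u + y * (u + u)) +
     ((u + (u + (u + u))) + u))))))) + u))))) +
    (u + (u + ((u + (b + b + 1) * (u + (u + (u + u)))) + u)))))%R.

Lemma horner_total_cost (B U Y S : {poly nat}) x :
  (total_cost B U Y S).[x]%R = total_cost B.[x]%R U.[x]%R Y.[x]%R S.[x]%R.
Proof. by rewrite /total_cost !(hornerD, hornerM) hornerC. Qed.

End Factoring.

Theorem theorem5 (R : realType) (Q : {poly nat}) :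
  GRH R ->
  exists P : {poly nat},
    forall (n : nat) (O : oracle), rsa_modulus n -> oracle_spec Q n O ->
      exists (st : state) (t : nat),
        [/\ run O algorithm (input n) st t,
            (t <= P.[bitlen n]%R)%N,
            prime (output st)
          & (output st %| n)%N].
Proof.
move=> /admissible_exists[Yp HY].
(* Answer sizes: every m that is tried satisfies [bitlen m <= m + 1 <= Y + 1], and [Q] is
   monotone. *)
pose Sp : {poly nat} := (Q \Po ('X + Yp + 1%N%:P))%R.
(* One unit covering both [bitlen V ^ 2] and the reading of an answer, which has at most S entries
   below n. *)
pose Lp : {poly nat} := ((Sp + 1%N%:P) * ('X + (Yp + Sp + 4%N%:P)) ^+ 2)%R.
pose U : {poly nat} := (8%N%:P * Lp)%R.
exists (total_cost 'X%R U Yp Sp) => n O rsa spec; have [m0 m0Y [A0 adm0]] := HY n rsa.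
have [p [q [pp qp pq nE]]] := rsa.
pose Y := Yp.[bitlen n]%R; pose S := Sp.[bitlen n]%R; pose L := Lp.[bitlen n]%R.
(* Exceeds every value that arises: residues modulo n, candidates up to Y + 3, and indices up to S +
   1. *)
pose V := (n + (Y + S + 3))%N.
have n1 : (1 < n)%N by rewrite nE; have := prime_gt1 pp; have := prime_gt1 qp; nia.
have SE : S = Q.[bitlen n + Y + 1]%R by rewrite /S /Sp horner_comp !hornerE.
have LE : L = ((S + 1) * (bitlen n + (Y + S + 4)) ^ 2)%N.
  by rewrite /L /Lp !hornerE !(natrDE, natrME, natrXE).
have VB : (bitlen V <= bitlen n + (Y + S + 4))%N.
  by apply: leq_trans (bitlenD _ _) _; rewrite leq_add2l; apply: leq_trans (bitlen_leS _) _; lia.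
have VL : (bitlen V ^ 2 <= L)%N.
  by rewrite LE -[leqLHS]mul1n leq_mul ?leq_exp2r// addn1.
have spec_some m (A : seq nat) : (1 < m)%N -> O (Defs.code n) m = Some A ->
    admissible n m A /\ (size A <= Q.[bitlen n + bitlen m]%R)%N.
  by move=> m1 E; have := spec m m1; rewrite E.
have HS m : (1 < m <= Y)%N -> (size (odflt [::] (O (Defs.code n) m)) <= S)%N.
  case/andP => m1 mY; case E : (O _ _) => [A|//=]; have [_ /leq_trans] := spec_some m A m1 E.
  apply; rewrite SE; apply: horner_nat_mono; rewrite !(natrDE, natrME, natrXE) -addnA leq_add2l.
  by rewrite addn1 (leq_trans (bitlen_leS m)).
have Hn m : (1 < m <= Y)%N -> all (fun x => x < n)%N (odflt [::] (O (Defs.code n) m)).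
  case/andP => m1 mY; case E : (O _ _) => [A|//=]; have [[_ sub _] _] := spec_some m A m1 E.
  by apply/allP => x /sub /mapP[r _ ->]; rewrite ltn_pmod// ltnW.
have HL m : (1 < m <= Y)%N -> (list_cost (odflt [::] (O (Defs.code n) m)) <= L)%N.
  move=> mY; have := HS m mY; have := Hn m mY; move: (odflt _ _) => A An AS.
  rewrite /list_cost; apply: (@leq_trans (size A * bitlen n).+1).
    rewrite ltnS -sum1_size big_distrl /= big_seq [leqRHS]big_seq.
    by apply: leq_sum => x xA; rewrite mul1n leq_bitlen// ltnW// (allP An).
  rewrite LE; set B := (bitlen n + _)%N.
  have h1 : (size A * bitlen n <= S * B)%N by rewrite leq_mul// leq_addr.
  have B0 : (0 < B)%N by rewrite addn_gt0.
  rewrite mulnDl mul1n -addn1 leq_add ?expn_gt0 ?B0//; apply: leq_trans h1 _.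
  by rewrite leq_mul2l -mulnn leq_pmulr ?orbT.
have om0 : O (Defs.code n) m0 <> None.
  move=> E; case/andP: m0Y => m01 _; have := spec m0 m01.
  by rewrite E => /(_ A0); apply.
have nV : (n <= V)%N by rewrite leq_addr.
have YV : (Y + 3 <= V)%N by rewrite /V; lia.
have SV : (S < V)%N by rewrite /V; lia.
have h1 := find_m_exec n1 nV YV SV VL HL (st := input n) erefl erefl m0Y om0.
pose u := (8 * L)%N.
pose T1 := (u + (u + (u + Y * (u + (u + u)))))%N.
pose T2 := (u + (u + (u + S * (u + (u + ((u + (u + (u + Y * (u + (u + ((u + Y * (u + u)) +
    ((u + (u + (u + u))) + u))))))) + u))))))%N.
pose T3 := (u + (u + ((u + (bitlen n).*2.+1 * (u + (u + (u + u)))) + u)))%N.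
have PE : (total_cost 'X%R U Yp Sp).[bitlen n]%R = (T1 + (T2 + T3))%N.
  have UE : U.[bitlen n]%R = u by rewrite /U hornerM hornerC.
  rewrite horner_total_cost hornerX -/Y -/S UE /total_cost !(natrDE, natrME).
  by rewrite /T1 /T2 /T3 -addnn -addn1.
have [st [t [rt tT [op od]]]] : exec O algorithm (input n) (total_cost 'X%R U Yp Sp).[bitlen n]%R
    (fun st => prime (output st) /\ (output st %| n)%N).
  rewrite PE; apply: (exec_seq (leqnn _) h1) => st1 [m mY [A OA [n1' m1' a1']]].
  have /andP[m1 _] := mY; have [[_ sub nsub] _] := spec_some m A m1 OA.
  have h2 := find_r_exec n1 nV YV SV VL HS HL Hn mY OA nsub n1' m1' a1'.
  apply: (exec_seq (leqnn _) h2) => st2 [n2' rA rS l2].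
  have rn : (reg st2 Reg.r < n)%N by have /allP := Hn m mY; rewrite OA; exact.
  have h3 := compute_d_exec O n1 nV YV SV VL n2' rn l2.
  apply: exec_weaken (leqnn _) _ h3 => st3 ->; split; last exact: dvdn_gcdr.
  have /mapP[r] := sub _ rA; rewrite mem_primes => /and3P[rp _ rd] rE.
  rewrite rE nE in rS *; rewrite nE in rd.
  exact: (prime_gcd_factor pp qp pq rp rd rS).
by exists st, t.
Qed.
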